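(* Let $\Omega\subset\mathbb{R}^2$ be a planar convex bounded open set and $B$ an open disk with the same area. Then, for any $\tau\geq0$, the inequality $$\Gamma(\Omega,\tau)\geq\Gamma(B,\tau)$$ holds as long as $$\frac{\pi|\partial\Omega|^2}{16|\Omega|}>\gamma_0^2\,\frac{J_{1}(\gamma_0)^2}{J_0(\gamma_0)^2}\simeq 6.92801 .$$
   Context: For $\tau\in\mathbb{R}$ and an open set $\Omega\subset\mathbb{R}^d$ of finite volume, $\Gamma(\Omega,\tau)$ denotes the first eigenvalue of $\Delta^2-\tau\Delta$ over $\Omega$ with Dirichlet boundary conditions $u=\partial_nu=0$ on $\partial\Omega$, that is $$\Gamma(\Omega,\tau)=\min_{v\in H_0^2(\Omega),\,v\neq0}\frac{\int_\Omega(\Delta v)^2+\tau\int_\Omega|\nabla v|^2}{\int_\Omega v^2}.$$ $|\partial\Omega|$ is the perimeter and $|\Omega|$ the area of $\Omega$. $J_\mu$ and $I_\mu$ are the Bessel and modified Bessel functions of the first kind of order $\mu$, and $\gamma_0\simeq3.19622$ is the smallest positive zero of $r\mapsto\left[\frac{J_1(r)}{J_0(r)}+\frac{I_1(r)}{I_0(r)}\right]r$. *)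

(* Defs.v *)
From HB Require Import structures.
From mathcomp Require Import all_boot all_order all_algebra.
From mathcomp Require Import all_classical all_reals all_analysis.
Set Implicit Arguments.
Unset Strict Implicit.
Unset Printing Implicit Defensive.
Import Order.TTheory GRing.Theory Num.Theory.
Import numFieldNormedType.Exports.
Local Open Scope classical_set_scope.
Local Open Scope ring_scope.

(* The plane is R * R. Its library norm is the max norm, which gives the usual
   topology and the usual bounded sets; Euclidean quantities (disks, |grad v|,
   unit vector fields) are written out with sums of squares. *)

Definition leb2 (R : realType) :
  {measure set (measurableTypeR R * measurableTypeR R) -> \bar R} :=
  (@lebesgue_measure R \x @lebesgue_measure R)%E.

Definition open_disk (R : realType) (c : R * R) (r : R) : set (R * R) :=
  [set p | (p.1 - c.1) ^+ 2 + (p.2 - c.2) ^+ 2 < r ^+ 2].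

Definition area (R : realType) (Omega : set (R * R)) : R :=
  fine (leb2 R Omega).

Definition axis (R : realType) (i : 'I_2) : R * R :=
  ((i == 0)%:R, (i == 1)%:R).

Definition partial (R : realType) (i : 'I_2) (f : R * R -> R) : R * R -> R :=
  fun p => 'D_(axis R i) f p.

(* partials [:: i; j] f is d_i d_j f, and partials [::] f is f. *)
Definition partials (R : realType) (s : seq 'I_2) (f : R * R -> R) :
  R * R -> R := foldr (@partial R) f s.

Definition smooth (R : realType) (f : R * R -> R) : Prop :=
  forall s : seq 'I_2, continuous (partials s f) /\
    forall (i : 'I_2) (p : R * R), derivable (partials s f) p (axis R i).

(* C_c^oo(Omega), each function being extended by zero to the plane. *)
Definition test_function (R : realType) (Omega : set (R * R))
    (phi : R * R -> R) : Prop :=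
  [/\ smooth phi,
      compact (closure [set p | phi p != 0]) &
      closure [set p | phi p != 0] `<=` Omega].

Definition L2 (R : realType) (Omega : set (R * R)) (f : R * R -> R) : Prop :=
  measurable_fun Omega f /\
  (leb2 R).-integrable Omega (fun p => (f p ^+ 2)%:E).

Definition weak_partials (R : realType) (Omega : set (R * R)) (s : seq 'I_2)
    (f g : R * R -> R) : Prop :=
  forall phi : R * R -> R, test_function Omega phi ->
    \int[leb2 R]_(p in Omega) (f p * partials s phi p) =
    (-1) ^+ size s * \int[leb2 R]_(p in Omega) (g p * phi p).

(* v lies in H^2(Omega), and D s is its weak derivative along the list of
   directions s, for all s of length at most 2; D is irrelevant elsewhere. *)
Definition H2 (R : realType) (Omega : set (R * R)) (v : R * R -> R)
    (D : seq 'I_2 -> R * R -> R) : Prop :=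
  D [::] = v /\
  forall s : seq 'I_2, (size s <= 2)%N ->
    L2 Omega (D s) /\ weak_partials Omega s v (D s).

(* H_0^2(Omega) is the closure of C_c^oo(Omega) in H^2(Omega). *)
Definition H20 (R : realType) (Omega : set (R * R)) (v : R * R -> R)
    (D : seq 'I_2 -> R * R -> R) : Prop :=
  H2 Omega v D /\
  exists phi : nat -> R * R -> R,
    (forall n, test_function Omega (phi n)) /\
    forall s : seq 'I_2, (size s <= 2)%N ->
      (\int[leb2 R]_(p in Omega) ((partials s (phi n) p - D s p) ^+ 2)%:E)%E
        @[n --> \oo] --> 0%E.

Definition laplacian (R : realType) (D : seq 'I_2 -> R * R -> R) :
  R * R -> R := fun p => \sum_(i < 2) D [:: i; i] p.

Definition grad_sqr (R : realType) (D : seq 'I_2 -> R * R -> R) :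
  R * R -> R := fun p => \sum_(i < 2) D [:: i] p ^+ 2.

Definition rayleigh (R : realType) (Omega : set (R * R)) (tau : R)
    (v : R * R -> R) (D : seq 'I_2 -> R * R -> R) : R :=
  (\int[leb2 R]_(p in Omega) (laplacian D p ^+ 2) +
   tau * \int[leb2 R]_(p in Omega) grad_sqr D p) /
  \int[leb2 R]_(p in Omega) (v p ^+ 2).

(* v <> 0 is meant in L^2(Omega). The minimum over H_0^2(Omega) \ {0} is
   attained when Omega is open, nonempty and of finite volume, so it is the
   infimum. *)
Definition Gamma (R : realType) (Omega : set (R * R)) (tau : R) : R :=
  inf [set q | exists (v : R * R -> R) (D : seq 'I_2 -> R * R -> R),
    [/\ H20 Omega v D,
        ~ {ae leb2 R, forall p, Omega p -> v p = 0} &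
        q = rayleigh Omega tau v D]].

(* De Giorgi's perimeter: the supremum of the integrals over Omega of div X,
   for X in C_c^oo(R^2; R^2) with |X| <= 1. For a bounded convex open set it
   is finite and equal to the length of the boundary. *)
Definition perimeter (R : realType) (Omega : set (R * R)) : R :=
  fine (ereal_sup
    [set (\int[leb2 R]_(p in Omega)
            (\sum_(i < 2) partial i (X i) p)%:E)%E |
     X in [set X : 'I_2 -> R * R -> R |
       (forall i, test_function setT (X i)) /\
       forall p, \sum_(i < 2) X i p ^+ 2 <= 1]]).

(* Bessel functions of integer order, by their power series. *)
Definition besselJ (R : realType) (n : nat) (x : R) : R :=
  limn (series (fun k : nat =>
    (-1) ^+ k / (k`! * (k + n)`!)%N%:R * (x / 2) ^+ (2 * k + n)%N)).

Definition besselI (R : realType) (n : nat) (x : R) : R :=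
  limn (series (fun k : nat =>
    ((k`! * (k + n)`!)%N%:R)^-1 * (x / 2) ^+ (2 * k + n)%N)).

(* r is a zero of r |-> [J_1(r)/J_0(r) + I_1(r)/I_0(r)] r, a function defined
   where J_0 does not vanish; I_0 >= 1 on the real line. *)
Definition plate_zero (R : realType) (r : R) : Prop :=
  besselJ 0 r != 0 /\
  (besselJ 1 r / besselJ 0 r + besselI 1 r / besselI 0 r) * r = 0.

Definition smallest_positive_plate_zero (R : realType) (g : R) : Prop :=
  [/\ 0 < g, plate_zero g & forall r : R, 0 < r -> plate_zero r -> g <= r].

(* Main.v *)
Require Import Defs.
From HB Require Import structures.
From mathcomp Require Import all_boot all_order all_algebra.
From mathcomp Require Import all_classical all_reals all_analysis.
From mathcomp Require Import measurable_realfun ring lra zify.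
Set Implicit Arguments.
Unset Strict Implicit.
Unset Printing Implicit Defensive.
Import Order.TTheory GRing.Theory Num.Theory.
Import numFieldNormedType.Exports.
Local Open Scope classical_set_scope.
Local Open Scope ring_scope.

(** A single trial function bounds [Gamma] on the disk by an affine function of [tau], and the two
    energy bounds on [Omega] give an affine lower bound, so comparing coefficients settles every
    [tau >= 0] at once. On the unit disk the limiting trial function has Dirichlet quotient 20/3 and
    bending quotient 320/3. Hersch's bound beats the former when (pi r / rho)^2 >= 4 * 20/3 = 26.67,
    while the hypothesis gives 4 * 6.76 = 27.04; this narrow margin has to pay for the mollification
    and for staying strictly below the pole of the tangent. The value 6.76 = 2.6^2 is accessible
    because J_1/J_0 = - I_1/I_0 at a zero, which expresses K through series with positive terms. De
    Giorgi's perimeter offers no boundary to integrate over. The bound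
    [perimeter Omega * rho <= 2 * A] comes from displacing points by e X with |X| <= 1: as [Omega]
    contains a disk of radius rho, the points within e of [Omega] lie in its homothetic image of
    ratio 1 + e / rho, and the first order in e compares the integral of div X with 2 A / rho. *)

(** Let [rho] be the inradius of [Omega], [A] its area and [r] the radius of the
    disk. As [perimeter Omega * rho <= 2 * A], the hypothesis says that [Omega]
    is elongated: [A > 4 * K * rho ^+ 2 / pi] with [K >= 6.76], so that [r] is
    large compared with [rho], and it is then enough to compare the bending and
    the Dirichlet energies separately. The points where the boundary touches a
    largest inscribed disk yield three half-planes containing [Omega], at
    distance [rho] from the center, whose unit normals have [0] as a convex
    combination. Cutting the plane according to the nearest of the three lines
    and integrating along its normal gives Hersch's inequality, i.e. the Dirichlet
    bound [(pi / (2 * rho)) ^+ 2]. As [A / rho ^+ 2] is large, one of the weights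
    of the combination is at least [0.43]; hence [Omega] lies in a strip of width
    at most [rho / 0.43], which bounds the bending energy from below by a
    one-dimensional inequality for clamped functions. On the disk, mollified
    versions of the trial function [(r ^+ 2 - |x| ^+ 2) ^+ 2] have smaller
    energies. *)

(** * Lebesgue measure in the plane: affine changes of variables *)

Section Measure.
Context {R : realType}.
Notation mR := (measurableTypeR R).
Notation mu := (@lebesgue_measure R).

(** The sigma-algebra of the plane is generated by rectangles; an open set belongs to it as the
    countable union of the rational boxes that it contains. *)
Lemma open_measurable2 (A : set (R * R)) : open A -> measurable (A : set (mR * mR)).
Proof.
move=> oA.
pose box (q : (rat * rat) * (rat * rat)) : set (mR * mR) :=
  `]ratr q.1.1, ratr q.1.2[%classic `*` `]ratr q.2.1, ratr q.2.2[%classic.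
pose boxA q : set (mR * mR) := if `[< box q `<=` A >] then box q else set0.
have -> : A = \bigcup_q boxA q.
  apply/seteqP; split => [p Ap|p [q _]]; last first.
    by rewrite /boxA; case: asboolP => // + pq; exact.
  have [e /= e0 pe] := (nbhs_ballP _ _).1 (oA _ Ap).
  have [a1 a1p] := rat_in_itvoo (ltac:(lra) : p.1 - e < p.1).
  have [b1 b1p] := rat_in_itvoo (ltac:(lra) : p.1 < p.1 + e).
  have [a2 a2p] := rat_in_itvoo (ltac:(lra) : p.2 - e < p.2).
  have [b2 b2p] := rat_in_itvoo (ltac:(lra) : p.2 < p.2 + e).
  rewrite !in_itv/= in a1p b1p a2p b2p.
  exists ((a1, b1), (a2, b2)) => //; rewrite /boxA asboolT.
    by split; rewrite /= in_itv/=; apply/andP; split; lra.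
  move=> q [/=]; rewrite !in_itv/= => h1 h2; apply: pe; split => /=;
    rewrite /ball/= ltr_norml; apply/andP; split; lra.
apply: countable_bigcupT_measurable => // q; rewrite /boxA.
by case: asboolP => // _; apply: measurableX; exact: measurable_itv.
Qed.

Lemma continuous_measurable2 (f : R * R -> R) : continuous f ->
  measurable_fun [set: mR * mR] f.
Proof.
move=> /continuousP cf; apply: (measurability _ (RGenOpens.measurableE R)).
move=> _ [_ [a [b ->] <-]]; rewrite setTI; apply: open_measurable2.
exact/cf/interval_open.
Qed.

Local Open Scope ereal_scope.

(** The image measure, rescaled by [k], gives half-open intervals their length, and this
    characterizes Lebesgue measure. *)
Lemma ge0_integral_affine (k a : R) (f : mR -> \bar R) : (0 < k)%R ->
  measurable_fun [set: mR] f -> (forall x, 0 <= f x) ->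
  k%:E * \int[mu]_x f (k * x + a)%R = \int[mu]_x f x.
Proof.
move=> k0 mf f0.
pose phi (x : mR) : mR := (k * x + a)%R.
have mphi : measurable_fun setT phi.
  by apply: continuous_measurable_fun => x; apply: cvgD; [apply: cvgM; [exact: cvg_cst|exact: cvg_id]|exact: cvg_cst].
pose K : {nonneg R} := NngNum (ltW k0).
have E A : measurable A -> mu A = mscale K (pushforward mu phi) A.
  apply: lebesgue_measure_unique => _ [[x y] _ <-]; change (mu `]x, y]%classic = k%:E * mu (phi @^-1` `]x, y]%classic)).
  have -> : phi @^-1` `]x, y]%classic = `]((x - a) / k)%R, ((y - a) / k)%R]%classic.
    apply/seteqP; split => z /=; rewrite !in_itv/= /phi ltr_pdivrMr// ler_pdivlMr// (mulrC z);
      by move=> /andP[? ?]; apply/andP; split; lra.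
  rewrite !lebesgue_measure_itv/= !lte_fin ltr_pM2r ?invr_gt0// ltrD2r.
  case: ifPn => xy; last by rewrite mule0.
  by rewrite -EFinM; congr (_%:E); field; rewrite gt_eqF.
rewrite [RHS](eq_measure_integral (mscale K (pushforward mu phi))); last by move=> A mA _; exact: E.
rewrite ge0_integral_mscale//= ge0_integral_pushforward//.
Qed.

Lemma ge0_integral_translate (a : R) (f : mR -> \bar R) :
  measurable_fun [set: mR] f -> (forall x, 0 <= f x) ->
  \int[mu]_x f (x + a)%R = \int[mu]_x f x.
Proof.
move=> mf f0; rewrite -(ge0_integral_affine (k := 1) a ltr01 mf)// mul1e.
by apply: eq_integral => x _; rewrite mul1r.
Qed.

Notation mu2 := (leb2 R).

Section plane.
Variable f : mR * mR -> \bar R.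
Hypotheses (mf : measurable_fun [set: mR * mR] f) (f0 : forall p, 0 <= f p).

Lemma tonelli1 : \int[mu2]_p f p = \int[mu]_x \int[mu]_y f (x, y).
Proof. exact: fubini_tonelli1. Qed.

Lemma tonelli2 : \int[mu2]_p f p = \int[mu]_y \int[mu]_x f (x, y).
Proof. exact: fubini_tonelli2. Qed.

Lemma measurable_section1 y : measurable_fun [set: mR] (fun x => f (x, y)).
Proof. by apply: measurableT_comp => //; exact: measurable_fun_pair. Qed.

Lemma measurable_section2 x : measurable_fun [set: mR] (fun y => f (x, y)).
Proof. by apply: measurableT_comp => //; exact: measurable_fun_pair. Qed.
End plane.

Lemma measurable_comp2 (f : mR * mR -> \bar R) (g h : mR * mR -> mR) :
  measurable_fun [set: mR * mR] f -> measurable_fun [set: mR * mR] g ->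
  measurable_fun [set: mR * mR] h ->
  measurable_fun [set: mR * mR] (fun p => f (g p, h p)).
Proof.
move=> mf mg mh; exact: (measurableT_comp mf (measurable_fun_pair mg mh)).
Qed.

Lemma measurable_lin (a b c : R) :
  measurable_fun [set: mR * mR] (fun p : R * R => a * p.1 + b * p.2 + c)%R.
Proof.
apply: continuous_measurable2 => p; apply: cvgD; last exact: cvg_cst.
by apply: cvgD; apply: cvgM; (try exact: cvg_cst); [exact: cvg_fst|exact: cvg_snd].
Qed.

(** On each horizontal slice a shear is a translation, so Tonelli's theorem reduces it to dimension
    one. *)
Lemma ge0_integral_shear1 (a b : R) (f : mR * mR -> \bar R) :
  measurable_fun [set: mR * mR] f -> (forall p, 0 <= f p) ->
  \int[mu2]_p f (p.1 + (a * p.2 + b), p.2)%R = \int[mu2]_p f p.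
Proof.
move=> mf f0.
have mg : measurable_fun [set: mR * mR] (fun p => f (p.1 + (a * p.2 + b), p.2)%R).
  apply: (measurable_comp2 (g := fun p => p.1 + (a * p.2 + b))%R) => //.
  by rewrite (_ : (fun _ => _) = (fun p : R * R => 1 * p.1 + a * p.2 + b)%R);
    [exact: measurable_lin|apply/funext => p; rewrite mul1r addrA].
rewrite (tonelli2 mg (fun p => f0 _)) (tonelli2 mf f0).
apply: eq_integral => y _ /=.
exact: (ge0_integral_translate (a * y + b) (measurable_section1 mf y)).
Qed.

Lemma ge0_integral_shear2 (a b : R) (f : mR * mR -> \bar R) :
  measurable_fun [set: mR * mR] f -> (forall p, 0 <= f p) ->
  \int[mu2]_p f (p.1, p.2 + (a * p.1 + b))%R = \int[mu2]_p f p.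
Proof.
move=> mf f0.
have mg : measurable_fun [set: mR * mR] (fun p => f (p.1, p.2 + (a * p.1 + b))%R).
  apply: (measurable_comp2 (h := fun p => p.2 + (a * p.1 + b))%R) => //.
  by rewrite (_ : (fun _ => _) = (fun p : R * R => a * p.1 + 1 * p.2 + b)%R);
    [exact: measurable_lin|apply/funext => p; ring].
rewrite (tonelli1 mg (fun p => f0 _)) (tonelli1 mf f0).
apply: eq_integral => x _ /=.
exact: (ge0_integral_translate (a * x + b) (measurable_section2 mf x)).
Qed.

Lemma ge0_integral_dilate (k : R) (f : mR * mR -> \bar R) : (0 < k)%R ->
  measurable_fun [set: mR * mR] f -> (forall p, 0 <= f p) ->
  (k ^+ 2)%:E * \int[mu2]_p f (k * p.1, k * p.2)%R = \int[mu2]_p f p.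
Proof.
move=> k0 mf f0.
have ml (g : R * R -> R) : (exists a b, g = (fun p => a * p.1 + b * p.2 + 0)%R) ->
    measurable_fun [set: mR * mR] g by move=> [a [b ->]]; exact: measurable_lin.
have m1 : measurable_fun [set: mR * mR] (fun p : R * R => k * p.1)%R.
  by apply: ml; exists k, 0%R; apply/funext => p; ring.
have m2 : measurable_fun [set: mR * mR] (fun p : R * R => k * p.2)%R.
  by apply: ml; exists 0%R, k; apply/funext => p; ring.
rewrite tonelli1//; last exact: measurable_comp2.
rewrite [RHS](tonelli1 mf f0) -[RHS](ge0_integral_affine (k := k) 0 k0); last first.
- by move=> x; exact: integral_ge0.
- exact: (measurable_fun_fubini_tonelli_F (m2 := mu) _ mf).
rewrite expr2 EFinM -muleA; congr (_ * _).
rewrite -ge0_integralZl//; last first.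
- by rewrite lee_fin ltW.
- by move=> x _; exact: integral_ge0.
- exact: (measurable_fun_fubini_tonelli_F (m2 := mu) _ (measurable_comp2 mf m1 m2)).
apply: eq_integral => x _ /=; rewrite addr0.
rewrite -(ge0_integral_affine 0 k0 (measurable_section2 mf _))//.
by congr (_ * _); apply: eq_integral => y _; rewrite addr0.
Qed.

Lemma ge0_integral_translate2 (a b : R) (f : mR * mR -> \bar R) :
  measurable_fun [set: mR * mR] f -> (forall p, 0 <= f p) ->
  \int[mu2]_p f (p.1 + a, p.2 + b)%R = \int[mu2]_p f p.
Proof.
move=> mf f0; rewrite -[RHS](ge0_integral_shear1 0 a mf f0).
rewrite -[RHS](ge0_integral_shear2 0 b); last 2 first.
- apply: (measurable_comp2 (g := fun p => p.1 + (0 * p.2 + a))%R) => //.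
  by rewrite (_ : (fun _ => _) = (fun p : R * R => 1 * p.1 + 0 * p.2 + a)%R);
    [exact: measurable_lin|apply/funext => p; ring].
- by move=> p; exact: f0.
by apply: eq_integral => p _ /=; rewrite !mul0r !add0r.
Qed.

(** For a unit vector [n], the rotation that takes the second basis vector to [n] and the first one
    to (n.2, - n.1). *)
Definition frame (n : R * R) (p : R * R) : R * R :=
  (n.2 * p.1 + n.1 * p.2, - n.1 * p.1 + n.2 * p.2)%R.

Lemma measurable_frame (f : mR * mR -> \bar R) n :
  measurable_fun [set: mR * mR] f -> measurable_fun [set: mR * mR] (f \o frame n).
Proof.
move=> mf; apply: (measurable_comp2 mf).
- by rewrite (_ : (fun _ => _) = (fun p : R * R => n.2 * p.1 + n.1 * p.2 + 0)%R);
    [exact: measurable_lin|apply/funext => p; ring].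
- by rewrite (_ : (fun _ => _) = (fun p : R * R => - n.1 * p.1 + n.2 * p.2 + 0)%R);
    [exact: measurable_lin|apply/funext => p; ring].
Qed.

(* A rotation that is not +-1 is a product of three shears. *)
Lemma ge0_integral_frame (n : R * R) (f : mR * mR -> \bar R) :
  (n.1 ^+ 2 + n.2 ^+ 2 = 1)%R ->
  measurable_fun [set: mR * mR] f -> (forall p, 0 <= f p) ->
  \int[mu2]_p f (frame n p) = \int[mu2]_p f p.
Proof.
have main m g : (m.1 ^+ 2 + m.2 ^+ 2 = 1)%R -> m.1 != 0%R ->
    measurable_fun [set: mR * mR] g -> (forall p, 0 <= g p) ->
    \int[mu2]_p g (frame m p) = \int[mu2]_p g p.
  (* Writing [m] as (sin a, cos a), [t] is tan (a / 2), and the rotation is composed of the shears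
     of coefficients [t], - sin a and [t]. *)
  move=> m1 m0 mg g0; pose t := ((1 - m.2) / m.1)%R.
  pose g1 p := g (p.1 + (t * p.2 + 0), p.2)%R.
  pose g2 p := g1 (p.1, p.2 + (- m.1 * p.1 + 0))%R.
  have mg1 : measurable_fun [set: mR * mR] g1.
    apply: (measurable_comp2 (g := fun p => p.1 + (t * p.2 + 0))%R) => //.
    by rewrite (_ : (fun _ => _) = (fun p : R * R => 1 * p.1 + t * p.2 + 0)%R);
      [exact: measurable_lin|apply/funext => p; ring].
  have mg2 : measurable_fun [set: mR * mR] g2.
    apply: (measurable_comp2 (h := fun p => p.2 + (- m.1 * p.1 + 0))%R) => //.
    by rewrite (_ : (fun _ => _) = (fun p : R * R => - m.1 * p.1 + 1 * p.2 + 0)%R);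
      [exact: measurable_lin|apply/funext => p; ring].
  rewrite -[RHS](ge0_integral_shear1 t 0 mg g0) -[RHS](ge0_integral_shear2 (- m.1) 0 mg1)//;
    last by move=> p; exact: g0.
  rewrite -[RHS](ge0_integral_shear1 t 0 mg2); last by move=> p; exact: g0.
  have ht : (m.1 * t = 1 - m.2)%R by rewrite mulrCA divff// mulr1.
  have ht2 : (t * (1 + m.2) = m.1)%R.
    by apply: (mulfI m0); rewrite mulrA ht -expr2; lra.
  apply: eq_integral => p _; rewrite /g2 /g1 /frame /=.
  have := congr1 (fun z => z * p.1)%R ht; have := congr1 (fun z => z * p.2)%R ht.
  have := congr1 (fun z => z * p.2 * t)%R ht; have := congr1 (fun z => z * p.2)%R ht2.
  by move=> /= *; congr (g (_, _)); lra.
move=> n1 mf f0; have [n0|n0] := eqVneq n.1 0%R; last exact: (main n f n1 n0 mf f0).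
have : ((n.2 - 1) * (n.2 + 1) = 0)%R by rewrite n0 in n1; lra.
move/eqP; rewrite mulf_eq0 => /orP[] /eqP h.
  have n2 : n.2 = 1%R by lra.
  by apply: eq_integral => -[x y] _; rewrite /frame n0 n2 /=; congr (f (_, _)); ring.
have n2 : (n.2 = -1)%R by lra.
(* Minus the identity is the square of the quarter turn, to which the generic case applies. *)
have q1 : (((1 : R), (0 : R)).1 ^+ 2 + ((1 : R), (0 : R)).2 ^+ 2 = 1 :> R)%R by rewrite /=; ring.
rewrite -[RHS](main (1, 0)%R f q1 (oner_neq0 _) mf f0).
rewrite -[RHS](main _ _ q1 (oner_neq0 _) (measurable_frame (1, 0)%R mf) (fun p => f0 _)).
by apply: eq_integral => -[x y] _; rewrite /frame n0 n2/=; congr (f (_, _)); ring.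
Qed.

End Measure.

(** * Derivation rules for real functions on a normed space *)

Section RealDerive.
Context {R : realType} {V : normedModType R}.
Implicit Types (f g : V -> R) (x v : V).

Lemma is_derive_mul f g x v df dg : is_derive x v f df -> is_derive x v g dg ->
  is_derive x v (fun y => f y * g y) (df * g x + f x * dg).
Proof.
move=> hf hg; apply: (is_derive_eq (is_deriveM hf hg)).
by rewrite /GRing.scale/=; ring.
Qed.

Lemma is_derive_add f g x v df dg : is_derive x v f df -> is_derive x v g dg ->
  is_derive x v (fun y => f y + g y) (df + dg).
Proof. exact: is_deriveD. Qed.

Lemma is_derive_sub f g x v df dg : is_derive x v f df -> is_derive x v g dg ->
  is_derive x v (fun y => f y - g y) (df - dg).
Proof. by move=> hf hg; exact: (is_deriveB hf hg). Qed.

Lemma is_derive_opp f x v df : is_derive x v f df ->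
  is_derive x v (fun y => - f y) (- df).
Proof. exact: is_deriveN. Qed.

Lemma is_derive_scal (k : R) f x v df : is_derive x v f df ->
  is_derive x v (fun y => k * f y) (k * df).
Proof. by move=> hf; exact: (is_deriveZ k hf). Qed.

Lemma is_derive_sqr f x v df : is_derive x v f df ->
  is_derive x v (fun y => f y ^+ 2) (2 * f x * df).
Proof.
move=> hf; apply: (is_derive_eq (is_derive_mul hf hf)); ring.
Qed.

Lemma is_derive_pow n f x v df : is_derive x v f df ->
  is_derive x v (fun y => f y ^+ n) (n%:R * f x ^+ n.-1 * df).
Proof.
move=> hf; have -> : (fun y => f y ^+ n) = f ^+ n.
  by apply/funext => y; elim: n => [|n IH]; rewrite ?expr0 // !exprS IH.
exact: is_deriveX.
Qed.
End RealDerive.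

(** * One-dimensional inequalities by calibration *)

Section OneDim.
Context {R : realType}.
Notation mu := (@lebesgue_measure R).
Implicit Types (f g G u v : R -> R) (a b k x : R).

Lemma continuous_pair (T : topologicalType) (f g : T -> R) (x : T) :
  {for x, continuous f} -> {for x, continuous g} -> {for x, continuous (fun y => (f y, g y))}.
Proof.
by move=> cf cg; exact: (@cvg_pair _ R R (nbhs x) (nbhs (f x)) (nbhs (g x)) _ _ _ f g cf cg).
Qed.

Lemma continuous_add (T : topologicalType) (f g : T -> R) (x : T) :
  {for x, continuous f} -> {for x, continuous g} -> {for x, continuous (fun y => f y + g y)}.
Proof. by move=> cf cg; exact: (cvgD cf cg). Qed.

Lemma continuous_sub (T : topologicalType) (f g : T -> R) (x : T) :
  {for x, continuous f} -> {for x, continuous g} -> {for x, continuous (fun y => f y - g y)}.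
Proof. by move=> cf cg; exact: (cvgB cf cg). Qed.

Lemma continuous_mul (T : topologicalType) (f g : T -> R) (x : T) :
  {for x, continuous f} -> {for x, continuous g} -> {for x, continuous (fun y => f y * g y)}.
Proof. by move=> cf cg; exact: (cvgM cf cg). Qed.

Lemma continuous_scal (T : topologicalType) (k : R) (f : T -> R) (x : T) :
  {for x, continuous f} -> {for x, continuous (fun y => k * f y)}.
Proof. by move=> cf; exact: (cvgM (cvg_cst k) cf). Qed.

Arguments continuous_scal {T} k {f x}.

Lemma continuous_sqr (T : topologicalType) (f : T -> R) (x : T) :
  {for x, continuous f} -> {for x, continuous (fun y => f y ^+ 2)}.
Proof. by move=> cf; exact: (cvgM cf cf). Qed.

Lemma continuous_is_derive f x d : is_derive x (1 : R) f d -> {for x, continuous f}.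
Proof. by move=> [df _]; apply/differentiable_continuous/derivable1_diffP. Qed.

Lemma FTC2_in G g a b : a < b ->
  (forall x, a <= x <= b -> is_derive x (1 : R) G (g x)) ->
  (forall x, a <= x <= b -> {for x, continuous g}) ->
  (\int[mu]_(x in `[a, b]) (g x)%:E = (G b - G a)%:E)%E.
Proof.
move=> ab dG cg.
rewrite (@continuous_FTC2 R g G)//.
- by apply: continuous_in_subspaceT => x; rewrite inE/= in_itv/= => /cg.
- split.
  + by move=> x; rewrite in_itv/= => /andP[h1 h2]; have [|//] := dG x; rewrite !ltW.
  + by apply/cvg_at_right_filter; apply: (continuous_is_derive (dG a _)); rewrite lexx ltW.
  + by apply/cvg_at_left_filter; apply: (continuous_is_derive (dG b _)); rewrite lexx ltW.
- move=> x; rewrite in_itv/= => /andP[h1 h2]; rewrite derive1E.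
  have dx : is_derive x (1 : R) G (g x) by apply: dG; rewrite !ltW.
  exact: derive_val.
Qed.

Lemma continuous_integrable_itv g a b :
  (forall x, a <= x <= b -> {for x, continuous g}) ->
  mu.-integrable `[a, b] (EFin \o g).
Proof.
move=> cg; apply: continuous_compact_integrable; first exact: segment_compact.
by apply: continuous_in_subspaceT => x; rewrite inE/= in_itv/= => /cg.
Qed.

(** An exact derivative can be added to an integrand at the price of its boundary values. An
    integral inequality is thereby reduced to a pointwise one, once a suitable [G] is exhibited. *)
Lemma le_integral_calibration u v G g a b : a <= b ->
  (forall x, a <= x <= b -> is_derive x (1 : R) G (g x)) ->
  (forall x, a <= x <= b -> {for x, continuous g}) ->
  (forall x, a <= x <= b -> {for x, continuous u}) ->
  (forall x, a <= x <= b -> {for x, continuous v}) ->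
  (forall x, a <= x <= b -> u x + g x <= v x) -> G a <= G b ->
  (\int[mu]_(x in `[a, b]) (u x)%:E <= \int[mu]_(x in `[a, b]) (v x)%:E)%E.
Proof.
rewrite le_eqVlt => /predU1P[<- *|ab dG cg cu cv uv Gab].
  by rewrite set_itv1 !integral_set1.
have ig := continuous_integrable_itv cg; have iu := continuous_integrable_itv cu.
have iv := continuous_integrable_itv cv.
apply: (@le_trans _ _ (\int[mu]_(x in `[a, b]) (u x)%:E + \int[mu]_(x in `[a, b]) (g x)%:E)%E).
  by rewrite leeDl// (FTC2_in ab)// lee_fin subr_ge0.
rewrite -integralD//=; apply: le_integral => //; first exact: integrableD.
by move=> x; rewrite inE/= in_itv/= => /uv; rewrite lee_fin.
Qed.

(** With t = tan (k x), completing the square gives f'^2 - k^2 f^2 = (f' + k t f)^2 - (k t f^2)'.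
    The boundary term vanishes at [b] and has the right sign at [a] because [0 <= a]. The strict
    bound [k * b < pi / 2] keeps the tangent finite up to [b]. *)
Lemma le_integral_cosine f f1 k a b : 0 <= a <= b -> 0 < k -> k * b < pi / 2 ->
  (forall x, is_derive x (1 : R) f (f1 x)) -> continuous f1 -> f b = 0 ->
  ((k ^+ 2)%:E * \int[mu]_(x in `[a, b]) (f x ^+ 2)%:E <=
   \int[mu]_(x in `[a, b]) (f1 x ^+ 2)%:E)%E.
Proof.
move=> /andP[a0 ab] k0 kb df cf1 fb.
have cf x : {for x, continuous f} := continuous_is_derive (df x).
have cosk x : a <= x <= b -> 0 < cos (k * x).
  move=> /andP[ax xb]; apply: cos_gt0_pihalf; have p0 := pi_gt0 R.
  have x0 : 0 <= k * x := mulr_ge0 (ltW k0) (le_trans a0 ax).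
  have xkb : k * x <= k * b by rewrite ler_pM2l.
  by apply/andP; split; lra.
pose t x := sin (k * x) / cos (k * x).
have dt x : a <= x <= b -> is_derive x (1 : R) t (k * (1 + t x ^+ 2)).
  move=> xab; have c0 : cos (k * x) != 0 by rewrite gt_eqF// cosk.
  have dl : is_derive x (1 : R) ( *%R k) k.
    by have := is_deriveZ k (is_derive_id x (1 : R)); rewrite scaler1; apply.
  have ds := is_derive1_comp (is_derive_sin (k * x)) dl.
  have dc := is_derive1_comp (is_derive_cos (k * x)) dl.
  have dv := is_deriveV (f := cos \o *%R k) c0 dc.
  apply: (is_derive_eq (is_derive_mul ds dv)).
  by rewrite /t /= /GRing.scale /=; field.
have mf2 : measurable_fun [set: measurableTypeR R] (fun x => f x ^+ 2).
  by apply: continuous_measurable_fun => x; apply: continuous_sqr; exact: cf.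
rewrite -ge0_integralZl//=; last first.
- by rewrite lee_fin sqr_ge0.
- by move=> x _; rewrite lee_fin sqr_ge0.
- exact/measurable_EFinP/measurable_funTS.
under eq_integral do rewrite -EFinM.
apply: (le_integral_calibration (G := fun x => - k * (t x * f x ^+ 2))
  (g := fun x => - k * (k * (1 + t x ^+ 2) * f x ^+ 2 + 2 * (t x * (f x * f1 x)))) ab).
- move=> x xab.
  have h := is_derive_scal (- k) (is_derive_mul (dt x xab) (is_derive_sqr (df x))).
  apply: (is_derive_eq h); ring.
- move=> x xab; have ct := continuous_is_derive (dt x xab).
  apply: cvgM; first exact: cvg_cst.
  apply: cvgD.
    apply: cvgM; last by apply: continuous_sqr; exact: cf.
    apply: cvgM; first exact: cvg_cst.
    by apply: cvgD; [exact: cvg_cst|exact: (continuous_sqr ct)].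
  apply: cvgM; first exact: cvg_cst.
  by apply: cvgM => //; apply: cvgM; [exact: cf|exact: cf1].
- by move=> x _; apply: cvgM; [exact: cvg_cst|apply: continuous_sqr; exact: cf].
- by move=> x _; apply: continuous_sqr; exact: cf1.
- move=> x xab; rewrite -subr_ge0.
  have -> : f1 x ^+ 2 - (k ^+ 2 * f x ^+ 2 +
    - k * (k * (1 + t x ^+ 2) * f x ^+ 2 + 2 * (t x * (f x * f1 x)))) =
    (f1 x + k * t x * f x) ^+ 2 by ring.
  exact: sqr_ge0.
- rewrite fb expr0n/= !mulr0 mulNr oppr_le0; apply: mulr_ge0; first exact: ltW.
  apply: mulr_ge0; last exact: sqr_ge0.
  have c0 := cosk a; rewrite /t divr_ge0 ?(ltW (c0 _)) ?lexx//.
  apply: sin_ge0_pi; rewrite mulr_ge0//= ?(ltW k0)//.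
  have := pi_gt0 R => p0; have : k * a <= k * b by rewrite ler_pM2l.
  by move=> ?; lra.
Qed.

(* [28 * 16 / (b - a)^4] is a slightly smaller substitute for the optimal
   constant [(4.73004 / (b - a))^4]. The certificate comes from the identity
   [(f'' + p f' + q f)^2 = f''^2 - c f^2 + (p f'^2 + 2 q f f' + e f^2)'] with
   [p = - W'/W], [q = W''/(2 W)], [e = - W'''/(2 W)], which holds when
   [- 2 W W'''' + 2 W' W''' - W''^2 = 4 c W^2]. *)
Lemma le_integral_clamped f f1 f2 a b : a < b ->
  (forall x, is_derive x (1 : R) f (f1 x)) ->
  (forall x, is_derive x (1 : R) f1 (f2 x)) -> continuous f2 ->
  f a = 0 -> f1 a = 0 -> f b = 0 -> f1 b = 0 ->
  ((28 * (2 / (b - a)) ^+ 4)%:E * \int[mu]_(x in `[a, b]) (f x ^+ 2)%:E <=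
   \int[mu]_(x in `[a, b]) (f2 x ^+ 2)%:E)%E.
Proof.
move=> ab df df1 cf2 fa f1a fb f1b.
have cf x : {for x, continuous f} := continuous_is_derive (df x).
have cf1 x : {for x, continuous f1} := continuous_is_derive (df1 x).
set s := 2 / (b - a).
pose y x := s * (x - (a + b) / 2).
have y1 x : a <= x <= b -> (y x) ^+ 2 <= 1.
  move=> /andP[ax xb]; have ba : 0 < b - a by rewrite subr_gt0.
  have -> : y x = (2 * x - (a + b)) / (b - a) by rewrite /y /s; field; rewrite gt_eqF.
  rewrite expr_div_n ler_pdivrMr ?exprn_gt0// mul1r -subr_ge0.
  rewrite (_ : _ - _ = 4 * ((b - x) * (x - a))); last by ring.
  by rewrite mulr_ge0// mulr_ge0// subr_ge0.
have dy x : is_derive x (1 : R) y s.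
  have h := is_derive_scal s (is_derive_sub (is_derive_id x (1 : R)) (is_derive_cst ((a + b) / 2) x (1 : R))).
  by apply: (is_derive_eq h); rewrite subr0 mulr1.
(* The map [y] sends [[a, b]] onto [-1, 1]. There the differential equation for the certificate is
   relaxed to the inequality [resid], with 4 c = 112, so that a positive polynomial can serve as
   [W]. *)
pose W (t : R) : R := 20 + 80 * t ^+ 2 - 76 * t ^+ 4 - 23 * t ^+ 6.
pose W1 (t : R) : R := 160 * t - 304 * t ^+ 3 - 138 * t ^+ 5.
pose W2 (t : R) : R := 160 - 912 * t ^+ 2 - 690 * t ^+ 4.
pose W3 (t : R) : R := - 1824 * t - 2760 * t ^+ 3.
pose W4 (t : R) : R := - 1824 - 8280 * t ^+ 2.
have W0 t : t ^+ 2 <= 1 -> 0 < W t.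
  move=> t1; have t0 := sqr_ge0 t; rewrite /W.
  have -> : 20 + 80 * t ^+ 2 - 76 * t ^+ 4 - 23 * t ^+ 6 =
    20 + 80 * t ^+ 2 - 76 * (t ^+ 2) ^+ 2 - 23 * (t ^+ 2) ^+ 3 by ring.
  by move: (t ^+ 2) t0 t1; clear => u u0 u1; nra.
have dpow n x : is_derive x (1 : R) (fun x => y x ^+ n) (s * (n%:R * y x ^+ n.-1)).
  by apply: (is_derive_eq (is_derive_pow n (dy x))); rewrite mulrC.
have dW x : is_derive x (1 : R) (fun x => W (y x)) (s * W1 (y x)).
  have h := is_derive_sub (is_derive_sub (is_derive_add (is_derive_cst (20 : R) x (1 : R))
    (is_derive_scal 80 (dpow 2%N x))) (is_derive_scal 76 (dpow 4%N x))) (is_derive_scal 23 (dpow 6%N x)).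
  by apply: (is_derive_eq h); rewrite /W1/=; ring.
have dW1 x : is_derive x (1 : R) (fun x => W1 (y x)) (s * W2 (y x)).
  have h := is_derive_sub (is_derive_sub (is_derive_scal 160 (dpow 1%N x))
    (is_derive_scal 304 (dpow 3%N x))) (is_derive_scal 138 (dpow 5%N x)).
  by apply: (is_derive_eq h); rewrite /W2/= expr0; ring.
have dW2 x : is_derive x (1 : R) (fun x => W2 (y x)) (s * W3 (y x)).
  have h := is_derive_sub (is_derive_sub (is_derive_cst (160 : R) x (1 : R))
    (is_derive_scal 912 (dpow 2%N x))) (is_derive_scal 690 (dpow 4%N x)).
  by apply: (is_derive_eq h); rewrite /W3/=; ring.
have dW3 x : is_derive x (1 : R) (fun x => W3 (y x)) (s * W4 (y x)).
  have h := is_derive_sub (is_derive_scal (- 1824) (dpow 1%N x))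
    (is_derive_scal 2760 (dpow 3%N x)).
  by apply: (is_derive_eq h); rewrite /W4/= expr0; ring.
have resid t : t ^+ 2 <= 1 ->
    0 <= - 2 * W t * W4 t + 2 * W1 t * W3 t - W2 t ^+ 2 - 112 * W t ^+ 2.
  move=> t1; have t0 := sqr_ge0 t.
  (* In u = t^2 this is a quadratic of negative discriminant plus u^3 times a factor that is
     positive on [0, 1]. *)
  have -> : - 2 * W t * W4 t + 2 * W1 t * W3 t - W2 t ^+ 2 - 112 * W t ^+ 2 =
      (2 * 1000 + 560 - (27 * 1000 + 200) * t ^+ 2 + (286 * 1000 + 80) * (t ^+ 2) ^+ 2) + (t ^+ 2) ^+ 3 *
      ((1045 * 1000 + 440) - (329 * 1000 + 972) * t ^+ 2 - (391 * 1000 + 552) * (t ^+ 2) ^+ 2 - (59 * 1000 + 248) * (t ^+ 2) ^+ 3).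
    by rewrite /W /W1 /W2 /W3 /W4; ring.
  move: (t ^+ 2) t0 t1 => u u0 u1; apply: addr_ge0.
    by move: u0 u1; clear; nra.
  have u2 : u ^+ 2 <= 1 by rewrite exprn_ile1.
  have u3 : u ^+ 3 <= 1 by rewrite exprn_ile1.
  by apply: mulr_ge0; [rewrite exprn_ge0|move: u1 u2 u3; clear; lra].
pose V x := (W (y x))^-1.
have W0' x : a <= x <= b -> W (y x) != 0 by move=> xab; rewrite gt_eqF// W0// y1.
have dV x : a <= x <= b -> is_derive x (1 : R) V (- (s * W1 (y x)) * V x ^+ 2).
  move=> xab; have h := is_deriveV (f := fun z => W (y z)) (W0' x xab) (dW x).
  by apply: (is_derive_eq h); rewrite /GRing.scale/= /V exprVn; ring.
pose G x := (s * W1 (y x) * f1 x ^+ 2 - s ^+ 2 * W2 (y x) * (f x * f1 x)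
  + s ^+ 3 / 2 * W3 (y x) * f x ^+ 2) * V x.
have mf2 : measurable_fun [set: measurableTypeR R] (fun x => f x ^+ 2).
  by apply: continuous_measurable_fun => x; apply: continuous_sqr; exact: cf.
have s4 : s ^+ 4 = (s ^+ 2) ^+ 2 by ring.
rewrite -ge0_integralZl//=; last first.
- by rewrite lee_fin mulr_ge0// s4 sqr_ge0.
- by move=> x _; rewrite lee_fin sqr_ge0.
- exact/measurable_EFinP/measurable_funTS.
under eq_integral do rewrite -EFinM.
pose g x := (s * (s * W2 (y x)) * f1 x ^+ 2 + s * W1 (y x) * (2 * f1 x * f2 x)
   - (s ^+ 2 * (s * W3 (y x)) * (f x * f1 x) + s ^+ 2 * W2 (y x) * (f1 x * f1 x + f x * f2 x))
   + (s ^+ 3 / 2 * (s * W4 (y x)) * f x ^+ 2 + s ^+ 3 / 2 * W3 (y x) * (2 * f x * f1 x))) * V x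
   + (s * W1 (y x) * f1 x ^+ 2 - s ^+ 2 * W2 (y x) * (f x * f1 x)
      + s ^+ 3 / 2 * W3 (y x) * f x ^+ 2) * (- 1 * (s * W1 (y x)) * V x ^+ 2).
apply: (le_integral_calibration (G := G) (g := g) (ltW ab)).
- move=> x xab.
  have h := is_derive_mul (is_derive_add (is_derive_sub
    (is_derive_mul (is_derive_scal s (dW1 x)) (is_derive_sqr (df1 x)))
    (is_derive_mul (is_derive_scal (s ^+ 2) (dW2 x)) (is_derive_mul (df x) (df1 x))))
    (is_derive_mul (is_derive_scal (s ^+ 3 / 2) (dW3 x)) (is_derive_sqr (df x)))) (dV x xab).
  by apply: (is_derive_eq h); rewrite /g; ring.
- move=> x xab.
  have cV := continuous_is_derive (dV x xab).
  have cW1 := continuous_is_derive (dW1 x).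
  have cW2 := continuous_is_derive (dW2 x).
  have cW3 := continuous_is_derive (dW3 x).
  have cW4 : {for x, continuous (fun x => W4 (y x))}.
    apply: cvgB; first exact: cvg_cst.
    by apply: cvgM; [exact: cvg_cst|apply: continuous_sqr; exact: (continuous_is_derive (dy x))].
  have c0 := cf x; have c1 := cf1 x; have c2 := cf2 x.
  have q1 := continuous_mul (continuous_scal s cW1) (continuous_sqr c1).
  have q2 := continuous_mul (continuous_scal (s ^+ 2) cW2) (continuous_mul c0 c1).
  have q3 := continuous_mul (continuous_scal (s ^+ 3 / 2) cW3) (continuous_sqr c0).
  have q4 := continuous_mul (continuous_scal s (continuous_scal s cW2)) (continuous_sqr c1).
  have q5 := continuous_mul (continuous_scal s cW1) (continuous_mul (continuous_scal 2 c1) c2).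
  have q6 := continuous_mul (continuous_scal (s ^+ 2) (continuous_scal s cW3)) (continuous_mul c0 c1).
  have q7 := continuous_mul (continuous_scal (s ^+ 2) cW2)
    (continuous_add (continuous_mul c1 c1) (continuous_mul c0 c2)).
  have q8 := continuous_mul (continuous_scal (s ^+ 3 / 2) (continuous_scal s cW4)) (continuous_sqr c0).
  have q9 := continuous_mul (continuous_scal (s ^+ 3 / 2) cW3) (continuous_mul (continuous_scal 2 c0) c1).
  have q10 := continuous_mul (continuous_scal (- 1) (continuous_scal s cW1)) (continuous_sqr cV).
  have q := continuous_add (continuous_mul (continuous_add (continuous_sub (continuous_add q4 q5)
    (continuous_add q6 q7)) (continuous_add q8 q9)) cV)
    (continuous_mul (continuous_add (continuous_sub q1 q2) q3) q10).
  exact: q.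
- by move=> x _; apply: cvgM; [exact: cvg_cst|apply: continuous_sqr; exact: cf].
- by move=> x _; apply: continuous_sqr; exact: cf2.
- move=> x xab; rewrite -subr_ge0.
  have -> : f2 x ^+ 2 - (28 * s ^+ 4 * f x ^+ 2 + g x) =
    (f2 x - s * W1 (y x) * V x * f1 x + s ^+ 2 / 2 * W2 (y x) * V x * f x) ^+ 2 +
    (s ^+ 2 * V x * f x / 2) ^+ 2 *
    (- 2 * W (y x) * W4 (y x) + 2 * W1 (y x) * W3 (y x) - W2 (y x) ^+ 2 - 112 * W (y x) ^+ 2).
    rewrite /g /V; move: (W0' x xab).
    move: (W _) (W1 _) (W2 _) (W3 _) (W4 _) => w w1 w2 w3 w4 w0.
    by field.
  by rewrite addr_ge0 ?sqr_ge0// mulr_ge0 ?sqr_ge0// resid// y1.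
- by rewrite /G fa f1a fb f1b !expr0n/= !mulr0 !subr0 !addr0 !mul0r.
Qed.

End OneDim.
Arguments continuous_scal {R T} k {f x}.

(** * Differential calculus in the plane from partial derivatives *)

Notation i0 := (@ord0 1).
Notation i1 := (@ord_max 1).

Section Calculus.
Context {R : realType}.
Implicit Types (f g phi : R * R -> R) (p q n : R * R).

(** A directional derivative only sees the restriction to a line, so it can be computed in any other
    space with the same restriction; this identifies partial derivatives with derivatives in one
    variable. *)
Lemma is_derive_reparam (V W : normedModType R) (f : V -> R) (g : W -> R) a b v w d :
  (forall h : R, f (h *: v + a) = g (h *: w + b)) ->
  is_derive a v f d -> is_derive b w g d.
Proof.
move=> fg; have e : (fun h : R => h^-1 *: ((f \o shift a) (h *: v) - f a)) =
    (fun h : R => h^-1 *: ((g \o shift b) (h *: w) - g b)).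
  apply/funext => h; have := fg 0; rewrite !scale0r !add0r => <-.
  by rewrite /= fg.
by move=> [df <-]; split; [move: df; rewrite /derivable e|rewrite /derive e].
Qed.

Lemma axisE (i : 'I_2) (h : R) p :
  h *: axis R i + p = (h * (i == 0)%:R + p.1, h * (i == 1)%:R + p.2).
Proof. by []. Qed.

Lemma ord2 (i : 'I_2) : i = i0 \/ i = i1.
Proof. by case: i => [[|[|//]]] h; [left|right]; apply/val_inj. Qed.

Lemma is_derive_axis0 f p d :
  is_derive p (axis R i0) f d <-> is_derive p.1 (1 : R) (fun x => f (x, p.2)) d.
Proof.
by split; apply: is_derive_reparam => h; rewrite axisE /= mulr1 mulr0 add0r /GRing.scale/= mulr1.
Qed.

Lemma is_derive_axis1 f p d :
  is_derive p (axis R i1) f d <-> is_derive p.2 (1 : R) (fun y => f (p.1, y)) d.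
Proof.
by split; apply: is_derive_reparam => h; rewrite axisE /= mulr1 mulr0 add0r /GRing.scale/= mulr1.
Qed.

Lemma MVT_sym (f df : R -> R) (a b : R) :
  (forall x, is_derive x (1 : R) f (df x)) ->
  exists2 c, `|c - a| <= `|b - a| & f b - f a = df c * (b - a).
Proof.
move=> fd.
have main u v : u <= v -> exists2 c, u <= c <= v & f v - f u = df c * (v - u).
  move=> uv; have [|c] := MVT_segment uv (fun x _ => fd x); last first.
    by rewrite in_itv/=; exists c.
  by apply: continuous_in_subspaceT => x _; apply: (continuous_is_derive (fd x)).
have [ab|/ltW ba] := leP a b.
  have [c /andP[c1 c2] e] := main _ _ ab; exists c => //.
  by rewrite !ger0_norm ?subr_ge0// lerD2r.
have [c /andP[c1 c2] e] := main _ _ ba; exists c; last by lra.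
by rewrite !ler0_norm ?subr_le0// lerN2 lerD2r.
Qed.

Lemma continuous_ballP f p : {for p, continuous f} ->
  forall e : R, 0 < e -> exists2 d : R, 0 < d &
    forall q, `|q.1 - p.1| < d -> `|q.2 - p.2| < d -> `|f q - f p| < e.
Proof.
move=> cf e e0; have /cvgrPdist_lt/(_ e e0)/nbhs_ballP[d/= d0 H] := cf.
exists d => // q h1 h2; rewrite distrC; apply: H; split => /=;
  by rewrite /ball/= distrC.
Qed.

(** The increment is split into a horizontal and a vertical step. The mean value theorem applies to
    each, and continuity of the partial derivatives at the base point controls both intermediate
    points. *)
Lemma is_derive_line f f1 f2 p n (t : R) :
  (forall p, is_derive p (axis R i0) f (f1 p)) ->
  (forall p, is_derive p (axis R i1) f (f2 p)) ->
  continuous f1 -> continuous f2 ->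
  is_derive t (1 : R) (fun t => f (p.1 + t * n.1, p.2 + t * n.2))
    (n.1 * f1 (p.1 + t * n.1, p.2 + t * n.2) + n.2 * f2 (p.1 + t * n.1, p.2 + t * n.2)).
Proof.
move=> d1 d2 c1 c2; set q := (p.1 + t * n.1, p.2 + t * n.2).
set D := n.1 * f1 q + n.2 * f2 q.
suff key : (fun h : R => h^-1 *: (f (p.1 + (h + t) * n.1, p.2 + (h + t) * n.2) - f q))
    @ 0^' --> D.
  have e : (fun h : R => h^-1 *: (((fun t => f (p.1 + t * n.1, p.2 + t * n.2)) \o shift t) (h *: (1 : R)) - f q))
     = (fun h : R => h^-1 *: (f (p.1 + (h + t) * n.1, p.2 + (h + t) * n.2) - f q)).
    by apply/funext => h; rewrite /= /GRing.scale/= mulr1.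
  by split; [rewrite /derivable e; exact: (cvgP D)|rewrite /derive e; exact: cvg_lim].
apply/cvgrPdist_lt => e e0.
pose K := 1 + `|n.1| + `|n.2|.
have K0 : 0 < K by rewrite /K; have := normr_ge0 n.1; have := normr_ge0 n.2; lra.
have [r1 r10 h1] := continuous_ballP (c1 q) (divr_gt0 e0 K0).
have [r2 r20 h2] := continuous_ballP (c2 q) (divr_gt0 e0 K0).
pose r := Num.min r1 r2 / K.
have r0 : 0 < r by rewrite divr_gt0// lt_min r10.
near=> h.
have hn0 : h != 0 by near: h; exact: nbhs_dnbhs_neq.
have hr : `|h| < r.
  near: h; apply: (@dnbhs0_lt _ R^o); exact: r0.
have hK : `|h| * K < Num.min r1 r2 by rewrite -ltr_pdivlMr.
have hn1 : `|h * n.1| < Num.min r1 r2.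
  rewrite normrM (le_lt_trans _ hK)// ler_wpM2l// /K; have := normr_ge0 n.2; lra.
have hn2 : `|h * n.2| < Num.min r1 r2.
  rewrite normrM (le_lt_trans _ hK)// ler_wpM2l// /K; have := normr_ge0 n.1; lra.
rewrite !lt_min in hn1 hn2.
have [/andP[hn11 hn12] /andP[hn21 hn22]] := conj hn1 hn2.
pose y' := p.2 + (h + t) * n.2.
have [x1 X1 E1] := MVT_sym (f := fun x => f (x, y')) (df := fun x => f1 (x, y')) q.1 (p.1 + (h + t) * n.1)
  (fun x => (is_derive_axis0 f (x, y') _).1 (d1 (x, y'))).
have [y1 Y1 E2] := MVT_sym (f := fun y => f (q.1, y)) (df := fun y => f2 (q.1, y)) q.2 y'
  (fun y => (is_derive_axis1 f (q.1, y) _).1 (d2 (q.1, y))).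
have qx : p.1 + (h + t) * n.1 - q.1 = h * n.1 by rewrite /q/=; ring.
have qy : y' - q.2 = h * n.2 by rewrite /q/y'/=; ring.
rewrite qx in X1 E1; rewrite qy in Y1 E2.
have -> : h^-1 *: (f (p.1 + (h + t) * n.1, p.2 + (h + t) * n.2) - f q) =
    n.1 * f1 (x1, y') + n.2 * f2 (q.1, y1).
  have -> : f (p.1 + (h + t) * n.1, p.2 + (h + t) * n.2) - f q =
     f1 (x1, y') * (h * n.1) + f2 (q.1, y1) * (h * n.2).
    by rewrite -E1 -E2 /q /=; ring.
  by rewrite /GRing.scale/=; field.
have B1 := h1 (x1, y') (le_lt_trans X1 hn11) ltac:(by rewrite /= qy).
have B2 := h2 (q.1, y1) ltac:(by rewrite /= subrr normr0) (le_lt_trans Y1 hn22).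
rewrite distrC /D.
have -> : n.1 * f1 (x1, y') + n.2 * f2 (q.1, y1) - (n.1 * f1 q + n.2 * f2 q) =
  n.1 * (f1 (x1, y') - f1 q) + n.2 * (f2 (q.1, y1) - f2 q) by ring.
rewrite (le_lt_trans (ler_normD _ _))// !normrM.
have eK : e = (1 + `|n.1| + `|n.2|) * (e / K) by rewrite mulrC divfK// gt_eqF.
have eK0 : 0 < e / K by rewrite divr_gt0.
rewrite [ltRHS]eK.
have := ler_wpM2l (normr_ge0 n.1) (ltW B1); have := ler_wpM2l (normr_ge0 n.2) (ltW B2).
by move=> *; lra.
Unshelve. all: by end_near. Qed.

(** The second difference over a square of side r is r^2 times a value of either mixed derivative
    near [p], according to the order in which two mean values are taken. *)
Lemma clairaut f f1 f2 f12 f21 p :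
  (forall p, is_derive p (axis R i0) f (f1 p)) ->
  (forall p, is_derive p (axis R i1) f (f2 p)) ->
  (forall p, is_derive p (axis R i1) f1 (f12 p)) ->
  (forall p, is_derive p (axis R i0) f2 (f21 p)) ->
  continuous f12 -> continuous f21 -> f12 p = f21 p.
Proof.
move=> d1 d2 d12 d21 c12 c21.
apply/eqP; rewrite -subr_eq0 -normr_le0; apply/ler_addgt0Pr => /= e e0; rewrite add0r.
have e2 : 0 < e / 2 by rewrite divr_gt0.
have [r1 r10 h1] := continuous_ballP (c12 p) e2.
have [r2 r20 h2] := continuous_ballP (c21 p) e2.
pose r := Num.min r1 r2 / 2.
have m0 : 0 < Num.min r1 r2 by rewrite lt_min r10.
have r0 : 0 < r by rewrite divr_gt0.
have [rr1 rr2] : r < r1 /\ r < r2.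
  have h : Num.min r1 r2 <= r1 /\ Num.min r1 r2 <= r2 by rewrite !ge_min !lexx orbT.
  by rewrite /r; lra.
have rn : `|r| = r by rewrite gtr0_norm.
pose D := f (p.1 + r, p.2 + r) - f (p.1 + r, p.2) - f (p.1, p.2 + r) + f (p.1, p.2).
have [x1 X1 E1] := MVT_sym (f := fun x => f (x, p.2 + r) - f (x, p.2)) (df := fun x => f1 (x, p.2 + r) - f1 (x, p.2)) (p.1) (p.1 + r)
  (fun x => is_derive_sub ((is_derive_axis0 f (x, p.2 + r) _).1 (d1 (x, p.2 + r)))
     ((is_derive_axis0 f (x, p.2) _).1 (d1 (x, p.2)))).
have [y1 Y1 F1] := MVT_sym (f := fun y => f1 (x1, y)) (df := fun y => f12 (x1, y)) (p.2) (p.2 + r)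
  (fun y => (is_derive_axis1 f1 (x1, y) _).1 (d12 (x1, y))).
have [y2 Y2 E2] := MVT_sym (f := fun y => f (p.1 + r, y) - f (p.1, y)) (df := fun y => f2 (p.1 + r, y) - f2 (p.1, y)) (p.2) (p.2 + r)
  (fun y => is_derive_sub ((is_derive_axis1 f (p.1 + r, y) _).1 (d2 (p.1 + r, y)))
     ((is_derive_axis1 f (p.1, y) _).1 (d2 (p.1, y)))).
have [x2 X2 F2] := MVT_sym (f := fun x => f2 (x, y2)) (df := fun x => f21 (x, y2)) (p.1) (p.1 + r)
  (fun x => (is_derive_axis0 f2 (x, y2) _).1 (d21 (x, y2))).
have pr1 : p.1 + r - p.1 = r by ring.
have pr2 : p.2 + r - p.2 = r by ring.
rewrite pr1 ?rn in X1 E1 X2 F2; rewrite pr2 ?rn in Y1 F1 Y2 E2.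
rewrite /= in E1 E2 F1 F2.
have E : f12 (x1, y1) = f21 (x2, y2).
  have rneq : r != 0 by rewrite gt_eqF.
  apply: (mulIf rneq); apply: (mulIf rneq).
  by rewrite -F1 -F2 -E1 -E2; ring.
have B1 := h1 (x1, y1) (le_lt_trans X1 rr1) (le_lt_trans Y1 rr1).
have B2 := h2 (x2, y2) (le_lt_trans X2 rr2) (le_lt_trans Y2 rr2).
have -> : f12 p - f21 p = (f21 (x2, y2) - f21 p) - (f12 (x1, y1) - f12 p).
  by rewrite E; ring.
by rewrite (le_trans (ler_normB _ _))//; lra.
Qed.

End Calculus.

(** * Compactly supported integrands and integration by parts in the plane *)

Section PlaneIntegral.
Context {R : realType}.
Notation mR := (measurableTypeR R).
Notation mu := (@lebesgue_measure R).
Notation mu2 := (leb2 R).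
Implicit Types (f g F phi : R * R -> R) (M : R) (Om : set (R * R)).

(** Compact support in the form suited to slicing: every horizontal or vertical section vanishes
    outside the same bounded interval. *)
Definition box_supp M f := forall p, ~~ ((`|p.1| < M) && (`|p.2| < M)) -> f p = 0.

Lemma integral_supp d (T : measurableType d) (m : {measure set T -> \bar R}) (D : set T)
    (f : T -> \bar R) : (forall x, ~ D x -> f x = 0%E) ->
  (\int[m]_(x in D) f x = \int[m]_x f x)%E.
Proof.
move=> fD; rewrite integral_mkcond; congr (integral _ _ _); apply/funext => x.
by rewrite patchE; case: ifPn => //; rewrite notin_setE => /fD ->.
Qed.

Lemma Rintegral_supp d (T : measurableType d) (m : {measure set T -> \bar R}) (D : set T)
    (f : T -> R) : (forall x, ~ D x -> f x = 0) ->
  \int[m]_(x in D) f x = \int[m]_x f x.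
Proof. by move=> fD; congr fine; apply: integral_supp => x /fD ->. Qed.

Lemma eq_integral_Rintegral d (T : measurableType d) (m : {measure set T -> \bar R}) (D : set T)
    (f g : T -> R) : measurable D -> m.-integrable D (EFin \o f) -> m.-integrable D (EFin \o g) ->
  \int[m]_(x in D) f x = \int[m]_(x in D) g x ->
  (\int[m]_(x in D) (f x)%:E = \int[m]_(x in D) (g x)%:E)%E.
Proof.
move=> mD fi gi fg; have /fineK <- := integrable_fin_num mD fi.
by have /fineK <- := integrable_fin_num mD gi; congr EFin.
Qed.

Lemma bounded_box M f : continuous f -> box_supp M f -> exists2 C, 0 <= C & forall p, `|f p| <= C.
Proof.
move=> cf sf.
have cK : compact (`[- M, M]%classic `*` `[- M, M]%classic : set (R * R)).
  by apply: compact_setX; exact: segment_compact.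
have [C [_ HC]] := compact_bounded (continuous_compact (continuous_subspaceT cf) cK).
exists (`|C| + 1); first by rewrite addr_ge0.
move=> p; case: (boolP ((`|p.1| < M) && (`|p.2| < M))) => [/andP[h1 h2]|/sf ->]; last first.
  by rewrite normr0 addr_ge0.
apply: (HC (`|C| + 1)); first by rewrite (le_lt_trans (ler_norm C))// ltrDl.
by exists p => //; split; rewrite /= in_itv/= -ler_norml ltW.
Qed.

Lemma leb2_box (a b c d : R) : a <= b -> c <= d ->
  mu2 (`[a, b]%classic `*` `[c, d]%classic) = ((b - a) * (d - c))%:E.
Proof.
move=> ab cd.
have -> : mu2 (`[a, b]%classic `*` `[c, d]%classic) = (mu `[a, b]%classic * mu `[c, d]%classic)%E.
  by apply: product_measure1E; exact: measurable_itv.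
rewrite !lebesgue_measure_itv/= !lte_fin.
have len (x y : R) : x <= y -> (if (x < y)%R then y%:E - x%:E else 0)%E = (y - x)%:E.
  by rewrite le_eqVlt => /predU1P[->|->//]; rewrite ltxx subrr.
by rewrite !len// EFinM.
Qed.

Lemma integrable_box M f : continuous f -> box_supp M f ->
  mu2.-integrable setT (EFin \o f).
Proof.
move=> cf sf; have [C C0 HC] := bounded_box cf sf.
pose B : set (mR * mR) := `[- `|M|, `|M|]%classic `*` `[- `|M|, `|M|]%classic.
have mB : measurable B by apply: measurableX; exact: measurable_itv.
have -> : EFin \o f = (EFin \o f) \_ B.
  apply/funext => p; rewrite patchE; case: ifPn => //; rewrite notin_setE => Bp.
  rewrite /= sf//; apply/negP => /andP[h1 h2]; apply: Bp.
  by split; rewrite /= in_itv/= -ler_norml (le_trans (ltW _) (ler_norm M)).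
apply/(integrable_mkcond _ mB); apply: measurable_bounded_integrable => //.
- have MM : - `|M| <= `|M| by rewrite (le_trans _ (normr_ge0 M))// oppr_le0.
  by rewrite leb2_box ?ltry.
- by apply: measurable_funTS; exact: continuous_measurable2.
- exists C; split; first exact: num_real.
  by move=> x Cx p _; exact: (le_trans (HC p) (ltW Cx)).
Qed.

Lemma box_supp_mulr M f g : box_supp M f -> box_supp M (fun p => f p * g p).
Proof. by move=> sf p /sf ->; rewrite mul0r. Qed.

(** Integrating first along the axis, each section contributes the increment of a function that
    vanishes at both ends. *)
Lemma integral_derive_axis0 M F g : continuous g -> box_supp M F -> box_supp M g ->
  (forall p, is_derive p (axis R i0) F (g p)) -> (\int[mu2]_p (g p)%:E = 0)%E.
Proof.
move=> cg sF sg dF; rewrite -(integral21_prod_meas1 (integrable_box cg sg)).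
rewrite (eq_integral (cst 0%E)) ?integral_cst ?mul0e// => y _; rewrite /fubini_G /=.
pose N := `|M| + 1.
have N0 : - N < N by rewrite /N; have := normr_ge0 M; lra.
rewrite -(@integral_supp _ _ mu `[- N, N]%classic); last first.
  move=> x xN; rewrite sg//; apply/negP => /andP[h1 _]; apply: xN.
  rewrite /= in_itv/= -ler_norml (le_trans (ltW h1))// /N.
  by rewrite (le_trans (ler_norm M))// lerDl.
transitivity ((F (N, y) - F (- N, y))%:E).
  apply: (FTC2_in (G := fun x => F (x, y)) (g := fun x => g (x, y)) N0).
  - by move=> x _; exact/(is_derive_axis0 F (x, y)).
  - by move=> x _; apply: (@continuous_comp _ _ _ (fun x => (x, y)) g); [apply: continuous_pair; [exact: cvg_id|exact: cvg_cst]|exact: cg].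
have sMN : M <= N by rewrite (le_trans (ler_norm M))// lerDl.
rewrite !sF ?subrr// negb_and -!leNgt /= ?normrN.
  by rewrite (le_trans sMN)// ler_norm.
by rewrite (le_trans sMN)// ler_norm.
Qed.

Lemma integral_derive_axis1 M F g : continuous g -> box_supp M F -> box_supp M g ->
  (forall p, is_derive p (axis R i1) F (g p)) -> (\int[mu2]_p (g p)%:E = 0)%E.
Proof.
move=> cg sF sg dF; rewrite -(integral12_prod_meas1 (integrable_box cg sg)).
rewrite (eq_integral (cst 0%E)) ?integral_cst ?mul0e// => x _; rewrite /fubini_F /=.
pose N := `|M| + 1.
have N0 : - N < N by rewrite /N; have := normr_ge0 M; lra.
rewrite -(@integral_supp _ _ mu `[- N, N]%classic); last first.
  move=> y yN; rewrite sg//; apply/negP => /andP[_ h1]; apply: yN.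
  rewrite /= in_itv/= -ler_norml (le_trans (ltW h1))// /N.
  by rewrite (le_trans (ler_norm M))// lerDl.
transitivity ((F (x, N) - F (x, - N))%:E).
  apply: (FTC2_in (G := fun y => F (x, y)) (g := fun y => g (x, y)) N0).
  - by move=> y _; exact/(is_derive_axis1 F (x, y)).
  - by move=> y _; apply: (@continuous_comp _ _ _ (fun y => (x, y)) g); [apply: continuous_pair; [exact: cvg_cst|exact: cvg_id]|exact: cg].
have sMN : M <= N by rewrite (le_trans (ler_norm M))// lerDl.
rewrite !sF ?subrr// negb_and -!leNgt /= ?normrN.
  by apply/orP; right; exact: le_trans sMN (ler_norm _).
by apply/orP; right; exact: le_trans sMN (ler_norm _).
Qed.

Lemma Rintegral_derive_axis (i : 'I_2) M F g : continuous g -> box_supp M F -> box_supp M g ->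
  (forall p, is_derive p (axis R i) F (g p)) -> \int[mu2]_p (g p) = 0.
Proof.
move=> cg sF sg; rewrite /Rintegral; case: (ord2 i) => -> dF.
  by rewrite (integral_derive_axis0 cg sF sg dF).
by rewrite (integral_derive_axis1 cg sF sg dF).
Qed.

Lemma continuous_mul_plane f g : continuous f -> continuous g -> continuous (fun p => f p * g p).
Proof. by move=> cf cg p; exact: (continuous_mul (cf p) (cg p)). Qed.

Lemma continuous_sqr_plane f : continuous f -> continuous (fun p => f p ^+ 2).
Proof. by move=> cf p; exact: (continuous_sqr (cf p)). Qed.

Lemma Rintegral_by_parts (i : 'I_2) M u v du dv :
  continuous u -> continuous v -> continuous du -> continuous dv ->
  box_supp M u -> box_supp M du ->
  (forall p, is_derive p (axis R i) u (du p)) ->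
  (forall p, is_derive p (axis R i) v (dv p)) ->
  \int[mu2]_p (du p * v p) = - \int[mu2]_p (u p * dv p).
Proof.
move=> cu cv cdu cdv su sdu hu hv.
have c1 := continuous_mul_plane cdu cv; have c2 := continuous_mul_plane cu cdv.
have s1 := box_supp_mulr v sdu; have s2 := box_supp_mulr dv su.
apply/eqP; rewrite -subr_eq0 opprK -RintegralD//; [|exact: (integrable_box c1 s1)|exact: (integrable_box c2 s2)].
apply/eqP; apply: (@Rintegral_derive_axis i M (fun p => u p * v p)).
- by move=> p; exact: (continuous_add (c1 p) (c2 p)).
- exact: box_supp_mulr.
- by move=> p pM; rewrite s1// s2// addr0.
- by move=> p; exact: is_derive_mul.
Qed.

End PlaneIntegral.

(** * Test functions, their Hessian, and slicing in a rotated frame *)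

Section TestFunctions.
Context {R : realType}.
Notation mR := (measurableTypeR R).
Notation mu := (@lebesgue_measure R).
Notation mu2 := (leb2 R).
Implicit Types (phi : R * R -> R) (M : R) (Om : set (R * R)).

Lemma smooth_continuous phi s : smooth phi -> continuous (partials s phi).
Proof. by move=> /(_ s)[]. Qed.

Lemma smooth_is_derive phi s (i : 'I_2) p : smooth phi ->
  is_derive p (axis R i) (partials s phi) (partials (i :: s) phi p).
Proof. by move=> /(_ s)[_ /(_ i p) h]; split. Qed.

Lemma partials_cat s t phi : partials (s ++ t) phi = partials s (partials t phi).
Proof. exact: foldr_cat. Qed.

Lemma smooth_partials s phi : smooth phi -> smooth (partials s phi).
Proof. by move=> h t; rewrite -partials_cat; exact: h. Qed.

Lemma partials_swap phi s t (i j : 'I_2) : smooth phi ->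
  partials (s ++ i :: j :: t) phi = partials (s ++ j :: i :: t) phi.
Proof.
move=> sphi; rewrite (partials_cat s [:: i, j & t]) (partials_cat s [:: j, i & t]).
suff -> : partials [:: i, j & t] phi = partials [:: j, i & t] phi by [].
have main : partials (i0 :: i1 :: t) phi = partials (i1 :: i0 :: t) phi.
  apply/funext => p; apply/esym.
  apply: (@clairaut _ (partials t phi) (partials (i0 :: t) phi) (partials (i1 :: t) phi)) => [q|q|q|q||];
    first [exact: smooth_is_derive|exact: smooth_continuous].
case: (ord2 i) => ->; case: (ord2 j) => ->; [exact: erefl|exact: main|exact: esym main|exact: erefl].
Qed.

Lemma partials_supp phi s p : ~ closure [set q | phi q != 0] p -> partials s phi p = 0.
Proof.
elim: s p => [|i s IH] p pS.
  by apply/eqP/negPn/negP => h; apply: pS; exact: subset_closure.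
have oS : open (~` closure [set q | phi q != 0]) by apply: closed_openC; exact: closed_closure.
rewrite /= /partial (@near_eq_derive _ _ _ _ (cst 0)) ?derive_cst//.
by apply: filterS (open_nbhs_nbhs (conj oS pS)) => q /IH.
Qed.

Lemma test_function_supp Om phi s p : test_function Om phi -> ~ Om p -> partials s phi p = 0.
Proof. by move=> [_ _ h] pO; apply: partials_supp => /h. Qed.

Lemma test_function_box Om phi : test_function Om phi ->
  exists M, forall s, box_supp M (partials s phi).
Proof.
move=> [_ /compact_bounded[C [_ HC]] _]; exists (`|C| + 1 + 1) => s p pM.
apply: partials_supp => /(HC (`|C| + 1)) h; move/negP: pM; apply.
have {h} : `|p| <= `|C| + 1 by apply: h; rewrite (le_lt_trans (ler_norm C))// ltrDl.
rewrite prod_normE ge_max => /andP[h1 h2].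
have lt1 : `|C| + 1 < `|C| + 1 + 1 by rewrite ltrDl.
by apply/andP; split; [exact: le_lt_trans h1 lt1|exact: le_lt_trans h2 lt1].
Qed.

(** Both sides equal minus the integral of u e. The intended case is u = v_x, c = v_yy, b = v_xy, e
    = v_xyy, where it says that v_xx v_yy and v_xy^2 have the same integral. *)
Lemma Rintegral_swap_parts M (u u0 c b u1 e : R * R -> R) :
  continuous u -> continuous u0 -> continuous u1 -> continuous c -> continuous b -> continuous e ->
  box_supp M u -> box_supp M u0 -> box_supp M u1 ->
  (forall p, is_derive p (axis R i0) u (u0 p)) -> (forall p, is_derive p (axis R i1) u (u1 p)) ->
  (forall p, is_derive p (axis R i0) c (e p)) -> (forall p, is_derive p (axis R i1) b (e p)) ->
  b = u1 ->
  \int[mu2]_p (u0 p * c p) = \int[mu2]_p (b p * b p).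
Proof.
move=> cu cu0 cu1 cc cb ce su su0 su1 d0 d1 dc db bu.
rewrite (Rintegral_by_parts cu cc cu0 ce su su0 d0 dc) {1}bu.
by rewrite (Rintegral_by_parts cu cb cu1 ce su su1 d1 db).
Qed.

Lemma measurable_sqrE (f : R * R -> R) : continuous f ->
  measurable_fun [set: mR * mR] (fun p => (f p ^+ 2)%:E).
Proof.
move=> cf; have m := continuous_measurable2 (continuous_sqr_plane cf).
by apply/measurable_EFinP; exact: m.
Qed.

Section OneFunction.
Variables (phi : R * R -> R) (M : R).
Hypotheses (sphi : smooth phi) (bphi : forall s, box_supp M (partials s phi)).

Lemma integrable_partials2 s t :
  mu2.-integrable setT (EFin \o (fun p => partials s phi p * partials t phi p)).
Proof.
apply: (@integrable_box _ M); last exact: box_supp_mulr.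
by apply: continuous_mul_plane; exact: smooth_continuous.
Qed.

Lemma integral_hessian :
  \int[mu2]_p (partials [:: i0; i0] phi p * partials [:: i1; i1] phi p) =
  \int[mu2]_p (partials [:: i0; i1] phi p * partials [:: i0; i1] phi p).
Proof.
have ct t : continuous (partials t phi) by exact: smooth_continuous.
have dt t (k : 'I_2) p := smooth_is_derive t k p sphi.
apply: (@Rintegral_swap_parts _ (partials [:: i0] phi) _ _ _ (partials [:: i1; i0] phi) (partials [:: i0; i1; i1] phi)).
- exact: ct.
- exact: ct.
- exact: ct.
- exact: ct.
- exact: ct.
- exact: ct.
- exact: bphi.
- exact: bphi.
- exact: bphi.
- have -> : partials [:: i0; i1; i1] phi = partials [:: i1; i0; i1] phi := partials_swap [::] [:: i1] i0 i1 sphi.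
  exact: (dt [:: i0; i1] i1).
- exact: (partials_swap [::] [::] i0 i1 sphi).
Qed.

(** For compactly supported functions the integral of the squared Laplacian is that of the squared
    norm of the Hessian H, and |H|^2 dominates the square of n . H n pointwise for a unit vector
    n. *)
Lemma integral_laplacian_ge (n : R * R) : n.1 ^+ 2 + n.2 ^+ 2 = 1 ->
  (\int[mu2]_p ((n.1 ^+ 2 * partials [:: i0; i0] phi p + 2 * n.1 * n.2 * partials [:: i0; i1] phi p
     + n.2 ^+ 2 * partials [:: i1; i1] phi p) ^+ 2)%:E <=
   \int[mu2]_p ((partials [:: i0; i0] phi p + partials [:: i1; i1] phi p) ^+ 2)%:E)%E.
Proof.
move=> n1.
pose a := partials [:: i0; i0] phi; pose b := partials [:: i0; i1] phi; pose c := partials [:: i1; i1] phi.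
have [ca cb cc] : [/\ continuous a, continuous b & continuous c] by split; exact: smooth_continuous.
have [sa sb sc] : [/\ box_supp M a, box_supp M b & box_supp M c] by split; exact: bphi.
pose u p := a p * c p - b p * b p.
have iac : mu2.-integrable setT (EFin \o (fun p => a p * c p)) by exact: integrable_partials2.
have ibb : mu2.-integrable setT (EFin \o (fun p => b p * b p)) by exact: integrable_partials2.
have iu : mu2.-integrable setT (EFin \o u).
  by have := integrableB measurableT iac ibb.
have u0 : \int[mu2]_p u p = 0.
  rewrite (RintegralB measurableT iac ibb); apply/eqP; rewrite subr_eq0; apply/eqP.
  exact: integral_hessian.
pose w p := a p ^+ 2 + 2 * b p ^+ 2 + c p ^+ 2.
have sqE (f : R * R -> R) p : f p ^+ 2 = f p * f p by rewrite expr2.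
have il : mu2.-integrable setT (EFin \o (fun p => (a p + c p) ^+ 2)).
  apply: (@integrable_box _ M).
    by apply: continuous_sqr_plane => p; exact: (continuous_add (ca p) (cc p)).
  by move=> p pM; rewrite sa// sc// addr0 expr0n.
have iw : mu2.-integrable setT (EFin \o w).
  apply: (@integrable_box _ M).
    move=> p; exact: (continuous_add (continuous_add (continuous_sqr (ca p))
      (continuous_scal 2 (continuous_sqr (cb p)))) (continuous_sqr (cc p))).
  by move=> p pM; rewrite /w (sa p pM) (sb p pM) (sc p pM) !expr0n/= mulr0 !addr0.
have -> : (\int[mu2]_p ((a p + c p) ^+ 2)%:E = \int[mu2]_p (w p)%:E)%E.
  apply: (eq_integral_Rintegral measurableT il iw).
  apply/eqP; rewrite -subr_eq0 -(RintegralB measurableT il iw).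
  have -> : (fun p => (a p + c p) ^+ 2 - w p) = (fun p => 2 * u p).
    by apply/funext => p; rewrite /w /u; ring.
  by rewrite (@RintegralZl _ _ _ _ _ _ 2 measurableT iu) u0 mulr0.
have mw : measurable_fun [set: mR * mR] (fun p => (w p)%:E) by have /integrableP[] := iw.
apply: ge0_le_integral => //.
- by move=> p _; rewrite lee_fin sqr_ge0.
- apply: (measurable_sqrE (f := fun p => n.1 ^+ 2 * a p + 2 * n.1 * n.2 * b p + n.2 ^+ 2 * c p)) => p.
  exact: (continuous_add (continuous_add (continuous_scal (n.1 ^+ 2) (ca p))
    (continuous_scal (2 * n.1 * n.2) (cb p))) (continuous_scal (n.2 ^+ 2) (cc p))).
move=> p _; rewrite lee_fin /w -/(a p) -/(b p) -/(c p).
move: (a p) (b p) (c p) n.1 n.2 n1 => A B C x y xy; rewrite -subr_ge0.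
have -> : A ^+ 2 + 2 * B ^+ 2 + C ^+ 2 - (x ^+ 2 * A + 2 * x * y * B + y ^+ 2 * C) ^+ 2 =
  (x * y * (A - C) - (x ^+ 2 - y ^+ 2) * B) ^+ 2 + (y ^+ 2 * A - 2 * x * y * B + x ^+ 2 * C) ^+ 2
  + (x * y * (A - C) - (x ^+ 2 - y ^+ 2) * B) ^+ 2.
  have -> : A ^+ 2 + 2 * B ^+ 2 + C ^+ 2 = (A ^+ 2 + 2 * B ^+ 2 + C ^+ 2) * (x ^+ 2 + y ^+ 2) ^+ 2.
    by rewrite xy expr1n mulr1.
  by ring.
by rewrite !addr_ge0 ?sqr_ge0.
Qed.

Section Slices.
Variables (n c : R * R).
Hypothesis n1 : n.1 ^+ 2 + n.2 ^+ 2 = 1.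

(** The point with coordinate s along (n.2, - n.1) and coordinate u along [n], from the origin
    [c]. *)
Definition rigid (p : R * R) : R * R := ((frame n p).1 + c.1, (frame n p).2 + c.2).

Lemma measurable_rigid (f : mR * mR -> \bar R) :
  measurable_fun [set: mR * mR] f -> measurable_fun [set: mR * mR] (fun p => f (rigid p)).
Proof.
move=> mf; have mt : measurable_fun [set: mR * mR] (fun p : mR * mR => f (p.1 + c.1, p.2 + c.2)).
  apply: (measurable_comp2 mf).
  - rewrite (_ : (fun _ => _) = (fun p : R * R => 1 * p.1 + 0 * p.2 + c.1)); first exact: measurable_lin.
    by apply/funext => p; ring.
  - rewrite (_ : (fun _ => _) = (fun p : R * R => 0 * p.1 + 1 * p.2 + c.2)); first exact: measurable_lin.
    by apply/funext => p; ring.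
exact: (measurable_frame n mt).
Qed.

Lemma ge0_integral_rigid (f : mR * mR -> \bar R) :
  measurable_fun [set: mR * mR] f -> (forall p, (0 <= f p)%E) ->
  (\int[mu2]_p f p = \int[mu]_s \int[mu]_u f (rigid (s, u)))%E.
Proof.
move=> mf f0; rewrite -(ge0_integral_translate2 c.1 c.2 mf f0).
have mt : measurable_fun [set: mR * mR] (fun p : mR * mR => f (p.1 + c.1, p.2 + c.2)).
  apply: (measurable_comp2 mf).
  - rewrite (_ : (fun _ => _) = (fun p : R * R => 1 * p.1 + 0 * p.2 + c.1)); first exact: measurable_lin.
    by apply/funext => p; ring.
  - rewrite (_ : (fun _ => _) = (fun p : R * R => 0 * p.1 + 1 * p.2 + c.2)); first exact: measurable_lin.
    by apply/funext => p; ring.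
rewrite -(ge0_integral_frame n1 mt); last by move=> p; exact: f0.
exact: (tonelli1 (measurable_frame n mt) (fun p => f0 _)).
Qed.

Lemma le_integral_slices (k : R) (f g : mR * mR -> \bar R) : 0 <= k ->
  measurable_fun [set: mR * mR] f -> (forall p, (0 <= f p)%E) ->
  measurable_fun [set: mR * mR] g -> (forall p, (0 <= g p)%E) ->
  (forall s, (k%:E * \int[mu]_u f (rigid (s, u)) <= \int[mu]_u g (rigid (s, u)))%E) ->
  (k%:E * \int[mu2]_p f p <= \int[mu2]_p g p)%E.
Proof.
move=> k0 mf f0 mg g0 H; rewrite (ge0_integral_rigid mf f0) (ge0_integral_rigid mg g0).
have mF (h : mR * mR -> \bar R) : measurable_fun [set: mR * mR] h -> (forall p, (0 <= h p)%E) ->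
    measurable_fun [set: mR] (fun s => \int[mu]_u h (rigid (s, u)))%E.
  move=> mh h0; apply: (measurable_fun_fubini_tonelli_F (m2 := mu) (fun p => h (rigid p))).
    exact: measurable_rigid.
  by move=> p; exact: h0.
rewrite -ge0_integralZl//; [|exact: mF|by move=> s _; exact: integral_ge0].
apply: ge0_le_integral => //.
- by move=> s _; rewrite mule_ge0// integral_ge0.
- by apply: measurable_funeM; exact: mF.
- by apply: mF.
Qed.

Definition dir1 p := n.1 * partials [:: i0] phi p + n.2 * partials [:: i1] phi p.
Definition dir2 p := n.1 ^+ 2 * partials [:: i0; i0] phi p
  + 2 * n.1 * n.2 * partials [:: i0; i1] phi p + n.2 ^+ 2 * partials [:: i1; i1] phi p.

Lemma rigidE s u : rigid (s, u) = ((rigid (s, 0)).1 + u * n.1, (rigid (s, 0)).2 + u * n.2).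
Proof. by rewrite /rigid /frame /=; congr pair; ring. Qed.

Lemma is_derive_rigid s u : is_derive u (1 : R) (fun u => phi (rigid (s, u))) (dir1 (rigid (s, u))).
Proof.
rewrite (_ : (fun _ => _) = (fun u => phi ((rigid (s, 0)).1 + u * n.1, (rigid (s, 0)).2 + u * n.2))).
  have ct t : continuous (partials t phi) by exact: smooth_continuous.
  rewrite (rigidE s u).
  exact: (@is_derive_line R phi (partials [:: i0] phi) (partials [:: i1] phi) (rigid (s, 0)) n u
    (fun p => smooth_is_derive [::] i0 p sphi) (fun p => smooth_is_derive [::] i1 p sphi) (ct _) (ct _)).
by apply/funext => v; rewrite (rigidE s v).
Qed.

Lemma is_derive_rigid2 s u :
  is_derive u (1 : R) (fun u => dir1 (rigid (s, u))) (dir2 (rigid (s, u))).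
Proof.
pose g i u := partials [:: i] phi ((rigid (s, 0)).1 + u * n.1, (rigid (s, 0)).2 + u * n.2).
rewrite (_ : (fun _ => _) = (fun u => n.1 * g i0 u + n.2 * g i1 u)); last first.
  by apply/funext => v; rewrite (rigidE s v).
have dg i : is_derive u (1 : R) (g i) (n.1 * partials [:: i0; i] phi (rigid (s, u))
    + n.2 * partials [:: i1; i] phi (rigid (s, u))).
  have ct t : continuous (partials t phi) by exact: smooth_continuous.
  rewrite (rigidE s u).
  exact: (@is_derive_line R (partials [:: i] phi) (partials [:: i0; i] phi) (partials [:: i1; i] phi) (rigid (s, 0)) n u
    (fun p => smooth_is_derive [:: i] i0 p sphi) (fun p => smooth_is_derive [:: i] i1 p sphi) (ct _) (ct _)).
apply: (is_derive_eq (is_derive_add (is_derive_scal n.1 (dg i0)) (is_derive_scal n.2 (dg i1)))).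
have -> : partials [:: i1; i0] phi = partials [:: i0; i1] phi := partials_swap [::] [::] i1 i0 sphi.
rewrite /dir2; move: (partials [:: i0; i0] phi _) (partials [:: i0; i1] phi _) (partials [:: i1; i1] phi _) => A B C.
by ring.
Qed.

Lemma continuous_rigid s (f : R * R -> R) : continuous f -> continuous (fun u => f (rigid (s, u))).
Proof.
move=> cf u; rewrite (_ : (fun _ => _) = f \o (fun u => ((rigid (s, 0)).1 + u * n.1, (rigid (s, 0)).2 + u * n.2))).
  apply: continuous_comp; last exact: cf.
  have cv : {for u, continuous (fun v : R => v)} by exact: cvg_id.
  have ck (k : R) : {for u, continuous (fun=> k)} by exact: cvg_cst.
  exact: (continuous_pair (continuous_add (ck _) (continuous_mul cv (ck _)))
    (continuous_add (ck _) (continuous_mul cv (ck _)))).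
by apply/funext => v; rewrite (rigidE s v).
Qed.

Lemma continuous_dir1 : continuous dir1.
Proof.
have ct t : continuous (partials t phi) by exact: smooth_continuous.
by move=> p; exact: (continuous_add (continuous_scal n.1 (ct _ p)) (continuous_scal n.2 (ct _ p))).
Qed.

Lemma continuous_dir2 : continuous dir2.
Proof.
have ct t : continuous (partials t phi) by exact: smooth_continuous.
move=> p; exact: (continuous_add (continuous_add (continuous_scal (n.1 ^+ 2) (ct _ p))
  (continuous_scal (2 * n.1 * n.2) (ct _ p))) (continuous_scal (n.2 ^+ 2) (ct _ p))).
Qed.

(** On every line directed by [n] the function is clamped at the two edges of the strip, so the
    one-dimensional inequality holds on each slice, and the second derivative along [n] is
    controlled by the Laplacian after integration. *)
Lemma clamped_strip (a b : R) : a < b ->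
  (forall s p, ~~ (a < n.1 * (p.1 - c.1) + n.2 * (p.2 - c.2) < b) -> partials s phi p = 0) ->
  ((28 * (2 / (b - a)) ^+ 4)%:E * \int[mu2]_p (phi p ^+ 2)%:E <=
   \int[mu2]_p ((partials [:: i0; i0] phi p + partials [:: i1; i1] phi p) ^+ 2)%:E)%E.
Proof.
move=> ab supp; apply: le_trans (integral_laplacian_ge n1).
have ht s u : n.1 * ((rigid (s, u)).1 - c.1) + n.2 * ((rigid (s, u)).2 - c.2) = u.
  have -> : n.1 * ((rigid (s, u)).1 - c.1) + n.2 * ((rigid (s, u)).2 - c.2) =
    u * (n.1 ^+ 2 + n.2 ^+ 2) by rewrite /rigid /frame/=; ring.
  by rewrite n1 mulr1.
have supp' l s u : ~~ (a < u < b) -> partials l phi (rigid (s, u)) = 0.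
  by move=> h; apply: supp; rewrite ht.
have supp1 s u : ~~ (a < u < b) -> dir1 (rigid (s, u)) = 0.
  by move=> h; rewrite /dir1 !supp'// !mulr0 addr0.
have supp2 s u : ~~ (a < u < b) -> dir2 (rigid (s, u)) = 0.
  by move=> h; rewrite /dir2 !supp'// !mulr0 !addr0.
apply: (le_integral_slices (f := fun p => (phi p ^+ 2)%:E) (g := fun p => (dir2 p ^+ 2)%:E)).
- by rewrite mulr_ge0// exprn_ge0// divr_ge0// subr_ge0 ltW.
- by apply: measurable_sqrE; exact: (smooth_continuous (s := [::])).
- by move=> p; rewrite lee_fin sqr_ge0.
- by apply: measurable_sqrE; exact: continuous_dir2.
- by move=> p; rewrite lee_fin sqr_ge0.
move=> s; have aab : ~~ (a < a < b) by rewrite ltxx.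
have bab : ~~ (a < b < b) by rewrite ltxx andbF.
have cd2 : continuous (fun u => dir2 (rigid (s, u))).
  by apply: continuous_rigid; exact: continuous_dir2.
have := le_integral_clamped ab (is_derive_rigid s) (is_derive_rigid2 s)
  cd2 (supp' [::] s a aab) (supp1 s a aab)
  (supp' [::] s b bab) (supp1 s b bab).
have e (f : R -> R) : (forall u, ~~ (a < u < b) -> f u = 0) ->
    (\int[mu]_(x in `[a, b]) (f x ^+ 2)%:E = \int[mu]_x (f x ^+ 2)%:E)%E.
  move=> f0; apply: integral_supp => u uab; rewrite f0 ?expr0n//.
  by apply/negP => /andP[u1 u2]; apply: uab; rewrite /= in_itv/= !ltW.
rewrite (e (fun u => phi (rigid (s, u))) (fun u => supp' [::] s u)).
by rewrite (e (fun u => dir2 (rigid (s, u))) (supp2 s)).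
Qed.

End Slices.
End OneFunction.
End TestFunctions.

(** * Hersch's lower bound for the Dirichlet energy *)

Section Hersch.
Context {R : realType}.
Notation mR := (measurableTypeR R).
Notation mu := (@lebesgue_measure R).
Notation mu2 := (leb2 R).
Implicit Types (phi : R * R -> R) (n c p q : R * R).

(** Such a [U] is a half-line starting at t = inf U >= 0, with or without its endpoint, which has
    measure zero. The inequality is the cosine one on [[t, rho]], since [F] vanishes beyond
    [rho]. *)
Lemma le_integral_upclosed (F F1 : R -> R) (U : set R) (k rho : R) :
  (forall u, U u -> 0 <= u) -> (forall u v, U u -> u <= v -> U v) ->
  (forall u, is_derive u (1 : R) F (F1 u)) -> continuous F1 ->
  (forall u, rho <= u -> F u = 0) -> 0 < k -> k * rho < pi / 2 ->
  ((k ^+ 2)%:E * \int[mu]_(u in U) (F u ^+ 2)%:E <= \int[mu]_(u in U) (F1 u ^+ 2)%:E)%E.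
Proof.
move=> U0 Uup dF cF1 F0 k0 kr.
have cF u : {for u, continuous F} := continuous_is_derive (dF u).
have mF2 : measurable_fun [set: mR] (fun u => (F u ^+ 2)%:E).
  apply/measurable_EFinP; apply: (continuous_measurable_fun (f := fun u => F u ^+ 2)) => u.
  exact: (continuous_sqr (cF u)).
have mF12 : measurable_fun [set: mR] (fun u => (F1 u ^+ 2)%:E).
  apply/measurable_EFinP; apply: (continuous_measurable_fun (f := fun u => F1 u ^+ 2)) => u.
  exact: (continuous_sqr (cF1 u)).
have mU : measurable (U : set mR).
  by apply: is_interval_measurable => x y Ux Uy z /andP[xz _]; exact: (Uup x).
have [[u0 [Uu0 u0r]]|no] := pselect (exists u, U u /\ u < rho); last first.
  rewrite (_ : (\int[mu]_(u in U) (F u ^+ 2)%:E = 0)%E).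
    by rewrite mule0 integral_ge0// => u _; rewrite lee_fin sqr_ge0.
  rewrite (eq_integral (cst 0%E)) ?integral0// => u; rewrite inE => Uu.
  rewrite F0 ?expr0n//; rewrite leNgt; apply/negP => ur; apply: no; by exists u.
pose t := inf U.
have iU : has_inf U by split; [exists u0|exists 0 => u /U0].
have t0 : 0 <= t by apply: lb_le_inf; [exists u0|move=> u /U0].
have tU u : U u -> t <= u by move=> Uu; apply: ge_inf => //; case: iU.
have tlt u : t < u -> U u.
  move=> tu; have [v Uv vu] := inf_adherent (ltac:(rewrite subr_gt0; exact: tu) : 0 < u - t) iU.
  by apply: (Uup v) => //; rewrite ltW// (lt_le_trans vu)// -/t; lra.
have tr : t < rho := le_lt_trans (tU _ Uu0) u0r.
have main := le_integral_cosine (ltac:(by rewrite t0 ltW) : 0 <= t <= rho) k0 kr dF cF1 (F0 _ (lexx _)).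
apply: (@le_trans _ _ ((k ^+ 2)%:E * \int[mu]_(u in `[t, rho]) (F u ^+ 2)%:E)%E).
  rewrite lee_pmul2l//= ?lte_fin ?exprn_gt0//.
  rewrite integral_mkcond [leRHS]integral_mkcond.
  apply: ge0_le_integral => //.
  - by move=> u uT; rewrite /patch; case: ifPn => // _; rewrite lee_fin sqr_ge0.
  - by apply/(measurable_restrict _ mU measurableT); rewrite setTI; exact: measurable_funTS.
  - by apply/(measurable_restrict _ (measurable_itv _) measurableT); rewrite setTI; exact: measurable_funTS.
  move=> u _; rewrite /patch; case: ifPn => [|_]; last first.
    by case: ifPn => // _; rewrite lee_fin sqr_ge0.
  rewrite inE => Uu; case: ifPn => // /negP uN.
  rewrite F0 ?expr0n// leNgt; apply/negP => ur; apply: uN.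
  by rewrite inE/= in_itv/= tU//= ltW.
apply: (le_trans main).
rewrite -integral_itv_obnd_cbnd; last exact: measurable_funTS.
apply: ge0_subset_integral => //.
- exact: measurable_funTS.
- by move=> u _; rewrite lee_fin sqr_ge0.
by move=> u; rewrite /= in_itv/= => /andP[/tlt].
Qed.

(** Each line directed by [n] meets [E] in a half-line on which the coordinate along [n] from [c] is
    nonnegative, which is the setting of the one-dimensional inequality. *)
Lemma hersch_piece phi n c (E : set (R * R)) (k rho : R) : smooth phi ->
  n.1 ^+ 2 + n.2 ^+ 2 = 1 -> measurable (E : set (mR * mR)) ->
  (forall p, E p -> 0 <= n.1 * (p.1 - c.1) + n.2 * (p.2 - c.2)) ->
  (forall p t, E p -> 0 <= t -> E (p.1 + t * n.1, p.2 + t * n.2)) ->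
  (forall p, rho <= n.1 * (p.1 - c.1) + n.2 * (p.2 - c.2) -> phi p = 0) ->
  0 < k -> k * rho < pi / 2 ->
  ((k ^+ 2)%:E * \int[mu2]_(p in E) (phi p ^+ 2)%:E <= \int[mu2]_(p in E) (dir1 phi n p ^+ 2)%:E)%E.
Proof.
move=> sphi n1 mE E0 Eup supp k0 kr.
have ht s u : n.1 * ((rigid n c (s, u)).1 - c.1) + n.2 * ((rigid n c (s, u)).2 - c.2) = u.
  have -> : n.1 * ((rigid n c (s, u)).1 - c.1) + n.2 * ((rigid n c (s, u)).2 - c.2) =
    u * (n.1 ^+ 2 + n.2 ^+ 2) by rewrite /rigid /frame/=; ring.
  by rewrite n1 mulr1.
have mr (f : R * R -> R) : continuous f ->
    measurable_fun [set: mR * mR] ((fun p => (f p ^+ 2)%:E) \_ E).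
  move=> cf; apply/(measurable_restrict _ mE measurableT); rewrite setTI.
  by apply: measurable_funTS; exact: measurable_sqrE.
rewrite integral_mkcond [leRHS]integral_mkcond.
apply: (le_integral_slices (c := c) n1).
- exact: sqr_ge0.
- by apply: mr; exact: (smooth_continuous (s := [::])).
- by move=> p; rewrite /patch; case: ifPn => // _; rewrite lee_fin sqr_ge0.
- by apply: mr; exact: continuous_dir1.
- by move=> p; rewrite /patch; case: ifPn => // _; rewrite lee_fin sqr_ge0.
move=> s; pose U := [set u | E (rigid n c (s, u))].
have slice (f : R * R -> R) : (\int[mu]_u ((fun p => (f p ^+ 2)%:E) \_ E) (rigid n c (s, u)) =
    \int[mu]_(u in U) (f (rigid n c (s, u)) ^+ 2)%:E)%E.
  rewrite [RHS]integral_mkcond; apply: eq_integral => u _; rewrite /patch.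
  have [h|h] := boolP (rigid n c (s, u) \in E); first by rewrite ifT// inE; move: h; rewrite inE.
  by rewrite ifF//; apply/negbTE/negP; rewrite inE => h'; move/negP: h; apply; rewrite inE.
rewrite !slice; apply: (le_integral_upclosed (rho := rho)) => //.
- by move=> u /E0; rewrite ht.
- move=> u v Uu uv; rewrite /U/= (_ : rigid n c (s, v) =
    ((rigid n c (s, u)).1 + (v - u) * n.1, (rigid n c (s, u)).2 + (v - u) * n.2)).
    by apply: Eup; rewrite // subr_ge0.
  by rewrite /rigid /frame/=; congr pair; ring.
- by move=> u; exact: is_derive_rigid.
- by apply: continuous_rigid; exact: continuous_dir1.
- by move=> u ru; apply: supp; rewrite ht.
Qed.

Lemma dot_le1 (m n : R * R) : m.1 ^+ 2 + m.2 ^+ 2 = 1 -> n.1 ^+ 2 + n.2 ^+ 2 = 1 ->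
  m.1 * n.1 + m.2 * n.2 <= 1.
Proof.
move=> hm hn; have := sqr_ge0 (m.1 - n.1); have := sqr_ge0 (m.2 - n.2).
by rewrite !sqrrB => *; lra.
Qed.

(** The nearest of the three lines is the one with the largest coordinate [L n p], which is
    nonnegative by the covering hypothesis. The region where [L n] is largest is stable under moves
    along [n], because no other coordinate grows faster in that direction. *)
Lemma hersch phi n1 n2 n3 c (k rho : R) : smooth phi ->
  n1.1 ^+ 2 + n1.2 ^+ 2 = 1 -> n2.1 ^+ 2 + n2.2 ^+ 2 = 1 -> n3.1 ^+ 2 + n3.2 ^+ 2 = 1 ->
  (forall p, [\/ 0 <= n1.1 * p.1 + n1.2 * p.2, 0 <= n2.1 * p.1 + n2.2 * p.2 |
     0 <= n3.1 * p.1 + n3.2 * p.2]) ->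
  (forall p, rho <= n1.1 * (p.1 - c.1) + n1.2 * (p.2 - c.2) -> phi p = 0) ->
  (forall p, rho <= n2.1 * (p.1 - c.1) + n2.2 * (p.2 - c.2) -> phi p = 0) ->
  (forall p, rho <= n3.1 * (p.1 - c.1) + n3.2 * (p.2 - c.2) -> phi p = 0) ->
  0 < k -> k * rho < pi / 2 ->
  ((k ^+ 2)%:E * \int[mu2]_p (phi p ^+ 2)%:E <=
   \int[mu2]_p (partials [:: i0] phi p ^+ 2 + partials [:: i1] phi p ^+ 2)%:E)%E.
Proof.
move=> sphi u1 u2 u3 cover s1 s2 s3 k0 kr.
pose L n p := n.1 * (p.1 - c.1) + n.2 * (p.2 - c.2).
have cL n : continuous (L n).
  have cp1 (p : R * R) : {for p, continuous (fun p : R * R => p.1)} by exact: cvg_fst.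
  have cp2 (p : R * R) : {for p, continuous (fun p : R * R => p.2)} by exact: cvg_snd.
  have ck (z : R) (p : R * R) : {for p, continuous (fun=> z)} by exact: cvg_cst.
  by move=> p; exact: (continuous_add (continuous_scal n.1 (continuous_sub (cp1 p) (ck _ _)))
    (continuous_scal n.2 (continuous_sub (cp2 p) (ck _ _)))).
have mL n : measurable_fun [set: mR * mR] (L n) by exact: continuous_measurable2.
have mle m n : measurable ([set p | L m p <= L n p] : set (mR * mR)).
  by rewrite -[X in measurable X]setTI; apply: measurable_fun_le.
have mlt m n : measurable ([set p | L m p < L n p] : set (mR * mR)).
  rewrite (_ : [set p | L m p < L n p] = ~` [set p | L n p <= L m p]).
    exact: measurableC.
  by apply/seteqP; split => p /=; rewrite leNgt; [move=> ->|move/negP; rewrite negbK].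
(* Strict and large inequalities are distributed so that ties are counted exactly once. *)
pose E1 := [set p | L n2 p <= L n1 p] `&` [set p | L n3 p <= L n1 p].
pose E2 := [set p | L n1 p < L n2 p] `&` [set p | L n3 p <= L n2 p].
pose E3 := [set p | L n1 p < L n3 p] `&` [set p | L n2 p < L n3 p].
have mE1 : measurable (E1 : set (mR * mR)) by exact: measurableI.
have mE2 : measurable (E2 : set (mR * mR)) by exact: measurableI.
have mE3 : measurable (E3 : set (mR * mR)) by exact: measurableI.
have L0 p : [\/ 0 <= L n1 p, 0 <= L n2 p | 0 <= L n3 p] by exact: (cover (p.1 - c.1, p.2 - c.2)).
have Lup m n p t : L m (p.1 + t * n.1, p.2 + t * n.2) = L m p + t * (m.1 * n.1 + m.2 * n.2).
  by rewrite /L/=; ring.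
have Lself n p t : n.1 ^+ 2 + n.2 ^+ 2 = 1 -> L n (p.1 + t * n.1, p.2 + t * n.2) = L n p + t.
  by move=> un; rewrite Lup -!expr2 un mulr1.
have Lother m n p t : m.1 ^+ 2 + m.2 ^+ 2 = 1 -> n.1 ^+ 2 + n.2 ^+ 2 = 1 -> 0 <= t ->
    L m (p.1 + t * n.1, p.2 + t * n.2) <= L m p + t.
  move=> um un t0; rewrite Lup lerD2l -[leRHS]mulr1 ler_wpM2l//; exact: dot_le1.
have p1 := hersch_piece (c := c) sphi u1 mE1
  (fun p => ltac:(by case=> /= h1 h2; case: (L0 p) => h; rewrite -/(L n1 p); lra))
  (fun p t => ltac:(by case=> /= h1 h2 t0; split; rewrite /= Lself//;
     [apply: le_trans (Lother n2 n1 p t u2 u1 t0) _|apply: le_trans (Lother n3 n1 p t u3 u1 t0) _];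
     rewrite lerD2r)) s1 k0 kr.
have p2 := hersch_piece (c := c) sphi u2 mE2
  (fun p => ltac:(by case=> /= h1 h2; case: (L0 p) => h; rewrite -/(L n2 p); lra))
  (fun p t => ltac:(by case=> /= h1 h2 t0; split; rewrite /= Lself//;
     [apply: le_lt_trans (Lother n1 n2 p t u1 u2 t0) _; rewrite ltrD2r|apply: le_trans (Lother n3 n2 p t u3 u2 t0) _; rewrite lerD2r])) s2 k0 kr.
have p3 := hersch_piece (c := c) sphi u3 mE3
  (fun p => ltac:(by case=> /= h1 h2; case: (L0 p) => h; rewrite -/(L n3 p); lra))
  (fun p t => ltac:(by case=> /= h1 h2 t0; split; rewrite /= Lself//;
     [apply: le_lt_trans (Lother n1 n3 p t u1 u3 t0) _|apply: le_lt_trans (Lother n2 n3 p t u2 u3 t0) _];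
     rewrite ltrD2r)) s3 k0 kr.
have split3 (f : mR * mR -> \bar R) : measurable_fun [set: mR * mR] f -> (forall p, (0 <= f p)%E) ->
    (\int[mu2]_p f p = \int[mu2]_(p in E1) f p + \int[mu2]_(p in E2) f p + \int[mu2]_(p in E3) f p)%E.
  have d12 : [disjoint E1 & E2].
    by apply/eqP; rewrite -subset0 => p [[/= h1 h2] [/= h3 h4]]; lra.
  have d123 : [disjoint E1 `|` E2 & E3].
    by apply/eqP; rewrite -subset0 => p [[[/= h1 h2]|[/= h1 h2]] [/= h3 h4]]; lra.
  move=> mf f0; rewrite -ge0_integral_setU//; last exact: measurable_funTS.
  rewrite -ge0_integral_setU//; [|exact: measurableU|exact: measurable_funTS].
  congr (integral _ _ _); apply/seteqP; split => // p _.
  rewrite /E1 /E2 /E3 /=; case: (leP (L n2 p) (L n1 p)) => h1.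
    case: (leP (L n3 p) (L n1 p)) => h2; first by left; left.
    by right; split => //; exact: le_lt_trans h1 h2.
  case: (leP (L n3 p) (L n2 p)) => h2; first by left; right.
  by right; split => //; exact: lt_trans h1 h2.
have cphi : continuous phi by exact: (smooth_continuous (s := [::])).
have c0 : continuous (partials [:: i0] phi) by exact: smooth_continuous.
have c1 : continuous (partials [:: i1] phi) by exact: smooth_continuous.
pose G p := (partials [:: i0] phi p ^+ 2 + partials [:: i1] phi p ^+ 2)%:E.
have mG : measurable_fun [set: mR * mR] G.
  have cG : continuous (fun p => partials [:: i0] phi p ^+ 2 + partials [:: i1] phi p ^+ 2).
    by move=> p; exact: (continuous_add (continuous_sqr (c0 p)) (continuous_sqr (c1 p))).
  by apply/measurable_EFinP; exact: (continuous_measurable2 cG).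
have G0 p : (0 <= G p)%E by rewrite lee_fin addr_ge0 ?sqr_ge0.
have f0 p : (0 <= (phi p ^+ 2)%:E)%E by rewrite lee_fin sqr_ge0.
have mf := measurable_sqrE cphi.
rewrite (split3 _ mf f0) (split3 _ mG G0).
have I0 (A : set (R * R)) : (0 <= \int[mu2]_(p in A) (phi p ^+ 2)%:E)%E by exact: integral_ge0.
rewrite ge0_muleDr; [|apply: adde_ge0; exact: I0|exact: I0].
rewrite ge0_muleDr; [|exact: I0|exact: I0].
have dirG n (A : set (mR * mR)) : measurable A -> n.1 ^+ 2 + n.2 ^+ 2 = 1 ->
    (\int[mu2]_(p in A) (dir1 phi n p ^+ 2)%:E <= \int[mu2]_(p in A) G p)%E.
  move=> mA un; apply: ge0_le_integral => //.
  - by move=> p _; rewrite lee_fin sqr_ge0.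
  - by apply: measurable_funTS; apply: measurable_sqrE; exact: continuous_dir1.
  - exact: measurable_funTS.
  move=> p _; rewrite lee_fin /dir1.
  move: (partials [:: i0] phi p) (partials [:: i1] phi p) => a b.
  rewrite -subr_ge0 (_ : _ - _ = (n.2 * a - n.1 * b) ^+ 2) ?sqr_ge0//.
  have -> : a ^+ 2 + b ^+ 2 = (a ^+ 2 + b ^+ 2) * (n.1 ^+ 2 + n.2 ^+ 2) by rewrite un mulr1.
  by ring.
exact: (leeD (leeD (le_trans p1 (dirG _ _ mE1 u1)) (le_trans p2 (dirG _ _ mE2 u2)))
  (le_trans p3 (dirG _ _ mE3 u3))).
Qed.

End Hersch.

(** * Continuity of arithmetic expressions *)

Section Contact.
Context {R : realType}.
Implicit Types (p q n e : R * R) (Om : set (R * R)).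

Lemma continuous_fst_comp (T : topologicalType) (V W : topologicalType) (f : T -> V * W) (x : T) :
  {for x, continuous f} -> {for x, continuous (fun y => (f y).1)}.
Proof. by move=> cf; apply: (@continuous_comp _ _ _ f fst) => //; exact: cvg_fst. Qed.

Lemma continuous_snd_comp (T : topologicalType) (V W : topologicalType) (f : T -> V * W) (x : T) :
  {for x, continuous f} -> {for x, continuous (fun y => (f y).2)}.
Proof. by move=> cf; apply: (@continuous_comp _ _ _ f snd) => //; exact: cvg_snd. Qed.

Lemma continuous_opp (T : topologicalType) (f : T -> R) (x : T) :
  {for x, continuous f} -> {for x, continuous (fun y => - f y)}.
Proof. by move=> cf; exact: cvgN. Qed.

Lemma continuous_norm_comp (T : topologicalType) (f : T -> R) (x : T) :
  {for x, continuous f} -> {for x, continuous (fun y => `|f y|)}.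
Proof. by move=> cf; exact: cvg_norm. Qed.

End Contact.

(** Structural descent on the body of the function. Subtraction is matched before addition, since it
    is the addition of an opposite. *)
Ltac continuity_arith :=
  repeat (lazy beta delta [prop_for]; lazymatch goal with
  | |- continuous_at ?x (fun=> ?c) => exact: cvg_cst
  | |- continuous_at ?x (fun y => y) => exact: cvg_id
  | |- continuous_at ?x fst => exact: cvg_fst
  | |- continuous_at ?x snd => exact: cvg_snd
  | |- continuous_at ?x (fun y => @Algebra.add _ (@?f y) (@Algebra.opp _ (@?g y))) =>
       apply: (@continuous_sub _ _ f g x)
  | |- continuous_at ?x (fun y => @Algebra.add _ (@?f y) (@?g y)) => apply: (@continuous_add _ _ f g x)
  | |- continuous_at ?x (fun y => @Algebra.opp _ (@?f y)) => apply: (@continuous_opp _ _ f x)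
  | |- continuous_at ?x (fun y => @GRing.mul _ (@?f y) (@?g y)) => apply: (@continuous_mul _ _ f g x)
  | |- continuous_at ?x (fun y => @GRing.exp _ (@?f y) 2) => apply: (@continuous_sqr _ _ f x)
  | |- continuous_at ?x (fun y => `|@?f y|) => apply: (@continuous_norm_comp _ _ f x)
  | |- continuous_at ?x (fun y => (@?f y).1) => apply: (@continuous_fst_comp _ _ _ f x)
  | |- continuous_at ?x (fun y => (@?f y).2) => apply: (@continuous_snd_comp _ _ _ f x)
  | |- continuous_at ?x (fun y => (@?f y, @?g y)) => apply: (@continuous_pair _ _ f g x)
  end).

(** * A largest inscribed disk and its contact points *)

Section Contact.
Context {R : realType}.
Implicit Types (p q n e : R * R) (Om : set (R * R)).

Lemma closed_le_fun (T : topologicalType) (f g : T -> R) :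
  continuous f -> continuous g -> closed [set x | f x <= g x].
Proof.
move=> cf cg; rewrite (_ : [set x | f x <= g x] = (fun x => f x - g x) @^-1` [set y | y <= 0]).
  apply: preimage_closed; last exact: closed_le.
  by move=> x _; apply: continuous_sub; [exact: cf|exact: cg].
by apply/seteqP; split => x /=; rewrite subr_le0.
Qed.

Definition dist2 q p := (q.1 - p.1) ^+ 2 + (q.2 - p.2) ^+ 2.

Lemma bounded_box_set Om : bounded_set Om ->
  exists2 M : R, 0 < M & forall p, Om p -> `|p.1| <= M /\ `|p.2| <= M.
Proof.
move=> [M [_ HM]]; exists (`|M| + 1); first by rewrite ltr_wpDl.
move=> p /(HM (`|M| + 1)) h.
have {h} : `|p| <= `|M| + 1 by apply: h; rewrite (le_lt_trans (ler_norm M))// ltrDl.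
by rewrite prod_normE ge_max => /andP.
Qed.

Lemma open_dist2 Om p : open Om -> Om p ->
  exists2 e : R, 0 < e & forall q, dist2 q p < e ^+ 2 -> Om q.
Proof.
move=> oO /oO /nbhs_ballP[e /= e0 pe]; exists e => // q qp; apply: pe.
have h1 := sqr_ge0 (q.1 - p.1); have h2 := sqr_ge0 (q.2 - p.2).
rewrite /dist2 in qp.
by split; rewrite /ball/= distrC -ltr_sqr ?nnegrE// ?ltW// real_normK ?num_real//; lra.
Qed.

(** Maximize the radius over a compact set of pairs (center, radius). If the half-plane of [e]
    contained no contact point, the complement of [Om] there would stay farther than rho by a fixed
    margin, and a small move of the center into that half-plane would make room for a larger
    disk. *)
Lemma inscribed_disk Om : open Om -> bounded_set Om -> Om !=set0 ->
  exists p, exists2 rho : R, 0 < rho &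
   (forall q, ~ Om q -> rho ^+ 2 <= dist2 q p) /\
   (forall e, exists q, [/\ ~ Om q, dist2 q p = rho ^+ 2 &
      e.1 * (q.1 - p.1) + e.2 * (q.2 - p.2) <= 0]).
Proof.
move=> oO bO [p0 Op0]; have [M M0 HM] := bounded_box_set bO.
pose S : set ((R * R) * R) := [set x | [/\ `|x.1.1| <= M, `|x.1.2| <= M, 0 <= x.2 <= 3 * M &
  forall q, ~ Om q -> x.2 ^+ 2 <= dist2 q x.1]].
have cS : compact S.
  apply: (@subclosed_compact _ _ ((`[- M, M]%classic `*` `[- M, M]%classic) `*` `[0, 3 * M]%classic)).
  - rewrite (_ : S = [set x | `|x.1.1| <= M] `&` [set x | `|x.1.2| <= M] `&`
      ([set x | 0 <= x.2] `&` [set x | x.2 <= 3 * M]) `&`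
      \bigcap_(q in ~` Om) [set x | x.2 ^+ 2 <= dist2 q x.1]).
      repeat apply: closedI.
      + apply: closed_le_fun => x; last exact: cvg_cst.
        by continuity_arith.
      + apply: closed_le_fun => x; last exact: cvg_cst.
        by continuity_arith.
      + by apply: closed_le_fun => x; continuity_arith.
      + by apply: closed_le_fun => x; continuity_arith.
      + by apply: closed_bigI => q _; apply: closed_le_fun => x; rewrite /dist2; continuity_arith.
    apply/seteqP; split => x.
      by case=> h1 h2 /andP[h3 h4] h5; split; first split.
    by case=> [[[h1 h2] [h3 h4]] h5]; split => //; apply/andP.
  - by repeat apply: compact_setX; exact: segment_compact.
  - move=> x [h1 h2 h3 _]; rewrite !ler_norml in h1 h2; split => /=; last by rewrite in_itv.
    by split; rewrite /= in_itv.
have [e e0 He] := open_dist2 oO Op0.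
have m0 : 0 < Num.min e M by rewrite lt_min e0.
have [me mM] : Num.min e M <= e /\ Num.min e M <= M by rewrite !ge_min !lexx orbT.
have S0 : S (p0, Num.min e M).
  have [h1 h2] := HM _ Op0; split => //=; first by apply/andP; split; lra.
  move=> q Oq; have : e ^+ 2 <= dist2 q p0 by rewrite leNgt; apply/negP => /He.
  apply: le_trans.
  by rewrite ler_sqr// ?nnegrE ltW.
have [|[p rho] /= + maxS] := @compact_EVT_max _ R (fun x => x.2) S (ex_intro _ _ S0) cS.
  by apply: continuous_subspaceT => x; exact: cvg_snd.
rewrite inE => -[/= p1 p2 /andP[r0 r3] Hp].
have rho0 : 0 < rho by have := maxS _ (mem_set S0) => /= h; lra.
(* The bound 3 M on the radius, imposed for compactness, excludes no inscribed disk: a larger one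
   would contain a point of [Om] outside the box of half-side M. *)
have noimp p' t : 0 < t -> (forall q, ~ Om q -> t ^+ 2 <= dist2 q p') -> t <= rho.
  move=> t0 H.
  have Op' : Om p'.
    by apply: contrapT => /H; rewrite /dist2 !subrr expr0n/= addr0 leNgt exprn_gt0.
  have [h1 h2] := HM _ Op'.
  apply: (maxS (p', t)); rewrite inE; split => //=; rewrite ltW//= leNgt; apply/negP => t3.
  have : Om (p'.1 + 3 * M, p'.2).
    apply: contrapT => /H; rewrite /dist2/= subrr expr0n/= addr0 leNgt => /negP; apply.
    by rewrite addrAC subrr add0r ltr_sqr// ?nnegrE; lra.
  by move=> /HM[/= + _]; move: h1; rewrite !ler_norml => /andP[h3 h4] /andP[h5 h6]; lra.
exists p, rho => //; split => //.
have main e' : e'.1 ^+ 2 + e'.2 ^+ 2 != 0 -> exists q, [/\ ~ Om q, dist2 q p = rho ^+ 2 &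
      e'.1 * (q.1 - p.1) + e'.2 * (q.2 - p.2) <= 0].
  move=> N0; set N := _ + _ in N0.
  have {}N0 : 0 < N by rewrite lt_neqAle eq_sym N0 addr_ge0 ?sqr_ge0.
  apply: contrapT => no.
  have [m mr Hm] : exists2 m, rho ^+ 2 < m & forall q, ~ Om q ->
      e'.1 * (q.1 - p.1) + e'.2 * (q.2 - p.2) <= 0 -> m <= dist2 q p.
    pose Z := [set q | [/\ ~ Om q, dist2 q p <= 4 * rho ^+ 2 & e'.1 * (q.1 - p.1) + e'.2 * (q.2 - p.2) <= 0]].
    have r40 : rho ^+ 2 < 4 * rho ^+ 2 by have := exprn_gt0 2 rho0; lra.
    have [[z Zz]|Z0] := pselect (Z !=set0); last first.
      exists (4 * rho ^+ 2) => // q Oq eq; rewrite leNgt; apply/negP => dq; apply: Z0.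
      by exists q; split => //; exact: ltW.
    have cZ : compact Z.
      pose B := 2 * rho.
      apply: (@subclosed_compact _ _ (`[p.1 - B, p.1 + B]%classic `*` `[p.2 - B, p.2 + B]%classic)).
      - rewrite (_ : Z = ~` Om `&` [set q | dist2 q p <= 4 * rho ^+ 2] `&`
          [set q | e'.1 * (q.1 - p.1) + e'.2 * (q.2 - p.2) <= 0]).
          apply: closedI; first apply: closedI; first exact: open_closedC.
          + by apply: closed_le_fun => x; rewrite /dist2; continuity_arith.
          + by apply: closed_le_fun => x; continuity_arith.
        by apply/seteqP; split => q; [case=> ? ? ?; split => //; split|case=> -[? ?] ?; split].
      - by apply: compact_setX; exact: segment_compact.
      - move=> q [_ + _]; rewrite /dist2 => dq.
        have B2 : B ^+ 2 = 4 * rho ^+ 2 by rewrite /B; ring.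
        have B0 : 0 <= B by rewrite mulr_ge0// ltW.
        have h1 := sqr_ge0 (q.1 - p.1); have h2 := sqr_ge0 (q.2 - p.2).
        have : `|q.1 - p.1| <= B by rewrite -ler_sqr ?nnegrE// real_normK ?num_real//; lra.
        have : `|q.2 - p.2| <= B by rewrite -ler_sqr ?nnegrE// real_normK ?num_real//; lra.
        by rewrite !ler_norml; clear => /andP[? ?] /andP[? ?]; split; rewrite /= in_itv/=; apply/andP; split; lra.
    have [|z0 /= + minZ] := @compact_EVT_min _ R (fun q => dist2 q p) Z (ex_intro _ _ Zz) cZ.
      by apply: continuous_subspaceT => q; rewrite /dist2; continuity_arith.
    rewrite inE => -[Oz dz ez]; exists (dist2 z0 p).
      rewrite lt_neqAle Hp// andbT; apply/eqP => h; apply: no; by exists z0.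
    move=> q Oq eq; have [h|h] := leP (dist2 q p) (4 * rho ^+ 2).
      by apply: minZ; rewrite inE.
    exact: le_trans dz (ltW h).
  have mN : 0 < m + N by have := exprn_gt0 2 rho0; lra.
  (* The center moves by - s e'. Where e' . (q - p) > 0 the squared distance gains at least s^2 N;
     elsewhere it stays above (1 - s) m - s N, which this [s] makes the midpoint of m and rho^2. *)
  pose s := (m - rho ^+ 2) / (2 * (m + N)).
  have s0 : 0 < s by rewrite divr_gt0// ?subr_gt0//; lra.
  have sE : (1 - s) * m - s * N = (m + rho ^+ 2) / 2.
    rewrite /s; field; rewrite gt_eqF//.
  have s1 : s <= 1.
    by rewrite /s ler_pdivrMr ?mul1r; have := exprn_gt0 2 rho0; lra.
  pose t2 := Num.min (rho ^+ 2 + s ^+ 2 * N) ((m + rho ^+ 2) / 2).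
  have sN : 0 < s ^+ 2 * N by rewrite mulr_gt0 ?exprn_gt0.
  have t2r : rho ^+ 2 < t2 by rewrite lt_min; apply/andP; split; lra.
  have [t2a t2b] : t2 <= rho ^+ 2 + s ^+ 2 * N /\ t2 <= (m + rho ^+ 2) / 2 by rewrite !ge_min !lexx orbT.
  have t20 : 0 < t2 by have := exprn_gt0 2 rho0; lra.
  have : Num.sqrt t2 <= rho.
    apply: (noimp (p.1 - s * e'.1, p.2 - s * e'.2)); first by rewrite sqrtr_gt0.
    move=> q Oq; rewrite sqr_sqrtr; last exact: ltW.
    have dE : dist2 q (p.1 - s * e'.1, p.2 - s * e'.2) = dist2 q p +
        2 * s * (e'.1 * (q.1 - p.1) + e'.2 * (q.2 - p.2)) + s ^+ 2 * N by rewrite /dist2 /N/=; ring.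
    have [h|h] := leP (e'.1 * (q.1 - p.1) + e'.2 * (q.2 - p.2)) 0.
      have mq := Hm _ Oq h; apply: (le_trans t2b); rewrite -sE.
      have cs : - (dist2 q p + N) <= 2 * (e'.1 * (q.1 - p.1) + e'.2 * (q.2 - p.2)).
        rewrite -subr_ge0 (_ : _ - _ = (e'.1 + (q.1 - p.1)) ^+ 2 + (e'.2 + (q.2 - p.2)) ^+ 2).
          by rewrite addr_ge0 ?sqr_ge0.
        by rewrite /dist2 /N; ring.
      have := ler_wpM2l (ltW s0) cs.
      have : (1 - s) * m <= (1 - s) * dist2 q p by rewrite ler_wpM2l ?subr_ge0.
      by rewrite dE; lra.
    apply: (le_trans t2a); rewrite dE; have := Hp _ Oq; have := mulr_gt0 s0 h; lra.
  rewrite leNgt => /negP; apply.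
  by rewrite -(ltr_sqr) ?nnegrE ?sqrtr_ge0 ?ltW// sqr_sqrtr// ltW.
move=> e'; have [eN|] := eqVneq (e'.1 ^+ 2 + e'.2 ^+ 2) 0; last exact: main.
have [|q [h1 h2 _]] := main (1, 0); first by rewrite /= expr1n expr0n/= addr0 oner_neq0.
exists q; split => //.
have [-> ->] : e'.1 = 0 /\ e'.2 = 0.
  move/eqP: eN; rewrite paddr_eq0 ?sqr_ge0// !sqrf_eq0 => /andP[/eqP -> /eqP ->] //.
by rewrite !mul0r addr0.
Qed.

End Contact.

(** * Three contact normals with the origin as a convex combination *)

Section Normals.
Context {R : realType}.
Implicit Types (p q n e : R * R) (Om N : set (R * R)).

(** On the upper unit half-circle a smaller abscissa means a larger angle, and the expression is the
    sine of the difference of the two angles. *)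
Lemma arc_ge0 (x y a b : R) : x ^+ 2 + y ^+ 2 = 1 -> a ^+ 2 + b ^+ 2 = 1 ->
  0 <= y -> 0 <= b -> a <= x -> 0 <= x * b - y * a.
Proof.
move=> xy ab y0 b0 ax; have [x0|x0] := leP 0 x.
  have [a0|a0] := leP a 0; first by nra.
  have yb : y <= b by rewrite -ler_sqr ?nnegrE//; nra.
  by nra.
have yb : b <= y by rewrite -ler_sqr ?nnegrE//; nra.
by nra.
Qed.

(** The last hypothesis says that the angle from b to a through (1, 0) is less than a half-turn. The
    linear form n x (a - b) is then positive on the upper part of the arc between them. *)
Lemma arc_gt0 (x y a1 a2 b1 b2 : R) : x ^+ 2 + y ^+ 2 = 1 -> a1 ^+ 2 + a2 ^+ 2 = 1 ->
  0 <= y -> 0 <= a2 -> b2 <= 0 -> a1 <= x -> a1 * b2 - a2 * b1 < 0 ->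
  0 < x * (a2 - b2) - y * (a1 - b1).
Proof.
move=> xy aa y0 a20 b20 ax w0; move: a20 aa w0.
rewrite le_eqVlt => /predU1P[<-|a20] aa w0.
  have w0' : a1 * b2 < 0 by lra.
  have b2lt : b2 < 0 by rewrite lt_neqAle b20 andbT; apply/eqP => b2e; move: w0'; rewrite b2e; lra.
  have a1gt : 0 < a1 by rewrite -(nmulr_llt0 _ b2lt).
  have a1e : a1 = 1.
    have : (a1 - 1) * (a1 + 1) = 0 by lra.
    by move=> /eqP; rewrite mulf_eq0 => /orP[] /eqP; lra.
  have y20 : y ^+ 2 = 0 by have := sqr_ge0 y; nra.
  have y00 : y = 0 by apply/eqP; rewrite -sqrf_eq0 y20.
  by rewrite y00; nra.
have h := arc_ge0 xy aa y0 (ltW a20) ax.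
rewrite -(pmulr_rgt0 _ a20).
have -> : a2 * (x * (a2 - b2) - y * (a1 - b1)) =
  (x * a2 - y * a1) * (a2 - b2) + y * (- (a1 * b2 - a2 * b1)) by ring.
move: y0; rewrite le_eqVlt => /predU1P[y0|y0]; last first.
  by apply: ltr_wpDl; [apply: mulr_ge0 => //; lra|apply: mulr_gt0 => //; lra].
rewrite -y0 mul0r subr0 in h; rewrite -y0 !mul0r addr0 subr0.
apply: mulr_gt0; last lra.
rewrite lt0r h andbT mulf_neq0 ?(gt_eqF a20)//.
by apply/eqP => x0; move: xy; rewrite -y0 x0 expr0n/= addr0 => /eqP; rewrite eq_sym oner_eq0.
Qed.

Lemma compact_unit_closed N : closed N -> (forall n, N n -> n.1 ^+ 2 + n.2 ^+ 2 = 1) -> compact N.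
Proof.
move=> cN uN; apply: (@subclosed_compact _ _ (`[-1, 1]%classic `*` `[-1, 1]%classic : set (R * R))) => //.
  by apply: compact_setX; exact: segment_compact.
by move=> n /uN h; split; rewrite /= in_itv/=; apply/andP; split; nra.
Qed.

(** A planar Caratheodory argument. Fix m in [N], let X and Y be the cosine and sine of the angle
    from m, and let a and b be the elements of [N] farthest from m in the upper and lower
    half-turns. If they are less than a half-turn apart through m, that is [w < 0], then [N] lies in
    an open half-plane, against the hypothesis. Otherwise the identity (a x b) m + (b x m) a + (m x
    a) b = 0 gives nonnegative weights. *)
Lemma contact_normals N : closed N -> (forall n, N n -> n.1 ^+ 2 + n.2 ^+ 2 = 1) ->
  (forall e, exists2 n, N n & e.1 * n.1 + e.2 * n.2 <= 0) ->
  exists n1 n2 n3 l1 l2 l3, [/\ [/\ N n1, N n2 & N n3], [/\ 0 <= l1, 0 <= l2 & 0 <= l3],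
    l1 + l2 + l3 = 1, l1 * n1.1 + l2 * n2.1 + l3 * n3.1 = 0 & l1 * n1.2 + l2 * n2.2 + l3 * n3.2 = 0].
Proof.
move=> cN uN HN; have [m Nm _] := HN (0, 0); have um := uN m Nm.
pose X n := m.1 * n.1 + m.2 * n.2; pose Y n := m.1 * n.2 - m.2 * n.1.
have XY n : N n -> X n ^+ 2 + Y n ^+ 2 = 1.
  move=> /uN un; have -> : X n ^+ 2 + Y n ^+ 2 = (m.1 ^+ 2 + m.2 ^+ 2) * (n.1 ^+ 2 + n.2 ^+ 2).
    by rewrite /X /Y; ring.
  by rewrite um un mulr1.
have Ym : Y m = 0 by rewrite /Y mulrC subrr.
have cX : continuous X by move=> n; rewrite /X; continuity_arith.
have cY : continuous Y by move=> n; rewrite /Y; continuity_arith.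
have minX A : closed A -> A `<=` N -> A m -> exists2 a, A a & forall n, A n -> X a <= X n.
  move=> cA AN Am.
  have [a aA Ha] := @compact_EVT_min _ R X A (ex_intro _ _ Am)
    (compact_unit_closed cA (fun n An => uN n (AN n An))) (continuous_subspaceT cX).
  by exists a => [|n An]; [rewrite inE in aA|apply: Ha; rewrite inE].
have c0 : continuous (fun _ : R * R => (0 : R)) by move=> n; exact: cvg_cst.
have [|||a [Na a2] Ha] := minX (N `&` [set n | 0 <= Y n]).
- by apply: closedI => //; exact: closed_le_fun.
- by move=> n [].
- by split => //=; rewrite Ym.
have [|||b [Nb b2] Hb] := minX (N `&` [set n | Y n <= 0]).
- by apply: closedI => //; exact: closed_le_fun.
- by move=> n [].
- by split => //=; rewrite Ym.
rewrite /= in a2 b2.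
have ua := XY a Na; have ub := XY b Nb.
pose w := X a * Y b - Y a * X b.
have wE : w = a.1 * b.2 - a.2 * b.1.
  have -> : a.1 * b.2 - a.2 * b.1 = (m.1 ^+ 2 + m.2 ^+ 2) * (a.1 * b.2 - a.2 * b.1) by rewrite um mul1r.
  by rewrite /w /X /Y; ring.
have [w0|w0] := ltP w 0.
  have [n Nn] := HN ((a.2 - b.2), - (a.1 - b.1)).
  rewrite (_ : _ + _ = X n * (Y a - Y b) - Y n * (X a - X b)); last first.
    transitivity ((m.1 ^+ 2 + m.2 ^+ 2) * ((a.2 - b.2) * n.1 + - (a.1 - b.1) * n.2)).
      by rewrite um mul1r.
    by rewrite /X /Y; ring.
  rewrite leNgt => /negP[]; have un := XY n Nn.
  have [Yn|/ltW Yn] := leP 0 (Y n).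
    by apply: (arc_gt0 un ua Yn a2 b2 _ w0); exact: Ha.
  have -> : X n * (Y a - Y b) - Y n * (X a - X b) = X n * (- Y b - - Y a) - (- Y n) * (X b - X a) by ring.
  apply: arc_gt0; rewrite ?sqrrN ?oppr_ge0 ?oppr_le0//; first exact: Hb.
  by rewrite /w in w0; lra.
have S0 : 0 <= w - Y b + Y a by lra.
move: S0; rewrite le_eqVlt => /predU1P[S0|S0]; last first.
  set s := _ + _ in S0.
  exists m, a, b, (w / s), (- Y b / s), (Y a / s); split => //.
  - by split; apply: divr_ge0; rewrite ?oppr_ge0// ltW.
  - by rewrite -!mulrDl -/s divff ?gt_eqF.
  - by rewrite wE /Y; field; rewrite gt_eqF.
  - by rewrite wE /Y; field; rewrite gt_eqF.
(* The weights all vanish only if a and b are collinear with m. Then one of them is - m, which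
   balances m alone, for otherwise X would be positive on all of [N]. *)
have [aY bY] : Y a = 0 /\ Y b = 0 by lra.
rewrite aY expr0n/= addr0 in ua; rewrite bY expr0n/= addr0 in ub.
have opp n : Y n = 0 -> X n = -1 -> n = (- m.1, - m.2).
  move=> Yn Xn; rewrite [n]surjective_pairing; congr (_, _).
    transitivity (m.1 * X n - m.2 * Y n); last by rewrite Xn Yn; ring.
    transitivity ((m.1 ^+ 2 + m.2 ^+ 2) * n.1); first by rewrite um mul1r.
    by rewrite /X /Y; ring.
  transitivity (m.2 * X n + m.1 * Y n); last by rewrite Xn Yn; ring.
  transitivity ((m.1 ^+ 2 + m.2 ^+ 2) * n.2); first by rewrite um mul1r.
  by rewrite /X /Y; ring.
have half n : N n -> Y n = 0 -> X n = -1 -> exists n1 n2 n3 l1 l2 l3,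
    [/\ [/\ N n1, N n2 & N n3], [/\ 0 <= l1, 0 <= l2 & 0 <= l3],
    l1 + l2 + l3 = 1, l1 * n1.1 + l2 * n2.1 + l3 * n3.1 = 0 & l1 * n1.2 + l2 * n2.2 + l3 * n3.2 = 0 :> R].
  move=> Nn Yn Xn; exists m, n, n, (1 / 2), (1 / 2), 0.
  by rewrite (opp n Yn Xn) /=; rewrite (opp n Yn Xn) in Nn; split; [|split; lra|lra|lra|lra].
have sq1 (z : R) : z ^+ 2 = 1 -> z != -1 -> z = 1.
  by move=> z2 z1; apply/eqP; have /eqP := z2; rewrite sqrf_eq1 (negbTE z1) orbF.
have [Xa|Xa] := eqVneq (X a) (-1); first exact: (half a).
have [Xb|Xb] := eqVneq (X b) (-1); first exact: (half b).
have [n Nn] := HN m; rewrite -/(X n) leNgt => /negP[].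
have [Yn|/ltW Yn] := leP 0 (Y n).
  by apply: (lt_le_trans _ (Ha n (conj Nn Yn))); rewrite (sq1 _ ua Xa).
by apply: (lt_le_trans _ (Hb n (conj Nn Yn))); rewrite (sq1 _ ub Xb).
Qed.

End Normals.

(** * The circumscribed triangle and the strip that it provides *)

Section Triangle.
Context {R : realType}.
Notation mR := (measurableTypeR R).
Notation mu := (@lebesgue_measure R).
Notation mu2 := (leb2 R).
Implicit Types (p q n x : R * R) (Om : set (R * R)).

Definition convex_plane Om := forall p q (t : R), Om p -> Om q -> 0 <= t <= 1 ->
  Om (t * p.1 + (1 - t) * q.1, t * p.2 + (1 - t) * q.2).

Lemma convex_planeP Om : convex_set Om -> convex_plane Om.
Proof.
move=> cO p q t Op Oq /andP[t0 t1].
have h := cO p q (Itv01 t0 t1) (mem_set Op) (mem_set Oq).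
by move: h; rewrite inE.
Qed.

(** If a point of [Om] were beyond the tangent at q, the segment from it through q could be
    prolonged into the open disk, hence inside [Om], and convexity would put q in [Om]. The
    inequality is strict because [Om] is open. *)
Lemma support_disk Om p q x (rho : R) : open Om -> convex_plane Om -> 0 < rho ->
  (forall q, ~ Om q -> rho ^+ 2 <= dist2 q p) -> ~ Om q -> dist2 q p = rho ^+ 2 -> Om x ->
  (q.1 - p.1) * (x.1 - p.1) + (q.2 - p.2) * (x.2 - p.2) < rho ^+ 2.
Proof.
move=> oO cO r0 Hp Oq dq.
have main y : Om y -> (q.1 - p.1) * (y.1 - p.1) + (q.2 - p.2) * (y.2 - p.2) <= rho ^+ 2.
  move=> Oy; rewrite leNgt; apply/negP => h.
  pose g := (q.1 - p.1) * (y.1 - p.1) + (q.2 - p.2) * (y.2 - p.2) - rho ^+ 2.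
  have g0 : 0 < g by rewrite /g subr_gt0.
  pose D := dist2 y q; have D0 : 0 <= D by rewrite addr_ge0 ?sqr_ge0.
  have D1 : 0 < D + 1 by lra.
  pose t := g / (D + 1); have t0 : 0 < t by rewrite divr_gt0.
  have tD : t * (D + 1) = g by rewrite divfK// gt_eqF.
  pose z := (q.1 + t * (q.1 - y.1), q.2 + t * (q.2 - y.2)).
  have Oz : Om z.
    apply: contrapT => /Hp; rewrite leNgt => /negP; apply.
    have -> : dist2 z p = rho ^+ 2 - 2 * t * g + t ^+ 2 * D.
      by rewrite -dq /g -dq /z /D /dist2 /=; ring.
    have : t * t * (D + 1) = t * g by rewrite -mulrA tD.
    have := mulr_gt0 t0 g0; have := mulr_gt0 t0 t0; lra.
  apply: Oq.
  have := cO z y (1 / (1 + t)) Oz Oy.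
  have t1 : 0 < 1 + t by lra.
  have -> : (1 / (1 + t) * z.1 + (1 - 1 / (1 + t)) * y.1, 1 / (1 + t) * z.2 + (1 - 1 / (1 + t)) * y.2) = q.
    by rewrite [RHS]surjective_pairing /z/=; congr (_, _); field; rewrite gt_eqF.
  apply; apply/andP; split; first by apply: divr_ge0 => //; exact: ltW.
  by rewrite ler_pdivrMr// mul1r; lra.
move=> Ox; have [e e0 He] := open_dist2 oO Ox.
pose t := e / (2 * rho); have t0 : 0 < t by rewrite divr_gt0// mulr_gt0.
have tr : t * rho = e / 2 by rewrite /t; field; rewrite gt_eqF.
have /main /= : Om (x.1 + t * (q.1 - p.1), x.2 + t * (q.2 - p.2)).
  apply: He; have -> : dist2 (x.1 + t * (q.1 - p.1), x.2 + t * (q.2 - p.2)) x = t ^+ 2 * dist2 q p.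
    by rewrite /dist2/=; ring.
  rewrite dq -exprMn tr expr_div_n ltr_pdivrMr ?exprn_gt0//.
  by have := exprn_gt0 2 e0; lra.
have : 0 < t * rho ^+ 2 by rewrite mulr_gt0// exprn_gt0.
rewrite -dq /dist2; lra.
Qed.

Lemma supporting_triangle Om : open Om -> bounded_set Om -> convex_plane Om -> Om !=set0 ->
  exists p rho n1 n2 n3 l1 l2 l3, [/\ 0 < rho, (forall q, ~ Om q -> rho ^+ 2 <= dist2 q p),
    [/\ n1.1 ^+ 2 + n1.2 ^+ 2 = 1, n2.1 ^+ 2 + n2.2 ^+ 2 = 1 & n3.1 ^+ 2 + n3.2 ^+ 2 = 1],
    [/\ [/\ 0 <= l1, 0 <= l2 & 0 <= l3], l1 + l2 + l3 = 1,
      l1 * n1.1 + l2 * n2.1 + l3 * n3.1 = 0 & l1 * n1.2 + l2 * n2.2 + l3 * n3.2 = 0] &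
    forall x, Om x -> [/\ n1.1 * (x.1 - p.1) + n1.2 * (x.2 - p.2) < rho,
      n2.1 * (x.1 - p.1) + n2.2 * (x.2 - p.2) < rho & n3.1 * (x.1 - p.1) + n3.2 * (x.2 - p.2) < rho]].
Proof.
move=> oO bO cO O0; have [p [rho r0 [Hp Hc]]] := inscribed_disk oO bO O0.
have rn0 : rho != 0 by rewrite gt_eqF.
pose N := [set n : R * R | n.1 ^+ 2 + n.2 ^+ 2 = 1 /\ ~ Om (p.1 + rho * n.1, p.2 + rho * n.2)].
have cN : closed N.
  have -> : N = [set n : R * R | n.1 ^+ 2 + n.2 ^+ 2 <= 1] `&` [set n | 1 <= n.1 ^+ 2 + n.2 ^+ 2]
     `&` (fun n => (p.1 + rho * n.1, p.2 + rho * n.2)) @^-1` (~` Om).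
    apply/seteqP; split => n /=; first by case=> -> ?; rewrite lexx.
    by case=> -[h1 h2] ?; split => //; apply/eqP; rewrite eq_le h1 h2.
  apply: closedI; first apply: closedI.
  - by apply: closed_le_fun => n; continuity_arith.
  - by apply: closed_le_fun => n; continuity_arith.
  - apply: preimage_closed; last exact: open_closedC.
    by move=> n _; continuity_arith.
have [|e|n1 [n2 [n3 [l1 [l2 [l3 [[[u1 N1] [u2 N2] [u3 N3]] H1 H2 H3 H4]]]]]]] := contact_normals cN.
- by move=> n [].
- have [q [Oq dq eq]] := Hc e.
  exists ((q.1 - p.1) / rho, (q.2 - p.2) / rho).
    split; rewrite /= ?expr_div_n.
      by rewrite -mulrDl -/(dist2 q p) dq divff// expf_neq0.
    by rewrite (mulrC rho) divfK// (mulrC rho) divfK// addrCA subrr addr0 addrCA subrr addr0 -surjective_pairing.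
  by rewrite /= !mulrA -mulrDl pmulr_lle0// invr_gt0.
exists p, rho, n1, n2, n3, l1, l2, l3; split => //.
have sup n : n.1 ^+ 2 + n.2 ^+ 2 = 1 -> ~ Om (p.1 + rho * n.1, p.2 + rho * n.2) ->
    forall x, Om x -> n.1 * (x.1 - p.1) + n.2 * (x.2 - p.2) < rho.
  move=> un Nn x Ox; have := support_disk oO cO r0 Hp Nn _ Ox.
  have aK (a b : R) : a + b - a = b by ring.
  rewrite /dist2/= !aK => h.
  have {}h := h ltac:(by transitivity (rho ^+ 2 * (n.1 ^+ 2 + n.2 ^+ 2)); [ring|rewrite un mulr1]).
  move: h; rewrite (_ : _ + _ = rho * (n.1 * (x.1 - p.1) + n.2 * (x.2 - p.2))); last by ring.
  by rewrite expr2 ltr_pM2l.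
by move=> x Ox; split; exact: sup.
Qed.

(* In the coordinates [(s, u)] along [n1^perp] and [n1], the slice of the triangle
   at height [u] has length [(l1 u + (1 - l1) rho) / m]. *)
Lemma area_triangle Om p (rho l1 l2 l3 : R) n1 n2 n3 : measurable (Om : set (mR * mR)) ->
  n1.1 ^+ 2 + n1.2 ^+ 2 = 1 -> 0 < rho -> 0 < l1 -> 0 <= l2 -> 0 <= l3 -> l1 + l2 + l3 = 1 ->
  l1 * n1.1 + l2 * n2.1 + l3 * n3.1 = 0 -> l1 * n1.2 + l2 * n2.2 + l3 * n3.2 = 0 ->
  let m := l2 * (n1.1 * n2.2 - n1.2 * n2.1) in 0 < m ->
  (forall x, Om x -> [/\ n1.1 * (x.1 - p.1) + n1.2 * (x.2 - p.2) < rho,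
      n2.1 * (x.1 - p.1) + n2.2 * (x.2 - p.2) < rho & n3.1 * (x.1 - p.1) + n3.2 * (x.2 - p.2) < rho]) ->
  (mu2 Om <= (rho ^+ 2 / (2 * l1 * m))%:E)%E.
Proof.
move=> mO u1 r0 l10 l20 l30 lsum h1 h2 m m0 HO.
pose a := l2 * (n1.1 * n2.1 + n1.2 * n2.2).
pose al u := (u * a - l2 * rho) / m.
pose be u := (l3 * rho + u * (l1 + a)) / m.
pose u0 := - (1 - l1) * rho / l1.
have u0r : u0 < rho.
  by rewrite /u0 ltr_pdivrMr// -subr_gt0 (_ : _ - _ = rho) //; ring.
have in_tri s u : Om (rigid n1 p (s, u)) -> (u0 <= u <= rho) /\ (al u <= s <= be u).
  move=> /HO[]; rewrite /rigid /frame /= !addrK => t1 t2 t3.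
  have {}t1 : u < rho.
    move: t1; have -> : n1.1 * (n1.2 * s + n1.1 * u) + n1.2 * (- n1.1 * s + n1.2 * u) =
      u * (n1.1 ^+ 2 + n1.2 ^+ 2) by ring.
    by rewrite u1 mulr1.
  (* Scaled by their weights, the constraints along n2 and n3 bound s from below and from above; n3
     is eliminated by the balance relation. *)
  have {t2} t2 : u * a - s * m <= l2 * rho.
    have := ler_wpM2l l20 (ltW t2); rewrite /a /m; lra.
  have {t3} t3 : s * m - u * (l1 + a) <= l3 * rho.
    have := ler_wpM2l l30 (ltW t3).
    have -> : l3 * (n3.1 * (n1.2 * s + n1.1 * u) + n3.2 * (- n1.1 * s + n1.2 * u)) =
       (l3 * n3.1) * (n1.2 * s + n1.1 * u) + (l3 * n3.2) * (- n1.1 * s + n1.2 * u) by ring.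
    have -> : l3 * n3.1 = - (l1 * n1.1 + l2 * n2.1) by lra.
    have -> : l3 * n3.2 = - (l1 * n1.2 + l2 * n2.2) by lra.
    have -> : - (l1 * n1.1 + l2 * n2.1) * (n1.2 * s + n1.1 * u) + - (l1 * n1.2 + l2 * n2.2) * (- n1.1 * s + n1.2 * u)
      = s * m - u * (l1 * (n1.1 ^+ 2 + n1.2 ^+ 2) + a) by rewrite /m /a; ring.
    by rewrite u1 mulr1.
  have l23 : l2 + l3 = 1 - l1 by lra.
  split; apply/andP; split.
  - rewrite /u0 ler_pdivrMr//.
    have -> : - (1 - l1) * rho = - (l2 * rho + l3 * rho) by rewrite -l23; ring.
    by lra.
  - exact: ltW.
  - by rewrite /al ler_pdivrMr//; lra.
  - by rewrite /be ler_pdivlMr//; lra.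
pose f (x : mR * mR) : \bar R := (\1_Om x)%:E.
have f0 x : (0 <= f x)%E by rewrite lee_fin.
have mf : measurable_fun [set: mR * mR] f by apply/measurable_EFinP; exact: measurable_indic.
have -> : mu2 Om = (\int[mu2]_x f x)%E by rewrite integral_indic// setIT.
have mg := measurable_rigid n1 p mf.
rewrite (ge0_integral_rigid p u1 mf f0) -(tonelli1 mg (fun x => f0 _)) (tonelli2 mg (fun x => f0 _)).
pose L u := be u - al u.
have LE u : L u = (l1 * u + (1 - l1) * rho) / m.
  have -> : 1 - l1 = l2 + l3 by lra.
  by rewrite /L /be /al; field; rewrite gt_eqF.
have L0 u : u0 <= u -> 0 <= L u.
  rewrite LE /u0 ler_pdivrMr// => h; rewrite divr_ge0 ?(ltW m0)//.
  by lra.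
have cL u : {for u, continuous L}.
  rewrite (_ : L = fun u => (l1 * u + (1 - l1) * rho) / m); last by apply/funext.
  by continuity_arith.
apply: (@le_trans _ _ (\int[mu]_(u in `[u0, rho]) (L u)%:E)%E).
  rewrite [leRHS]integral_mkcond; apply: ge0_le_integral => //.
  - by move=> u _; exact: integral_ge0.
  - exact: (measurable_fun_fubini_tonelli_G (m1 := mu) _ mg).
  - apply/(measurable_restrict _ (measurable_itv _) measurableT); rewrite setTI.
    by apply: measurable_funTS; apply/measurable_EFinP; exact: continuous_measurable_fun.
  move=> u _; rewrite patchE; case: ifPn => [|uN].
    rewrite inE/= in_itv/= => /andP[uu0 ur].
    apply: (@le_trans _ _ (\int[mu]_s (\1_(`[al u, be u]%classic) s)%:E)%E).
      apply: ge0_le_integral => //.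
      + exact: (measurable_section1 mg u).
      + by apply/measurable_EFinP; exact: measurable_indic.
      move=> s _; rewrite /f lee_fin !indicE; have [|//] := boolP (rigid n1 p (s, u) \in Om).
      rewrite inE => /in_tri[_ h]; rewrite mem_set//=.
    rewrite integral_indic// setIT.
    apply: (@le_trans _ _ (mu `[al u, be u]%classic)); first by [].
    rewrite lebesgue_measure_itv/= lte_fin.
    by case: ifPn => // _; rewrite lee_fin L0.
  rewrite (eq_integral (cst 0%E)) ?integral0// => s _; rewrite /f indicE.
  have [|//] := boolP (rigid n1 p (s, u) \in Om).
  rewrite inE => /in_tri[h _]; move: uN; rewrite notin_setE /= in_itv/= => /negP.
  by rewrite h.
have dG u : is_derive u (1 : R) (fun u => (l1 * u + (1 - l1) * rho) ^+ 2 * (1 / (2 * l1 * m))) (L u).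
  have h := is_derive_mul (is_derive_sqr (is_derive_add (is_derive_scal l1 (is_derive_id u (1 : R)))
    (is_derive_cst ((1 - l1) * rho) u (1 : R)))) (is_derive_cst (1 / (2 * l1 * m)) u (1 : R)).
  by apply: (is_derive_eq h); rewrite LE /=; field; rewrite !gt_eqF.
rewrite (FTC2_in u0r (fun u _ => dG u) (fun u _ => cL u)) lee_fin.
rewrite le_eqVlt; apply/orP; left; apply/eqP.
by rewrite /u0; field; rewrite !gt_eqF.
Qed.

(** Heron's formula. The vectors l_i n_i sum to zero, so a quarter turn makes them the edges of a
    triangle of perimeter 1 with sides l_i, whose area is half of |l1 l2 (n1 x n2)|. *)
Lemma heron_weights n1 n2 n3 (l1 l2 l3 : R) :
  n1.1 ^+ 2 + n1.2 ^+ 2 = 1 -> n2.1 ^+ 2 + n2.2 ^+ 2 = 1 -> n3.1 ^+ 2 + n3.2 ^+ 2 = 1 ->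
  l1 + l2 + l3 = 1 ->
  l1 * n1.1 + l2 * n2.1 + l3 * n3.1 = 0 -> l1 * n1.2 + l2 * n2.2 + l3 * n3.2 = 0 ->
  (1 - 2 * l1) * (1 - 2 * l2) * (1 - 2 * l3) =
  4 * (l1 * (l2 * (n1.1 * n2.2 - n1.2 * n2.1))) ^+ 2.
Proof.
move=> u1 u2 u3 ls h1 h2.
pose d := n1.1 * n2.1 + n1.2 * n2.2.
have hd : l3 ^+ 2 = l1 ^+ 2 + l2 ^+ 2 + 2 * l1 * l2 * d.
  transitivity ((l3 * n3.1) ^+ 2 + (l3 * n3.2) ^+ 2); first by rewrite !exprMn -mulrDr u3 mulr1.
  have -> : l3 * n3.1 = - (l1 * n1.1 + l2 * n2.1) by lra.
  have -> : l3 * n3.2 = - (l1 * n1.2 + l2 * n2.2) by lra.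
  transitivity (l1 ^+ 2 * (n1.1 ^+ 2 + n1.2 ^+ 2) + l2 ^+ 2 * (n2.1 ^+ 2 + n2.2 ^+ 2) + 2 * l1 * l2 * d).
    by rewrite /d; ring.
  by rewrite u1 u2 !mulr1.
have cr : (n1.1 * n2.2 - n1.2 * n2.1) ^+ 2 = 1 - d ^+ 2.
  transitivity ((n1.1 ^+ 2 + n1.2 ^+ 2) * (n2.1 ^+ 2 + n2.2 ^+ 2) - d ^+ 2); first by rewrite /d; ring.
  by rewrite u1 u2 mulr1.
rewrite !exprMn cr.
have -> : 4 * (l1 ^+ 2 * (l2 ^+ 2 * (1 - d ^+ 2))) = 4 * l1 ^+ 2 * l2 ^+ 2 - (l3 ^+ 2 - l1 ^+ 2 - l2 ^+ 2) ^+ 2.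
  by rewrite hd; ring.
have -> : l3 = 1 - l1 - l2 by lra.
by ring.
Qed.

(** Among three numbers of sum 1 that are at least 0.14, the product is smallest at (0.14, 0.14,
    0.72), where it is 0.01411. *)
Lemma product_ge (y z : R) : 14 / 100 < y -> 14 / 100 < z -> y + z < 86 / 100 ->
  141 / 10000 < y * z * (1 - y - z).
Proof.
move=> y1 y2 y4; have yz : 14 / 100 * (y + z) - 196 / 10000 <= y * z.
  have : 0 <= (y - 14 / 100) * (z - 14 / 100) by apply: mulr_ge0; lra.
  by lra.
have s0 : 0 <= 1 - (y + z) by move: y4; clear; lra.
have := ler_wpM2r s0 yz.
have : 0 <= (y + z - 28 / 100) * (86 / 100 - (y + z)) by apply: mulr_ge0; lra.
by rewrite -[1 - y - z]addrA -opprD; lra.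
Qed.

(** The triangle has width rho / l_i in the direction n_i. If all weights were below 0.43, Heron's
    formula would give (l1 m)^2 > 0.00352, so that the area rho^2 / (2 |l1 m|) of the triangle would
    be below 8.44 rho^2. *)
Lemma supporting_strip Om p (rho l1 l2 l3 : R) n1 n2 n3 : measurable (Om : set (mR * mR)) ->
  0 < rho -> ((858 / 100 * rho ^+ 2)%:E < mu2 Om)%E ->
  n1.1 ^+ 2 + n1.2 ^+ 2 = 1 -> n2.1 ^+ 2 + n2.2 ^+ 2 = 1 -> n3.1 ^+ 2 + n3.2 ^+ 2 = 1 ->
  0 <= l1 -> 0 <= l2 -> 0 <= l3 -> l1 + l2 + l3 = 1 ->
  l1 * n1.1 + l2 * n2.1 + l3 * n3.1 = 0 -> l1 * n1.2 + l2 * n2.2 + l3 * n3.2 = 0 ->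
  (forall x, Om x -> [/\ n1.1 * (x.1 - p.1) + n1.2 * (x.2 - p.2) < rho,
      n2.1 * (x.1 - p.1) + n2.2 * (x.2 - p.2) < rho & n3.1 * (x.1 - p.1) + n3.2 * (x.2 - p.2) < rho]) ->
  exists n l, [/\ n.1 ^+ 2 + n.2 ^+ 2 = 1, 43 / 100 <= l &
    forall x, Om x -> - (1 - l) / l * rho < n.1 * (x.1 - p.1) + n.2 * (x.2 - p.2) < rho].
Proof.
move=> mO r0 Abig u1 u2 u3 l10 l20 l30 ls h1 h2 HO.
have strip m1 m2 m3 a b d : m1.1 ^+ 2 + m1.2 ^+ 2 = 1 -> 43 / 100 <= a -> 0 <= b -> 0 <= d -> a + b + d = 1 ->
    a * m1.1 + b * m2.1 + d * m3.1 = 0 -> a * m1.2 + b * m2.2 + d * m3.2 = 0 ->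
    (forall x, Om x -> [/\ m1.1 * (x.1 - p.1) + m1.2 * (x.2 - p.2) < rho,
      m2.1 * (x.1 - p.1) + m2.2 * (x.2 - p.2) < rho & m3.1 * (x.1 - p.1) + m3.2 * (x.2 - p.2) < rho]) ->
    exists n l, [/\ n.1 ^+ 2 + n.2 ^+ 2 = 1, 43 / 100 <= l &
    forall x, Om x -> - (1 - l) / l * rho < n.1 * (x.1 - p.1) + n.2 * (x.2 - p.2) < rho].
  (* As the weighted normals cancel, the upper bounds along the other two give the lower bound along
     the first. It is strict because the other two weights cannot both be zero. *)
  move=> v1 a1 b0 d0 abd e1 e2 H; exists m1, a; split => // x /H[H1 H2 H3].
  rewrite H1 andbT.
  have a0 : 0 < a by move: a1; clear; lra.
  rewrite -(ltr_pM2l a0) (_ : a * _ = - (1 - a) * rho); last by field; rewrite gt_eqF.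
  have -> : a * (m1.1 * (x.1 - p.1) + m1.2 * (x.2 - p.2)) =
    (a * m1.1) * (x.1 - p.1) + (a * m1.2) * (x.2 - p.2) by ring.
  have -> : a * m1.1 = - (b * m2.1 + d * m3.1) by move: e1; clear; lra.
  have -> : a * m1.2 = - (b * m2.2 + d * m3.2) by move: e2; clear; lra.
  have -> : - (b * m2.1 + d * m3.1) * (x.1 - p.1) + - (b * m2.2 + d * m3.2) * (x.2 - p.2) =
    - (b * (m2.1 * (x.1 - p.1) + m2.2 * (x.2 - p.2)) + d * (m3.1 * (x.1 - p.1) + m3.2 * (x.2 - p.2))) by ring.
  have -> : - (1 - a) * rho = - (b * rho + d * rho) by rewrite -abd; ring.
  rewrite ltrN2; have [b1|b1] := ltP 0 b.
    by apply: ltr_leD; [rewrite ltr_pM2l|rewrite ler_wpM2l// ltW].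
  have b00 : b = 0 by apply/eqP; rewrite eq_le b1 b0.
  have [d1|d1] := ltP 0 d.
    by rewrite b00 !mul0r !add0r ltr_pM2l.
  have d00 : d = 0 by apply/eqP; rewrite eq_le d1 d0.
  have a11 : a = 1 by rewrite -abd b00 d00 !addr0.
  move: e1 e2; rewrite a11 b00 d00 !mul1r !mul0r !addr0 => z1 z2.
  by move: v1; rewrite z1 z2 expr0n/= addr0 => /eqP; rewrite eq_sym oner_eq0.
have [g1|g1] := leP (43 / 100) l1; first exact: (strip n1 n2 n3 l1 l2 l3).
have [g2|g2] := leP (43 / 100) l2.
  apply: (strip n2 n1 n3 l2 l1 l3 u2 g2 l10 l30); last by move=> x /HO[].
  - by rewrite -ls; ring.
  - by rewrite -[RHS]h1; ring.
  - by rewrite -[RHS]h2; ring.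
have [g3|g3] := leP (43 / 100) l3.
  apply: (strip n3 n1 n2 l3 l1 l2 u3 g3 l10 l20); last by move=> x /HO[].
  - by rewrite -ls; ring.
  - by rewrite -[RHS]h1; ring.
  - by rewrite -[RHS]h2; ring.
exfalso.
pose m := l2 * (n1.1 * n2.2 - n1.2 * n2.1).
have l1p : 0 < l1 by lra.
have hw := heron_weights u1 u2 u3 ls h1 h2.
have low : 352 / (100 * 1000) < (l1 * m) ^+ 2.
  have : 141 / 10000 < (1 - 2 * l1) * (1 - 2 * l2) * (1 - 2 * l3).
    have y1 : 14 / 100 < 1 - 2 * l1 by move: g1; clear; lra.
    have y2 : 14 / 100 < 1 - 2 * l2 by move: g2; clear; lra.
    have y3 : 14 / 100 < 1 - 2 * l3 by move: g3; clear; lra.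
    have e3 : 1 - 2 * l3 = 1 - (1 - 2 * l1) - (1 - 2 * l2) by move: ls; clear; lra.
    by rewrite e3; apply: product_ge => //; move: y3; rewrite e3; clear; lra.
  by rewrite hw -/m; clear; lra.
(* The area bound needs a positive determinant: [k] will be m or - m according to the orientation,
   the latter after exchanging the last two normals. *)
have area_le k : 0 < l1 * k -> (l1 * k) ^+ 2 = (l1 * m) ^+ 2 -> (mu2 Om <= (rho ^+ 2 / (2 * l1 * k))%:E)%E -> False.
  move=> k0 kE; apply/negP; rewrite -ltNge; apply: le_lt_trans Abig; rewrite lee_fin.
  have {kE low} : 352 / (100 * 1000) < (l1 * k) ^+ 2 by rewrite kE.
  rewrite -mulrA; move: (l1 * k) k0 => z z0 zz.
  have zb : 593 / (100 * 100) <= z by move: z0 zz; clear; nra.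
  rewrite ler_pdivrMr ?mulr_gt0//; move: (ler_wpM2l (sqr_ge0 rho) zb) (sqr_ge0 rho).
  by clear; lra.
have [m0|m0|m0] := ltgtP m 0; last by move: low; rewrite m0 mulr0 expr0n/=; clear; lra.
- apply: (area_le (- m)); [by rewrite mulrN oppr_gt0 pmulr_rlt0|by rewrite mulrN sqrrN|].
  have mE : l3 * (n1.1 * n3.2 - n1.2 * n3.1) = - m.
    rewrite /m; have -> : l3 * (n1.1 * n3.2 - n1.2 * n3.1) = n1.1 * (l3 * n3.2) - n1.2 * (l3 * n3.1) by ring.
    have -> : l3 * n3.1 = - (l1 * n1.1 + l2 * n2.1) by lra.
    have -> : l3 * n3.2 = - (l1 * n1.2 + l2 * n2.2) by lra.
    by ring.
  rewrite -mE; apply: (@area_triangle Om p rho l1 l3 l2 n1 n3 n2 mO u1 r0 l1p l30 l20).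
  + by rewrite -ls; ring.
  + by rewrite -[RHS]h1; ring.
  + by rewrite -[RHS]h2; ring.
  + by rewrite mE oppr_gt0.
  + by move=> x /HO[].
- apply: (area_le m) => //; first exact: mulr_gt0.
  exact: (@area_triangle Om p rho l1 l2 l3 n1 n2 n3).
Qed.

End Triangle.

(** * Tonelli's theorem on the product of two planes *)

Section PlaneTonelli.
Context {R : realType}.
Notation mR := (measurableTypeR R).
Notation mu := (@lebesgue_measure R).
Notation mu2 := (leb2 R).

Lemma leb2_sigma_finite : sigma_finite [set: mR * mR] (leb2 R).
Proof.
exists (fun n : nat => `[- n%:R, n%:R]%classic `*` `[- n%:R, n%:R]%classic).
  apply/seteqP; split => // p _.
  have := @archi_boundP R (Num.max `|p.1| `|p.2|) ltac:(by rewrite le_max normr_ge0).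
  move: (Num.bound _) => n.
  rewrite gt_max => /andP[h1 h2].
  by exists n => //; split; rewrite /= in_itv/= -ler_norml ltW.
move=> n; split; first by apply: measurableX; exact: measurable_itv.
have nn : - n%:R <= n%:R :> R by rewrite (@le_trans _ _ 0)// oppr_le0.
by have := leb2_box nn nn => /= ->; rewrite ltry.
Qed.

(** A named copy of [leb2 R], to which the sigma-finite structure is attached. *)
Definition lebesgue_plane : set (mR * mR)%type -> \bar R := leb2 R.
HB.instance Definition _ := Measure.copy lebesgue_plane (leb2 R).
HB.instance Definition _ := Measure_isSigmaFinite.Build _ _ _ lebesgue_plane leb2_sigma_finite.

Lemma tonelli_plane (f : (mR * mR) * (mR * mR) -> \bar R) :
  measurable_fun [set: (mR * mR) * (mR * mR)] f -> (forall x, (0 <= f x)%E) ->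
  (\int[mu2]_p \int[mu2]_q f (p, q) = \int[mu2]_q \int[mu2]_p f (p, q))%E.
Proof. by move=> mf f0; exact: (@fubini_tonelli _ _ _ _ R lebesgue_plane lebesgue_plane f mf f0). Qed.

Lemma measurable_integral_plane (f : (mR * mR) * (mR * mR) -> \bar R) :
  measurable_fun [set: (mR * mR) * (mR * mR)] f -> (forall x, (0 <= f x)%E) ->
  measurable_fun [set: mR * mR] (fun p => \int[mu2]_q f (p, q))%E.
Proof. by move=> mf f0; exact: (@measurable_fun_fubini_tonelli_F _ _ _ _ R lebesgue_plane f mf f0). Qed.

End PlaneTonelli.

(** * Truncated powers *)

Section PositivePart.
Context {R : realType}.
Implicit Types (x a b h l : R) (k : nat).

(** The truncated power x_+^k, of class C^(k-1) for k > 0; [pw 0] is the indicator of [0, +oo[. *)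
Definition pw k x := if 0 <= x then x ^+ k else 0.

Lemma pw_ge0 k x : 0 <= pw k x.
Proof. by rewrite /pw; case: ifPn => // x0; rewrite exprn_ge0. Qed.

Lemma pwS k x : pw k.+1 x = x * pw k x.
Proof. by rewrite /pw exprS; case: ifPn; rewrite ?mulr0. Qed.

Lemma pw_le0 k x : x <= 0 -> pw k.+1 x = 0.
Proof.
rewrite /pw => x0; case: ifPn => // x0'; have -> : x = 0 by apply/eqP; rewrite eq_le x0.
by rewrite expr0n.
Qed.

Lemma pw_gt0 k x : 0 < x -> pw k x = x ^+ k.
Proof. by rewrite /pw => /ltW ->. Qed.

Lemma continuous_pw k : continuous (pw k.+1).
Proof.
elim: k => [|k IH] x.
  rewrite (_ : pw 1 = fun x => (x + `|x|) / 2).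
    by continuity_arith.
  apply/funext => y; rewrite /pw expr1; case: ifPn => [y0|]; first by rewrite ger0_norm//; lra.
  by rewrite -ltNge => y0; rewrite ltr0_norm//; lra.
rewrite (_ : pw k.+2 = fun x => x * pw k.+1 x); last by apply/funext => y; rewrite pwS.
by apply: (continuous_mul (f := id)) => //; exact: IH.
Qed.

Lemma is_derive_pw k x : is_derive x (1 : R) (pw k.+2) (k.+2%:R * pw k.+1 x).
Proof.
have [x0|x0|->] := ltgtP x 0.
- rewrite pw_le0 ?ltW// mulr0.
  apply: (near_eq_is_derive _ (is_derive_cst (0 : R) x (1 : R))).
  by near=> y; rewrite pw_le0//; apply: ltW; near: y; exact: lt_nbhsl.
- rewrite pw_gt0//; have h := is_derive_pow k.+2 (is_derive_id x (1 : R)).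
  rewrite mulr1 in h; apply: (near_eq_is_derive _ h).
  by near=> y; rewrite pw_gt0//; near: y; exact: lt_nbhsr.
- rewrite pw_le0// mulr0.
  have key : (fun h : R => h^-1 *: (pw k.+2 (h + 0) - pw k.+2 0)) @ 0^' --> (0 : R).
    have : pw k.+1 h @[h --> 0^'] --> pw k.+1 (0 : R).
      by apply: cvg_trans (@continuous_pw k 0); apply: cvg_app; exact: nbhs_dnbhs.
    rewrite pw_le0//; apply: cvg_trans; apply: near_eq_cvg; near=> h.
    have h0 : h != 0 by near: h; exact: nbhs_dnbhs_neq.
    by rewrite addr0 (pw_le0 k.+1 (lexx 0)) subr0 (pwS k.+1) /GRing.scale/= mulKf.
  have e : (fun h : R => h^-1 *: ((pw k.+2 \o shift 0) (h *: (1 : R)) - pw k.+2 0))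
     = (fun h : R => h^-1 *: (pw k.+2 (h + 0) - pw k.+2 0)).
    by apply/funext => h; rewrite /= /GRing.scale/= mulr1.
  by split; [rewrite /derivable e; exact: (cvgP 0)|rewrite /derive e; exact: cvg_lim].
Unshelve. all: by end_near. Qed.

End PositivePart.

(** * A polynomial mollifier *)

Section Mollifier.
Context {R : realType}.
Notation mR := (measurableTypeR R).
Notation mu := (@lebesgue_measure R).
Notation mu2 := (leb2 R).
Variable d : R.
Hypothesis d0 : 0 < d.
Implicit Types (x a b h l : R).

(* [32/35 d^7] is the integral of [(d^2 - x^2)^3] over [[-d, d]]. *)
Definition mollc := 35 / (32 * d ^+ 7).
(** The cube makes the kernel twice continuously differentiable, as the second-order Taylor estimate
    requires. *)
Definition moll x := mollc * pw 3 (d ^+ 2 - x ^+ 2).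
Definition moll1 x := mollc * (3 * pw 2 (d ^+ 2 - x ^+ 2) * (- 2 * x)).
Definition moll2 x := mollc * (3 * (2 * pw 1 (d ^+ 2 - x ^+ 2) * (- 2 * x) * (- 2 * x)
  + pw 2 (d ^+ 2 - x ^+ 2) * (- 2))).

Lemma mollc_gt0 : 0 < mollc.
Proof. by rewrite divr_gt0// mulr_gt0// exprn_gt0. Qed.

Lemma is_derive_moll_arg k x : is_derive x (1 : R) (fun x => pw k.+2 (d ^+ 2 - x ^+ 2))
  (k.+2%:R * pw k.+1 (d ^+ 2 - x ^+ 2) * (- 2 * x)).
Proof.
have dg : is_derive x (1 : R) (fun x => d ^+ 2 - x ^+ 2) (- 2 * x).
  have h := is_derive_sub (is_derive_cst (d ^+ 2) x (1 : R)) (is_derive_sqr (is_derive_id x (1 : R))).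
  by apply: (is_derive_eq h); ring.
have h := is_derive1_comp (f := pw k.+2) (is_derive_pw k _) dg.
by apply: (is_derive_eq h); rewrite mulrC.
Qed.

Lemma is_derive_moll x : is_derive x (1 : R) moll (moll1 x).
Proof. exact: is_derive_scal (is_derive_moll_arg 1 x). Qed.

Lemma is_derive_moll1 x : is_derive x (1 : R) moll1 (moll2 x).
Proof.
have dl : is_derive x (1 : R) (fun x => - 2 * x) (- 2).
  by have := is_derive_scal (- 2) (is_derive_id x (1 : R)); rewrite mulr1.
have h := is_derive_scal mollc (is_derive_mul (is_derive_scal 3 (is_derive_moll_arg 0 x)) dl).
by apply: (is_derive_eq h); rewrite /moll2; ring.
Qed.

Lemma continuous_moll : continuous moll.
Proof. by move=> x; exact: continuous_is_derive (is_derive_moll x). Qed.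

Lemma continuous_moll1 : continuous moll1.
Proof. by move=> x; exact: continuous_is_derive (is_derive_moll1 x). Qed.

Lemma moll_ge0 x : 0 <= moll x.
Proof. by rewrite mulr_ge0 ?pw_ge0// ltW// mollc_gt0. Qed.

Lemma moll_opp x : moll (- x) = moll x.
Proof. by rewrite /moll sqrrN. Qed.

Lemma moll_arg_le0 x : d <= `|x| -> d ^+ 2 - x ^+ 2 <= 0.
Proof. by move=> dx; rewrite subr_le0 -(real_normK (num_real x)) ler_sqr// nnegrE ltW. Qed.

Lemma moll_supp x : d <= `|x| -> moll x = 0.
Proof. by move=> /moll_arg_le0 h; rewrite /moll pw_le0// mulr0. Qed.

Lemma moll1_supp x : d <= `|x| -> moll1 x = 0.
Proof. by move=> /moll_arg_le0 h; rewrite /moll1 pw_le0// mulr0 mul0r mulr0. Qed.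

Lemma bounded_supp (f : R -> R) : continuous f -> (forall x, d <= `|x| -> f x = 0) ->
  exists2 C, 0 <= C & forall x, `|f x| <= C.
Proof.
move=> cf sf; have dd : - d <= d by rewrite (@le_trans _ _ 0)// ?oppr_le0 ltW.
have cn : {within `[- d, d], continuous (fun x => `|f x|)}.
  by apply: continuous_subspaceT => x; apply: continuous_norm_comp; exact: cf.
have [c _ Hc] := EVT_max dd cn.
exists `|f c| => // x; have [dx|dx] := leP d `|x|; first by rewrite sf// normr0.
by apply: Hc; rewrite in_itv/= -ler_norml ltW.
Qed.

Lemma moll_bound : exists2 C, 0 <= C &
  forall x, [/\ `|moll x| <= C, `|moll1 x| <= C & `|moll2 x| <= C].
Proof.
have [C C0 HC] := bounded_supp continuous_moll moll_supp.
have [C1 C10 HC1] := bounded_supp continuous_moll1 moll1_supp.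
have cm2 : continuous moll2.
  move=> x; rewrite /moll2.
  have c1 : {for x, continuous (fun x => pw 1 (d ^+ 2 - x ^+ 2))}.
    apply: (@continuous_comp _ _ _ (fun x => d ^+ 2 - x ^+ 2) (pw 1)); last exact: continuous_pw.
    by continuity_arith.
  have c2 : {for x, continuous (fun x => pw 2 (d ^+ 2 - x ^+ 2))}.
    apply: (@continuous_comp _ _ _ (fun x => d ^+ 2 - x ^+ 2) (pw 2)); last exact: continuous_pw.
    by continuity_arith.
  have cl : {for x, continuous (fun x => - 2 * x)} by continuity_arith.
  have ck (k : R) : {for x, continuous (fun=> k)} by exact: cvg_cst.
  exact: continuous_scal (continuous_scal 3 (continuous_add (continuous_mul (continuous_mul
    (continuous_scal 2 c1) cl) cl) (continuous_mul c2 (ck _)))).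
have [C2 C20 HC2] := bounded_supp cm2 (fun x dx => ltac:(by rewrite /moll2 !pw_le0 ?moll_arg_le0//; ring)).
exists (C + C1 + C2); first by rewrite !addr_ge0.
by move=> x; have := HC x; have := HC1 x; have := HC2 x; split; lra.
Qed.

Lemma integral_moll a : (\int[mu]_x (moll (a - x))%:E = 1)%E.
Proof.
have mm : measurable_fun [set: mR] (fun x => (moll x)%:E).
  by apply/measurable_EFinP; exact: continuous_measurable_fun continuous_moll.
transitivity (\int[mu]_x (moll (x + (- a)))%:E)%E.
  by apply: eq_integral => x _; rewrite -moll_opp opprB.
rewrite (ge0_integral_translate (- a) mm); last by move=> x; rewrite lee_fin moll_ge0.
have dd : - d < d by rewrite (@lt_trans _ _ 0)// oppr_lt0.
rewrite -(@integral_supp _ _ _ mu `[- d, d]%classic); last first.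
  move=> x xd; rewrite moll_supp// leNgt; apply/negP => h; apply: xd.
  by rewrite /= in_itv/= -ler_norml ltW.
pose g x := mollc * (d ^+ 2 - x ^+ 2) ^+ 3.
transitivity (\int[mu]_(x in `[(- d)%R, d]) (g x)%:E)%E.
  apply: eq_integral => x; rewrite inE/= in_itv/= -ler_norml => xd.
  by rewrite /moll /pw ifT// subr_ge0 -(real_normK (num_real x)) ler_sqr ?nnegrE// ltW.
pose G x := mollc * (d ^+ 6 * x - d ^+ 4 * x ^+ 3 + 3 / 5 * d ^+ 2 * x ^+ 5 - 1 / 7 * x ^+ 7).
have dG x : - d <= x <= d -> is_derive x (1 : R) G (g x).
  move=> _; have dp n := is_derive_pow n (is_derive_id x (1 : R)).
  have h := is_derive_scal mollc (is_derive_sub (is_derive_add (is_derive_sub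
    (is_derive_scal (d ^+ 6) (is_derive_id x (1 : R))) (is_derive_scal (d ^+ 4) (dp 3%N)))
    (is_derive_scal (3 / 5 * d ^+ 2) (dp 5%N))) (is_derive_scal (1 / 7) (dp 7%N))).
  by apply: (is_derive_eq h); rewrite /g/=; field.
have cg x : - d <= x <= d -> {for x, continuous g}.
  move=> _; have c : {for x, continuous (fun x => d ^+ 2 - x ^+ 2)} by continuity_arith.
  have -> : g = fun x => mollc * ((d ^+ 2 - x ^+ 2) ^+ 2 * (d ^+ 2 - x ^+ 2)).
    by apply/funext => y; rewrite /g; ring.
  exact: (continuous_scal mollc (continuous_mul (continuous_sqr c) c)).
rewrite (FTC2_in dd dG cg); congr EFin.
by rewrite /G /mollc; field; rewrite gt_eqF.
Qed.

(** The remainder collects the second-order errors of the two factors and the product of their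
    first-order variations, at most C^2 (h^2 + |h l| + l^2). *)
Lemma moll_taylor C a b h l :
  (forall x, [/\ `|moll x| <= C, `|moll1 x| <= C & `|moll2 x| <= C]) ->
  moll a * moll b + (h * (moll1 a * moll b) + l * (moll a * moll1 b)) - 2 * C ^+ 2 * (h ^+ 2 + l ^+ 2)
  <= moll (a + h) * moll (b + l).
Proof.
move=> HC; have C0 : 0 <= C by have [h0 _ _] := HC 0; exact: le_trans h0.
have T2 u v : `|moll (u + v) - moll u| <= C * `|v|.
  have [z _ ->] := MVT_sym u (u + v) is_derive_moll.
  by rewrite addrC addKr normrM ler_wpM2r//; have [_] := HC z.
have T1 u v : `|moll (u + v) - moll u - v * moll1 u| <= C * v ^+ 2.
  have [z zu ->] := MVT_sym u (u + v) is_derive_moll.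
  rewrite (addrC u v) addrK in zu *.
  have -> : moll1 z * v - v * moll1 u = v * (moll1 z - moll1 u) by ring.
  have [y _ ->] := MVT_sym u z is_derive_moll1.
  have -> : v ^+ 2 = `|v| * `|v| by rewrite -normrM -expr2 ger0_norm ?sqr_ge0.
  rewrite normrM [X in _ * X <= _]normrM; have [_ _ hy] := HC y.
  have := ler_pM (normr_ge0 _) (normr_ge0 _) hy zu.
  by move=> /(ler_wpM2l (normr_ge0 v)); lra.
have [Ca C1a _] := HC a; have [Cb _ _] := HC (b + l).
have B1 := ler_pM (normr_ge0 _) (normr_ge0 _) (T1 a h) Cb.
have hC1 : `|h * moll1 a| <= `|h| * C by rewrite normrM ler_wpM2l.
have B2 := ler_pM (normr_ge0 _) (normr_ge0 _) hC1 (T2 b l).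
have B3 := ler_pM (normr_ge0 _) (normr_ge0 _) Ca (T1 b l).
rewrite -!normrM in B1 B2 B3.
have hl : `|h| * `|l| <= h ^+ 2 + l ^+ 2.
  rewrite -(real_normK (num_real h)) -(real_normK (num_real l)).
  by have := sqr_ge0 (`|h| - `|l|); have := normr_ge0 h; have := normr_ge0 l; nra.
have {}hl := ler_wpM2l (mulr_ge0 C0 C0) hl.
have n1 := ler_norm (- ((moll (a + h) - moll a - h * moll1 a) * moll (b + l))).
have n2 := ler_norm (- (h * moll1 a * (moll (b + l) - moll b))).
have n3 := ler_norm (- (moll a * (moll (b + l) - moll b - l * moll1 b))).
rewrite normrN in n1; rewrite normrN in n2; rewrite normrN in n3.
rewrite -subr_ge0.
have -> : moll (a + h) * moll (b + l) - (moll a * moll b + (h * (moll1 a * moll b) + l * (moll a * moll1 b))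
    - 2 * C ^+ 2 * (h ^+ 2 + l ^+ 2)) =
  (moll (a + h) - moll a - h * moll1 a) * moll (b + l) + h * moll1 a * (moll (b + l) - moll b) +
  moll a * (moll (b + l) - moll b - l * moll1 b) + 2 * C ^+ 2 * (h ^+ 2 + l ^+ 2) by ring.
move: n1 n2 n3 B1 B2 B3 hl.
move: (_ * moll (b + l)) (h * moll1 a * _) (moll a * _) => P Q S.
move: `|P| `|Q| `|S| `|h| `|l| => p q s h' l' *; lra.
Qed.

End Mollifier.

(** * Displacement of a convex set along a vector field *)

Section Perimeter.
Context {R : realType}.
Notation mR := (measurableTypeR R).
Notation mu := (@lebesgue_measure R).
Notation mu2 := (leb2 R).
Implicit Types (p q z y : R * R).

Lemma lipschitz_box (phi : R * R -> R) M s : smooth phi -> (forall t, box_supp M (partials t phi)) ->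
  exists2 L, 0 <= L & forall p z,
    `|partials s phi z - partials s phi p| <= L * (`|z.1 - p.1| + `|z.2 - p.2|).
Proof.
move=> sphi bphi.
have [L0 L00 H0] := bounded_box (smooth_continuous (s := i0 :: s) sphi) (bphi _).
have [L1 L10 H1] := bounded_box (smooth_continuous (s := i1 :: s) sphi) (bphi _).
exists (L0 + L1); first exact: addr_ge0.
move=> p z; set f := partials s phi.
have [x _ E1] := MVT_sym (f := fun x => f (x, z.2)) p.1 z.1
  (fun x => (is_derive_axis0 f (x, z.2) _).1 (smooth_is_derive s i0 (x, z.2) sphi)).
have [y _ E2] := MVT_sym (f := fun v => f (p.1, v)) p.2 z.2
  (fun v => (is_derive_axis1 f (p.1, v) _).1 (smooth_is_derive s i1 (p.1, v) sphi)).
rewrite /= -surjective_pairing in E1; rewrite /= -surjective_pairing in E2.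
have -> : f z - f p = (f z - f (p.1, z.2)) + (f (p.1, z.2) - f p) by ring.
rewrite E1 E2 (le_trans (ler_normD _ _))// [leRHS]mulrDr; apply: lerD; rewrite normrM ler_wpM2r//.
  by rewrite (le_trans (H0 _))// lerDl.
by rewrite (le_trans (H1 _))// lerDr.
Qed.

Lemma le_integral_ge0r d (T : measurableType d) (m : {measure set T -> \bar R})
    (D : set T) (f g : T -> \bar R) : measurable D -> m.-integrable D f -> measurable_fun D g ->
  (forall x, D x -> (0 <= g x)%E) -> (forall x, D x -> (f x <= g x)%E) ->
  (\int[m]_(x in D) f x <= \int[m]_(x in D) g x)%E.
Proof.
move=> mD fi mg g0 fg.
have [goo|gfin] := eqVneq (\int[m]_(x in D) g x)%E +oo%E; first by rewrite goo leey.
apply: le_integral => // [|x]; last by rewrite inE; exact: fg.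
apply/integrableP; split => //.
rewrite (eq_integral g) ?ltey// => x; rewrite inE => xD.
by rewrite gee0_abs// g0.
Qed.

Lemma measurable_indic_EFin d (T : measurableType d) (A : set T) : measurable A ->
  measurable_fun setT (fun x => (\1_A x : R)%:E).
Proof. by move=> mA; apply/measurable_EFinP; exact: measurable_indic. Qed.

Variables (Om : set (R * R)) (p0 : R * R) (rho : R).
Hypotheses (mOm : measurable (Om : set (mR * mR))) (finOm : (mu2 Om < +oo)%E)
  (cOm : convex_plane Om) (r0 : 0 < rho) (Hd : forall q, dist2 q p0 <= rho ^+ 2 -> Om q).
Variable X : 'I_2 -> R * R -> R.
Hypotheses (cX : forall i, continuous (X i)) (X1 : forall p, X i0 p ^+ 2 + X i1 p ^+ 2 <= 1).
Variable e : R.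
Hypothesis e0 : 0 < e.

Let k := 1 + e / rho.

Let k0 : 0 < k.
Proof. by rewrite ltr_wpDr// divr_ge0 ?ltW. Qed.

(** The homothety of center [p0] and ratio 1 / k applied to z + y. *)
Let dilated y z : R * R := (k^-1 * (z.1 + (y.1 - p0.1)) + p0.1, k^-1 * (z.2 + (y.2 - p0.2)) + p0.2).

(* [z + y] lies within [e] of [Om], hence in the dilation of [Om] by [k] about [p0]. *)
Let sub_dilated y z : Om (y.1 + (z.1 - e * X i0 z), y.2 + (z.2 - e * X i1 z)) -> Om (dilated y z).
Proof.
(* The barycenter of y + z - e X(z) and v with weights 1 / k and 1 - 1 / k is [dilated y z]: the
   contributions of - e X and rho X cancel. *)
move=> Ow; pose v := (p0.1 + rho * X i0 z, p0.2 + rho * X i1 z).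
have Ov : Om v.
  apply: Hd; rewrite (_ : dist2 v p0 = rho ^+ 2 * (X i0 z ^+ 2 + X i1 z ^+ 2)).
    by rewrite ler_piMr// sqr_ge0.
  by rewrite /dist2 /v /=; ring.
have kn0 : k != 0 by rewrite gt_eqF.
have rn0 : rho != 0 by rewrite gt_eqF.
have kE : 1 + e / rho != 0 := kn0.
have kE2 : rho + e != 0 by rewrite gt_eqF// addr_gt0.
have := cOm (t := k^-1) Ow Ov.
rewrite (_ : (_, _) = dilated y z); last first.
  by rewrite /dilated /v /k /=; congr (_, _); field; rewrite kE2 rn0.
apply; rewrite invr_ge0 ltW//= invf_le1// lerDl divr_ge0// ltW//.
Qed.

Let measurable_dilated y :
  measurable_fun [set: mR * mR] (fun z : mR * mR => (\1_Om (dilated y z) : R)%:E).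
Proof.
apply: (measurable_comp2 (measurable_indic_EFin mOm)).
  rewrite (_ : (fun _ => _) = fun z : R * R => k^-1 * z.1 + 0 * z.2 + (k^-1 * (y.1 - p0.1) + p0.1)).
    exact: measurable_lin.
  by apply/funext => z; ring.
rewrite (_ : (fun _ => _) = fun z : R * R => 0 * z.1 + k^-1 * z.2 + (k^-1 * (y.2 - p0.2) + p0.2)).
  exact: measurable_lin.
by apply/funext => z; ring.
Qed.

Let integral_dilated y : (\int[mu2]_z (\1_Om (dilated y z))%:E = (k ^+ 2)%:E * mu2 Om)%E.
Proof.
have mi := measurable_indic_EFin mOm; have md := measurable_dilated y.
have pos (z : mR * mR) : (0 <= (\1_Om (dilated y z) : R)%:E)%E by rewrite lee_fin.
rewrite -(ge0_integral_dilate k0 md pos); congr (_ * _)%E.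
have -> : (mu2 Om = \int[mu2]_z (\1_Om z)%:E)%E by rewrite integral_indic// setIT.
rewrite -(ge0_integral_translate2 (k^-1 * (y.1 - p0.1) + p0.1) (k^-1 * (y.2 - p0.2) + p0.2) mi);
  last by move=> z; rewrite lee_fin.
have kn0 : k != 0 by rewrite gt_eqF.
apply: eq_integral => z _; congr ((\1_Om _)%:E).
by rewrite /dilated /=; congr (_, _); field.
Qed.

Variable d : R.
Hypothesis d0 : 0 < d.

(** The density of the image of Lebesgue measure under z |-> z - e X(z), mollified at scale [d].
    Mollifying replaces a nonlinear change of variables in the plane. *)
Definition smear p := (\int[mu2]_z (moll d (p.1 - z.1 + e * X i0 z) * moll d (p.2 - z.2 + e * X i1 z))%:E)%E.

Lemma measurable_smear_kernel : measurable_fun [set: (mR * mR) * (mR * mR)]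
  (fun x : (mR * mR) * (mR * mR) => ((moll d (x.1.1 - x.2.1 + e * X i0 x.2) *
     moll d (x.1.2 - x.2.2 + e * X i1 x.2))%:E : \bar R)).
Proof.
have mm : measurable_fun [set: mR] (moll d) by exact: continuous_measurable_fun (@continuous_moll _ d).
have mX i : measurable_fun [set: mR * mR] (X i) by exact: continuous_measurable2.
have mXs i : measurable_fun [set: (mR * mR) * (mR * mR)] (fun x => e * X i x.2).
  by apply: measurable_funM => //; exact: (measurableT_comp (mX i)).
have m11 : measurable_fun [set: (mR * mR) * (mR * mR)] (fun x : (mR * mR) * (mR * mR) => x.1.1 : mR).
  exact: (measurableT_comp measurable_fst measurable_fst).
have m12 : measurable_fun [set: (mR * mR) * (mR * mR)] (fun x : (mR * mR) * (mR * mR) => x.1.2 : mR).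
  exact: (measurableT_comp measurable_snd measurable_fst).
have m21 : measurable_fun [set: (mR * mR) * (mR * mR)] (fun x : (mR * mR) * (mR * mR) => x.2.1 : mR).
  exact: (measurableT_comp measurable_fst measurable_snd).
have m22 : measurable_fun [set: (mR * mR) * (mR * mR)] (fun x : (mR * mR) * (mR * mR) => x.2.2 : mR).
  exact: (measurableT_comp measurable_snd measurable_snd).
apply/measurable_EFinP; apply: measurable_funM.
  apply: (measurableT_comp mm); apply: measurable_funD => //; exact: measurable_funB.
apply: (measurableT_comp mm); apply: measurable_funD => //; exact: measurable_funB.
Qed.

Lemma measurable_smear : measurable_fun [set: mR * mR] smear.
Proof.
apply: (measurable_integral_plane measurable_smear_kernel).
by move=> x; rewrite lee_fin mulr_ge0// moll_ge0.
Qed.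

Lemma integral_moll2 p : (\int[mu2]_z (moll d (p.1 - z.1) * moll d (p.2 - z.2))%:E = 1)%E.
Proof.
have mm : measurable_fun [set: mR] (moll d) by exact: continuous_measurable_fun (@continuous_moll _ d).
have ms a : measurable_fun [set: mR] (fun x => (moll d (a - x))%:E).
  by apply/measurable_EFinP; apply: (measurableT_comp mm); exact: measurable_funB.
have m2 : measurable_fun [set: mR * mR] (fun z : mR * mR => (moll d (p.1 - z.1) * moll d (p.2 - z.2))%:E).
  apply/measurable_EFinP; apply: measurable_funM; apply: (measurableT_comp mm); exact: measurable_funB.
rewrite tonelli1//=; last by move=> z; rewrite lee_fin mulr_ge0// moll_ge0.
transitivity (\int[mu]_x (moll d (p.1 - x))%:E)%E; last exact: integral_moll.
apply: eq_integral => x _; under eq_integral do rewrite EFinM.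
rewrite ge0_integralZl//; first by rewrite integral_moll// mule1.
- by move=> y _; rewrite lee_fin moll_ge0.
- by rewrite lee_fin moll_ge0.
Qed.

(** For a fixed shift y, the points z with y + z - e X(z) in [Om] lie in a translate of the
    homothetic image of [Om], of measure k^2 |Om|. Averaging over y costs nothing, as the kernel has
    mass 1. *)
Lemma integral_smear_le : (\int[mu2]_(p in Om) smear p <= (k ^+ 2)%:E * mu2 Om)%E.
Proof.
have mi := measurable_indic_EFin mOm.
pose M y := moll d y.1 * moll d y.2.
have M0 y : 0 <= M y by rewrite mulr_ge0// moll_ge0.
pose S z : R * R := (z.1 - e * X i0 z, z.2 - e * X i1 z).
pose F (x : (mR * mR) * (mR * mR)) : \bar R :=
  ((\1_Om x.1)%:E * (moll d (x.1.1 - x.2.1 + e * X i0 x.2) * moll d (x.1.2 - x.2.2 + e * X i1 x.2))%:E)%E.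
have mF : measurable_fun [set: (mR * mR) * (mR * mR)] F.
  apply: emeasurable_funM; last exact: measurable_smear_kernel.
  by apply: (measurableT_comp mi); exact: measurable_fst.
have F0 x : (0 <= F x)%E by rewrite /F -EFinM lee_fin mulr_ge0// mulr_ge0// moll_ge0.
have mM : measurable_fun [set: mR * mR] (fun y => (M y)%:E).
  have mm : measurable_fun [set: mR] (moll d) by exact: continuous_measurable_fun (@continuous_moll _ d).
  apply/measurable_EFinP; apply: measurable_funM; exact: (measurableT_comp mm).
pose H (x : (mR * mR) * (mR * mR)) : \bar R :=
  ((M x.2)%:E * (\1_Om (x.2.1 + (S x.1).1, x.2.2 + (S x.1).2))%:E)%E.
have mH : measurable_fun [set: (mR * mR) * (mR * mR)] H.
  apply: emeasurable_funM; first by apply: (measurableT_comp mM); exact: measurable_snd.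
  have mX i : measurable_fun [set: mR * mR] (X i) by exact: continuous_measurable2.
  have mXs i : measurable_fun [set: (mR * mR) * (mR * mR)] (fun x => e * X i x.1).
    by apply: measurable_funM => //; exact: (measurableT_comp (mX i)).
  apply: (measurableT_comp mi); apply: measurable_fun_pair => /=.
    apply: measurable_funD; first exact: (measurableT_comp measurable_fst measurable_snd).
    by apply: measurable_funB => //; exact: (measurableT_comp measurable_fst measurable_fst).
  apply: measurable_funD; first exact: (measurableT_comp measurable_snd measurable_snd).
  by apply: measurable_funB => //; exact: (measurableT_comp measurable_snd measurable_fst).
have H0 x : (0 <= H x)%E by rewrite /H -EFinM lee_fin mulr_ge0.
have -> : (\int[mu2]_(p in Om) smear p = \int[mu2]_p \int[mu2]_z F (p, z))%E.
  rewrite integral_mkcond; apply: eq_integral => p _; rewrite patchE /F /=.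
  case: ifPn => pO; last first.
    rewrite (eq_integral (cst 0%E)) ?integral0// => z _.
    by rewrite indicE (negbTE pO) mul0e.
  by apply: eq_integral => z _; rewrite indicE pO mul1e.
rewrite (tonelli_plane mF F0).
(* For fixed z, the translation p = y + z - e X(z) frees the kernel from X. *)
have -> : (\int[mu2]_z \int[mu2]_p F (p, z) = \int[mu2]_z \int[mu2]_y H (z, y))%E.
  apply: eq_integral => z _.
  rewrite -(ge0_integral_translate2 (S z).1 (S z).2); last 2 first.
  - by apply: (measurableT_comp mF); exact: measurable_fun_pair.
  - by move=> p; exact: F0.
  apply: eq_integral => y _; rewrite /F /H /M /= muleC; congr (_%:E * _)%E.
  by congr (moll d _ * moll d _); rewrite /S /=; ring.
rewrite (tonelli_plane mH H0).
apply: (@le_trans _ _ (\int[mu2]_y ((M y)%:E * ((k ^+ 2)%:E * mu2 Om)))%E).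
  apply: ge0_le_integral => //.
  - by move=> y _; exact: integral_ge0.
  - apply: (measurable_integral_plane (f := fun x => H (x.2, x.1))) => //.
    by apply: (measurableT_comp mH); apply: measurable_fun_pair; [exact: measurable_snd|exact: measurable_fst].
  - by apply: emeasurable_funM.
  move=> y _; rewrite -(integral_dilated y) -ge0_integralZl//; try exact: measurable_dilated; last by rewrite lee_fin.
  apply: ge0_le_integral => //.
  - by apply: (measurableT_comp mH); exact: measurable_fun_pair.
  - by apply: emeasurable_funM => //; exact: measurable_dilated.
  move=> z _; rewrite /H /=; apply: lee_wpmul2l; first by rewrite lee_fin.
  rewrite lee_fin !indicE; have [h|//] := boolP ((y.1 + (S z).1, y.2 + (S z).2) \in Om).
  by rewrite inE in h; rewrite mem_set//; exact: sub_dilated.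
under eq_integral do rewrite muleC.
rewrite ge0_integralZl//; last 2 first.
- by move=> y _; rewrite lee_fin.
- by rewrite mule_ge0// lee_fin sqr_ge0.
have -> : (\int[mu2]_y (M y)%:E = 1)%E; last by rewrite mule1.
rewrite -(integral_moll2 (0, 0)); apply: eq_integral => y _.
by rewrite /M /= !sub0r !moll_opp.
Qed.

(** To first order in e the displaced density is 1 + e div X. The kernel is expanded and an
    integration by parts moves its derivatives to X; eta bounds the drop of div X over the support
    of the kernel, and the Taylor remainder 2 C^2 e^2 is integrated over a box of area 4 d^2. *)
Lemma smear_ge (C eta : R) (X0d X1d : R * R -> R) p :
  (forall x, [/\ `|moll d x| <= C, `|moll1 d x| <= C & `|moll2 d x| <= C]) ->
  continuous X0d -> continuous X1d ->
  (forall z, is_derive z (axis R i0) (X i0) (X0d z)) ->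
  (forall z, is_derive z (axis R i1) (X i1) (X1d z)) ->
  (forall z, `|z.1 - p.1| < d -> `|z.2 - p.2| < d -> X0d p + X1d p - eta <= X0d z + X1d z) ->
  ((1 + e * (X0d p + X1d p - eta) - 8 * C ^+ 2 * d ^+ 2 * e ^+ 2)%:E <= smear p)%E.
Proof.
move=> HC cX0d cX1d dX0 dX1 near_p; have dpos := d0.
pose D := X0d p + X1d p - eta.
pose K := 2 * C ^+ 2 * e ^+ 2.
have K0 : 0 <= K by rewrite /K mulr_ge0 ?sqr_ge0// mulr_ge0// sqr_ge0.
pose B : set (mR * mR) := `[p.1 - d, p.1 + d]%classic `*` `[p.2 - d, p.2 + d]%classic.
have mB : measurable B by apply: measurableX; exact: measurable_itv.
have inB z : `|z.1 - p.1| < d -> `|z.2 - p.2| < d -> B z.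
  by rewrite !ltr_norml => /andP[? ?] /andP[? ?]; split; rewrite /= in_itv/=; apply/andP; split; lra.
have B4 : mu2 B = (4 * d ^+ 2)%:E.
  have h1 : p.1 - d <= p.1 + d by lra.
  have h2 : p.2 - d <= p.2 + d by lra.
  by have := leb2_box h1 h2 => ->; congr EFin; ring.
pose a (z : R * R) := p.1 - z.1; pose b (z : R * R) := p.2 - z.2.
have ca z : {for z, continuous a} by rewrite /a; continuity_arith.
have cb z : {for z, continuous b} by rewrite /b; continuity_arith.
have cm z : {for z, continuous (fun z => moll d (a z))}.
  by apply: (@continuous_comp _ _ _ a (moll d)) => //; exact: continuous_moll.
have cm' z : {for z, continuous (fun z => moll d (b z))}.
  by apply: (@continuous_comp _ _ _ b (moll d)) => //; exact: continuous_moll.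
have cn z : {for z, continuous (fun z => moll1 d (a z))}.
  by apply: (@continuous_comp _ _ _ a (moll1 d)) => //; exact: continuous_moll1.
have cn' z : {for z, continuous (fun z => moll1 d (b z))}.
  by apply: (@continuous_comp _ _ _ b (moll1 d)) => //; exact: continuous_moll1.
pose M z := moll d (a z) * moll d (b z).
pose M1 z := - moll1 d (a z) * moll d (b z).
pose M2 z := moll d (a z) * - moll1 d (b z).
have cM : continuous M by move=> z; exact: (continuous_mul (cm z) (cm' z)).
have cM1 : continuous M1 by move=> z; exact: (continuous_mul (continuous_opp (cn z)) (cm' z)).
have cM2 : continuous M2 by move=> z; exact: (continuous_mul (cm z) (continuous_opp (cn' z))).
have M0 z : 0 <= M z by rewrite mulr_ge0// moll_ge0.
pose W := `|p.1| + `|p.2| + d.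
have far z : ~~ ((`|z.1| < W) && (`|z.2| < W)) -> d <= `|a z| \/ d <= `|b z|.
  rewrite negb_and -!leNgt /W => /orP[h|h]; [left|right].
    have := ler_normB p.1 (p.1 - z.1); rewrite subKr /a; have := normr_ge0 p.2; lra.
  have := ler_normB p.2 (p.2 - z.2); rewrite subKr /b; have := normr_ge0 p.1; lra.
have sM : box_supp W M.
  by move=> z /far[] h; rewrite /M (moll_supp d0 h) ?mul0r ?mulr0.
have sM1 : box_supp W M1.
  by move=> z /far[] h; rewrite /M1 ?(moll1_supp d0 h) ?(moll_supp d0 h) ?oppr0 ?mul0r ?mulr0.
have sM2 : box_supp W M2.
  by move=> z /far[] h; rewrite /M2 ?(moll1_supp d0 h) ?(moll_supp d0 h) ?oppr0 ?mul0r ?mulr0.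
have dM1 z : is_derive z (axis R i0) M (M1 z).
  apply/is_derive_axis0.
  have da : is_derive z.1 (1 : R) (fun x => p.1 - x) (- 1).
    have h := is_derive_sub (is_derive_cst p.1 z.1 (1 : R)) (is_derive_id z.1 (1 : R)).
    by rewrite sub0r in h.
  have h := is_derive_mul (is_derive1_comp (f := moll d) (is_derive_moll d _) da)
     (is_derive_cst (moll d (b z)) z.1 (1 : R)).
  by apply: (is_derive_eq h); rewrite /M1 /a /=; ring.
have dM2 z : is_derive z (axis R i1) M (M2 z).
  apply/is_derive_axis1.
  have db : is_derive z.2 (1 : R) (fun x => p.2 - x) (- 1).
    have h := is_derive_sub (is_derive_cst p.2 z.2 (1 : R)) (is_derive_id z.2 (1 : R)).
    by rewrite sub0r in h.
  have h := is_derive_mul (is_derive_cst (moll d (a z)) z.2 (1 : R))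
     (is_derive1_comp (f := moll d) (is_derive_moll d _) db).
  by apply: (is_derive_eq h); rewrite /M2 /b /=; ring.
have P1 := Rintegral_by_parts cM (@cX i0) cM1 cX0d sM sM1 dM1 dX0.
have P2 := Rintegral_by_parts cM (@cX i1) cM2 cX1d sM sM2 dM2 dX1.
have iM := integrable_box cM sM.
have iM1 := integrable_box (continuous_mul_plane cM1 (@cX i0)) (box_supp_mulr (X i0) sM1).
have iM2 := integrable_box (continuous_mul_plane cM2 (@cX i1)) (box_supp_mulr (X i1) sM2).
have iN1 := integrable_box (continuous_mul_plane cM cX0d) (box_supp_mulr X0d sM).
have iN2 := integrable_box (continuous_mul_plane cM cX1d) (box_supp_mulr X1d sM).
have intM : \int[mu2]_z M z = 1.
  have E : (\int[mu2]_z (M z)%:E = 1)%E := integral_moll2 p.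
  by rewrite /Rintegral E.
pose u z := M z - e * (M1 z * X i0 z + M2 z * X i1 z).
have iu : mu2.-integrable setT (EFin \o u).
  apply: (@integrable_box _ W).
    by move=> z; exact: (continuous_sub (cM z) (continuous_scal e (continuous_add
      (continuous_mul (cM1 z) (@cX i0 z)) (continuous_mul (cM2 z) (@cX i1 z))))).
  by move=> z zW; rewrite /u sM// sM1// sM2// !mul0r addr0 mulr0 subr0.
have intu : 1 + e * D <= \int[mu2]_z u z.
  pose w z := M z * X0d z + M z * X1d z.
  have iw : mu2.-integrable setT (EFin \o w) by have := integrableD measurableT iN1 iN2.
  have iv : mu2.-integrable setT (EFin \o (fun z => M1 z * X i0 z + M2 z * X i1 z)).
    by have := integrableD measurableT iM1 iM2.
  have -> : \int[mu2]_z u z = 1 + e * \int[mu2]_z w z.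
    rewrite /u RintegralB//; last by have := integrableZl measurableT e iv.
    rewrite intM RintegralZl// RintegralD// P1 P2 /w RintegralD//.
    by ring.
  rewrite lerD2l ler_pM2l// -[D]mulr1 -intM -RintegralZl//.
  apply: le_Rintegral => //; first by have := integrableZl measurableT D iM.
  move=> z _; rewrite /w.
  have [/orP h|] := boolP ((d <= `|a z|) || (d <= `|b z|)).
    have -> : M z = 0 by case: h => h; rewrite /M (moll_supp d0 h) ?mul0r ?mulr0.
    by rewrite !mul0r mulr0 addr0.
  rewrite negb_or -!ltNge /a /b (distrC p.1) (distrC p.2) => /andP[h1 h2].
  by rewrite -mulrDr mulrC ler_wpM2l// near_p.
pose iB z := K * \1_B z : R.
have i1B : mu2.-integrable setT (EFin \o (\1_B : _ -> R)).
  rewrite (_ : EFin \o _ = (EFin \o cst 1) \_ B); last first.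
    by apply/funext => z; rewrite patchE /= indicE; case: ifPn => // /negbTE ->.
  apply/(integrable_mkcond _ mB); apply: measurable_bounded_integrable => //.
    by rewrite B4 ltry.
  exists 1; split; first exact: num_real.
  by move=> t t1 z _; rewrite /= normr1; exact: ltW.
have iiB : mu2.-integrable setT (EFin \o iB) by have := integrableZl measurableT K i1B.
have intB : \int[mu2]_z iB z = K * (4 * d ^+ 2).
  rewrite /iB RintegralZl//; congr (_ * _).
  by rewrite /Rintegral integral_indic// setIT B4.
have iuB : mu2.-integrable setT (EFin \o (fun z => u z - iB z)).
  by have := integrableB measurableT iu iiB.
apply: (@le_trans _ _ (\int[mu2]_z (u z - iB z)%:E)%E).
  have := integrable_fin_num measurableT iuB => /fineK <-; rewrite lee_fin.
  change (1 + e * D - 8 * C ^+ 2 * d ^+ 2 * e ^+ 2 <= \int[mu2]_z (u z - iB z)).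
  by rewrite RintegralB// intB /K; move: intu; lra.
rewrite /smear; set S := (X in (_ <= \int[_]_z X z)%E).
have mS : measurable_fun [set: mR * mR] S.
  pose F (x : (mR * mR) * (mR * mR)) : \bar R := (moll d (x.1.1 - x.2.1 + e * X i0 x.2) *
     moll d (x.1.2 - x.2.2 + e * X i1 x.2))%:E.
  have mF : measurable_fun [set: (mR * mR) * (mR * mR)] F by exact: measurable_smear_kernel.
  by apply: (measurableT_comp mF (g := fun z => (p, z))); exact: measurable_fun_pair.
apply: (le_integral_ge0r measurableT iuB mS) => [z _|].
  by rewrite /S lee_fin mulr_ge0// moll_ge0.
move=> z _; rewrite /S lee_fin -/(a z) -/(b z) /u /iB.
have [h|h] := boolP ((d <= `|a z|) || (d <= `|b z|)).
  have -> : M z = 0 by case/orP: h => h; rewrite /M (moll_supp d0 h) ?mul0r ?mulr0.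
  have -> : M1 z = 0.
    by case/orP: h => h; rewrite /M1 ?(moll1_supp d0 h) ?(moll_supp d0 h) ?oppr0 ?mul0r ?mulr0.
  have -> : M2 z = 0.
    by case/orP: h => h; rewrite /M2 ?(moll1_supp d0 h) ?(moll_supp d0 h) ?oppr0 ?mul0r ?mulr0.
  rewrite !mul0r addr0 mulr0 subrr sub0r (@le_trans _ _ 0)//; last by rewrite mulr_ge0// moll_ge0.
  by rewrite oppr_le0 mulr_ge0.
have Bz : B z.
  by move: h; rewrite negb_or -!ltNge /a /b (distrC p.1) (distrC p.2) => /andP[h1 h2]; exact: inB.
rewrite indicE mem_set// mulr1.
apply: le_trans (moll_taylor (a z) (b z) (e * X i0 z) (e * X i1 z) HC).
rewrite /M /M1 /M2.
have h2 : e ^+ 2 * (X i0 z ^+ 2 + X i1 z ^+ 2) <= e ^+ 2 by rewrite ler_piMr ?sqr_ge0.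
have := ler_wpM2l (mulr_ge0 (ler0n R 2) (sqr_ge0 C)) h2.
by rewrite /K; lra.
Qed.

End Perimeter.

(** * The inequality between perimeter, inradius and area *)

Section PerimeterBound.
Context {R : realType}.
Notation mR := (measurableTypeR R).
Notation mu2 := (leb2 R).

Lemma big_ord2 (F : 'I_2 -> R) : \sum_(i < 2) F i = F i0 + F i1.
Proof. by rewrite !big_ord_recl big_ord0 addr0; congr (_ + F _); exact: val_inj. Qed.

(** The lower and upper estimates of the integral of [smear] over [Om] are compared; the terms of
    order 0 in e cancel, and dividing by e leaves the claim up to [t]. *)
Lemma integral_div_le (Om : set (R * R)) (p0 : R * R) (rho : R) (X : 'I_2 -> R * R -> R) :
  measurable (Om : set (mR * mR)) -> (mu2 Om < +oo)%E -> convex_plane Om -> 0 < rho ->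
  (forall q, dist2 q p0 <= rho ^+ 2 -> Om q) ->
  (forall i, test_function setT (X i)) -> (forall p, \sum_(i < 2) X i p ^+ 2 <= 1) ->
  (\int[mu2]_(p in Om) (\sum_(i < 2) partial i (X i) p)%:E <= (2 * area Om / rho)%:E)%E.
Proof.
move=> mOm finOm cOm r0 Hd tX X1.
have sX i : smooth (X i) by case: (tX i).
have cX i : continuous (X i) by exact: (smooth_continuous (s := [::]) (sX i)).
have X1' p : X i0 p ^+ 2 + X i1 p ^+ 2 <= 1 by have := X1 p; rewrite big_ord2.
pose D0 := partials [:: i0] (X i0); pose D1 := partials [:: i1] (X i1).
pose D p := D0 p + D1 p.
have cD0 : continuous D0 by exact: smooth_continuous.
have cD1 : continuous D1 by exact: smooth_continuous.
have cD : continuous D by move=> p; exact: (continuous_add (cD0 p) (cD1 p)).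
have [M0 bM0] := test_function_box (tX i0); have [M1 bM1] := test_function_box (tX i1).
have [L0 L00 HL0] := lipschitz_box [:: i0] (sX i0) bM0.
have [L1 L10 HL1] := lipschitz_box [:: i1] (sX i1) bM1.
pose L := L0 + L1.
have HL p z : D p - D z <= L * (`|z.1 - p.1| + `|z.2 - p.2|).
  have := HL0 p z; have := HL1 p z; rewrite !ler_norml -/D0 -/D1 => /andP[h1 _] /andP[h2 _].
  by rewrite /L /D mulrDl; move: h1 h2; lra.
have iD : mu2.-integrable setT (EFin \o D).
  have := integrableD measurableT (integrable_box cD0 (bM0 [:: i0])) (integrable_box cD1 (bM1 [:: i1])).
  exact.
have iDO : mu2.-integrable Om (EFin \o D) by exact: integrableS iD.
have icO (c : R) : mu2.-integrable Om (EFin \o (fun=> c)).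
  apply: measurable_bounded_integrable => //; exists `|c|; split; first exact: num_real.
  by move=> t ct p _; rewrite /= ltW.
pose a := area Om.
have aE : mu2 Om = a%:E by rewrite /a /area fineK// ge0_fin_numE.
have a0 : 0 <= a by rewrite /a /area fine_ge0.
have -> : (\int[mu2]_(p in Om) (\sum_(i < 2) partial i (X i) p)%:E = \int[mu2]_(p in Om) (D p)%:E)%E.
  by apply: eq_integral => p _; rewrite big_ord2.
have := integrable_fin_num mOm iDO => /fineK <-; rewrite lee_fin -/(Rintegral _ _ _) -/a.
set I := (X in X <= _).
apply/ler_addgt0Pr => t t0.
(* The order of the choices matters: eta from t, then d so that div X varies by at most eta over the
   kernel, then C, which depends on d, and finally e. *)
pose eta := t / (2 * (a + 1)).
have a1 : 0 < a + 1 by lra.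
have eta0 : 0 < eta by rewrite divr_gt0// mulr_gt0.
have etaa : eta * a <= t / 2.
  have : eta * (a + 1) = t / 2 by rewrite /eta; field; rewrite gt_eqF.
  by move: eta0; lra.
have L_0 : 0 <= L by rewrite addr_ge0.
have L1p : 0 < 2 * L + 1 by lra.
pose d := eta / (2 * L + 1).
have d0 : 0 < d by rewrite divr_gt0.
have dL : L * (2 * d) <= eta.
  have : d * (2 * L + 1) = eta by rewrite /d divfK// gt_eqF.
  by move: d0; clear; lra.
have [C C0 HC] := moll_bound d0.
pose Q := 8 * C ^+ 2 * d ^+ 2.
have Q0 : 0 <= Q by rewrite /Q mulr_ge0 ?sqr_ge0// mulr_ge0 ?sqr_ge0.
pose W := a / rho ^+ 2 + Q * a.
have W0 : 0 <= W by apply: addr_ge0; [rewrite divr_ge0// sqr_ge0|exact: mulr_ge0].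
have W1 : 0 < 2 * (W + 1) by move: W0; clear; lra.
pose e := t / (2 * (W + 1)).
have e0 : 0 < e by rewrite divr_gt0.
have eW : e * W <= t / 2.
  have : e * (2 * (W + 1)) = t by rewrite /e divfK// gt_eqF.
  by move: e0; clear; lra.
pose c := 1 - e * eta - Q * e ^+ 2.
have low : (\int[mu2]_(p in Om) (c + e * D p)%:E <= \int[mu2]_(p in Om) smear X e d p)%E.
  apply: le_integral_ge0r => //.
  - have := integrableD mOm (icO c) (integrableZl mOm e iDO); exact.
  - by apply: measurable_funTS; exact: measurable_smear.
  - move=> p _; apply: integral_ge0 => z _; rewrite lee_fin mulr_ge0// moll_ge0//.
  - move=> p _; have := @smear_ge R X cX X1' e e0 d d0 C eta D0 D1 p HC cD0 cD1
      (fun z => smooth_is_derive [::] i0 z (sX i0)) (fun z => smooth_is_derive [::] i1 z (sX i1)).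
    move=> H; apply: le_trans (H _); first by rewrite lee_fin /c /Q /D; clear; lra.
    move=> z h1 h2; have := HL p z; rewrite /D.
    have : L * (`|z.1 - p.1| + `|z.2 - p.2|) <= L * (2 * d).
      by rewrite ler_wpM2l//; move: h1 h2; clear; lra.
    by move: dL; clear; lra.
have upp := le_trans low (integral_smear_le mOm cOm r0 Hd cX X1' e0 d0).
have E : (\int[mu2]_(p in Om) (c + e * D p)%:E = (c * a + e * I)%:E)%E.
  have iv : mu2.-integrable Om (EFin \o (fun p => c + e * D p)).
    by have := integrableD mOm (icO c) (integrableZl mOm e iDO).
  have := integrable_fin_num mOm iv => /fineK <-; congr EFin.
  change (\int[mu2]_(p in Om) (c + e * D p) = c * a + e * I).
  have ieD : mu2.-integrable Om (EFin \o (fun p => e * D p)) by have := integrableZl mOm e iDO.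
  rewrite (RintegralD mOm (icO c) ieD) (RintegralZl e mOm iDO).
  by rewrite (Rintegral_cst _ mOm).
rewrite E aE -EFinM lee_fin in upp.
have {}upp : e * (I - eta * a - Q * e * a) <= e * (2 * a / rho + e * (a / rho ^+ 2)).
  have : (1 + e / rho) ^+ 2 * a = a + e * (2 * a / rho + e * (a / rho ^+ 2)).
    by field; rewrite gt_eqF.
  by move=> h; rewrite h in upp; move: upp; rewrite /c; clear; lra.
rewrite ler_pM2l// in upp.
have -> : 2 * a / rho + t = 2 * a / rho + (t / 2 + t / 2) by field; rewrite gt_eqF.
by move: upp etaa eW; rewrite /W; clear; lra.
Qed.

(** Only the open disk is known to lie in [Om], so the divergence bound is applied with every radius
    s < rho, and s is then brought close to rho. *)
Lemma perimeter_bounds (Om : set (R * R)) (p0 : R * R) (rho : R) :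
  measurable (Om : set (mR * mR)) -> (mu2 Om < +oo)%E -> convex_plane Om -> 0 < rho ->
  (forall q, dist2 q p0 < rho ^+ 2 -> Om q) ->
  0 <= perimeter Om /\ perimeter Om * rho <= 2 * area Om.
Proof.
move=> mOm finOm cOm r0 Hd.
have main s : 0 < s -> s < rho -> 0 <= perimeter Om <= 2 * area Om / s.
  move=> s0 sr.
  have Hs q : dist2 q p0 <= s ^+ 2 -> Om q.
    by move=> h; apply: Hd; rewrite (le_lt_trans h)// ltr_sqr ?nnegrE// ltW.
  rewrite /perimeter; set S := [set _ | _ in _].
  have le1 : (ereal_sup S <= (2 * area Om / s)%:E)%E.
    apply: ge_ereal_sup => _ [X [tX X1] <-]; exact: (integral_div_le mOm finOm cOm s0 Hs tX X1).
  have ge0 : (0 <= ereal_sup S)%E.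
    apply: ereal_sup_ubound; exists (fun _ _ => 0).
      split => [i|p]; last by rewrite big1// => i _; rewrite expr0n.
      split.
      - have E l : partials l (fun _ : R * R => 0 : R) = fun=> 0.
          by elim: l => //= j l ->; apply/funext => p; exact: derive_cst.
        by move=> l; rewrite E; split => [p|j p]; [exact: cvg_cst|exact: derivable_cst].
      - rewrite (_ : [set _ | _] = set0) ?closure0; first exact: compact0.
        by apply/seteqP; split => p //=; rewrite eqxx.
      - by [].
    rewrite (eq_integral (cst 0%E)) ?integral0// => p _.
    by rewrite big1// => i _; rewrite /partial; exact: derive_cst.
  (* Finiteness matters here: [fine] would turn an infinite supremum into 0. *)
  have fn : ereal_sup S \is a fin_num by rewrite ge0_fin_numE// (le_lt_trans le1)// ltry.
  by rewrite fine_ge0//= -lee_fin fineK.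
have [P0 _] := andP (main (rho / 2) ltac:(by rewrite divr_gt0) ltac:(lra)).
split => //; rewrite leNgt; apply/negP => h.
have Pp : 0 < perimeter Om.
  rewrite lt_neqAle P0 andbT; apply/eqP => E; move: h; rewrite -E mul0r.
  by rewrite ltNge mulr_ge0// fine_ge0.
(* If the claim fails, 2 area / perimeter is below rho, and the bound with a radius strictly between
   the two is contradictory. *)
pose s := (2 * area Om / perimeter Om + rho) / 2.
have a0 : 0 <= 2 * area Om / perimeter Om by rewrite divr_ge0// mulr_ge0// fine_ge0.
have h' : 2 * area Om / perimeter Om < rho by rewrite ltr_pdivrMr// [ltRHS]mulrC.
have s0 : 0 < s by rewrite /s; lra.
have [_] := andP (main s s0 ltac:(rewrite /s; lra)).
rewrite ler_pdivlMr// leNgt => /negP; apply.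
by rewrite [ltRHS]mulrC -ltr_pdivrMr// /s; lra.
Qed.

End PerimeterBound.

(** * Flat functions at the origin *)

Section Cusp.
Context {R : realType}.
Variable eps : R.
Hypothesis eps0 : 0 < eps.
Implicit Types (x y : R) (k : nat).

(** All derivatives of exp (- eps / x), extended by 0, are combinations of these functions, so
    smoothness at 0 is a property of the family. *)
Definition cusp k x := if 0 < x then x^-1 ^+ k * expR (- (eps * x^-1)) else 0.

Lemma cusp_ge0 k x : 0 <= cusp k x.
Proof.
rewrite /cusp; case: ifPn => // x0.
by rewrite mulr_ge0 ?expR_ge0// exprn_ge0// invr_ge0 ltW.
Qed.

Lemma cuspS k x : x * cusp k.+1 x = cusp k x.
Proof.
rewrite /cusp; case: ifPn => x0; last by rewrite mulr0.
by rewrite exprS !mulrA divff ?mul1r// gt_eqF.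
Qed.

(** This is exp t >= (t / (k + 2))^(k + 2) with t = eps / x, a power of 1 + u <= exp u. The factor
    x^2 makes the derivative at 0 vanish. *)
Lemma cusp_le k x : cusp k x <= (k.+2%:R / eps) ^+ k.+2 * x ^+ 2.
Proof.
have C0 : 0 <= (k.+2%:R / eps) ^+ k.+2 by rewrite exprn_ge0// divr_ge0// ltW.
rewrite /cusp; case: ifPn => x0; last by rewrite mulr_ge0// sqr_ge0.
have xn0 : x != 0 by rewrite gt_eqF.
set t := eps * x^-1; have t0 : 0 < t by rewrite mulr_gt0// invr_gt0.
have h : (t / k.+2%:R) ^+ k.+2 <= expR t.
  have -> : expR t = expR (t / k.+2%:R) ^+ k.+2.
    by rewrite -expRM_natl [_ * (t / _)]mulrC divfK// pnatr_eq0.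
  apply: lerXn2r; rewrite ?nnegrE ?expR_ge0 ?(divr_ge0 (ltW t0))//.
  by rewrite (le_trans _ (expR_ge1Dx _))// lerDr.
rewrite expRN -ler_pdivlMl ?exprn_gt0 ?invr_gt0//.
have hp : 0 < (t / k.+2%:R) ^+ k.+2 by rewrite exprn_gt0// divr_gt0.
apply: (@le_trans _ _ ((t / k.+2%:R) ^+ k.+2)^-1).
  by rewrite lef_pV2 ?posrE// expR_gt0.
rewrite le_eqVlt; apply/orP; left; apply/eqP.
have e0 : eps != 0 by rewrite gt_eqF.
have n0 : k.+2%:R != 0 :> R by rewrite pnatr_eq0.
transitivity ((x * (k.+2%:R / eps)) ^+ k.+2).
  by rewrite -exprVn /t; congr (_ ^+ _); move: (k.+2%:R) n0 => N n0; field; rewrite e0 xn0 n0.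
rewrite exprMn exprVn invrK (_ : x ^+ k.+2 = x ^+ k * x ^+ 2); last by rewrite -exprD addn2.
by rewrite -mulrA (mulrC (x ^+ 2)).
Qed.

Lemma is_derive_cusp k x :
  is_derive x (1 : R) (cusp k) (- k%:R * cusp k.+1 x + eps * cusp k.+2 x).
Proof.
have [x0|x0|->] := ltgtP x 0.
- rewrite {2 3}/cusp (lt_gtF x0) !mulr0 addr0.
  apply: (near_eq_is_derive _ (is_derive_cst (0 : R) x (1 : R))).
  by near=> y; rewrite /cusp lt_gtF//; near: y; exact: lt_nbhsl.
- have xn0 : x != 0 by rewrite gt_eqF.
  have dv : is_derive x (1 : R) (fun y => y^-1) (- x^-1 ^+ 2).
    have h := is_deriveV (f := id) xn0 (is_derive_id x (1 : R)).
    by apply: (is_derive_eq h); rewrite /GRing.scale/= mulr1 exprVn.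
  have de := is_derive1_comp (f := @expR R) (is_derive_expR _) (is_derive_opp (is_derive_scal eps dv)).
  have h := is_derive_mul (is_derive_pow k dv) de.
  have h' : is_derive x (1 : R) (fun y => y^-1 ^+ k * expR (- (eps * y^-1)))
      (- k%:R * cusp k.+1 x + eps * cusp k.+2 x).
    apply: (is_derive_eq h); rewrite /cusp x0 /=.
    case: k {h} => [|k]; first by rewrite /= !expr0; ring.
    by rewrite succnK !exprS; ring.
  apply: (near_eq_is_derive _ h').
  by near=> y; rewrite /cusp ifT//; near: y; exact: lt_nbhsr.
- have c0 j : cusp j 0 = 0 by rewrite /cusp ltxx.
  rewrite !c0 !mulr0 addr0.
  pose C := (k.+2%:R / eps) ^+ k.+2.
  have C0 : 0 <= C by rewrite exprn_ge0// divr_ge0// ltW.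
  have key : (fun h : R => h^-1 *: (cusp k (h + 0) - cusp k 0)) @ 0^' --> (0 : R).
    apply/cvgrPdist_lt => e e0; near=> h.
    have h0 : h != 0 by near: h; exact: nbhs_dnbhs_neq.
    have hh : 0 < `|h| by rewrite normr_gt0.
    have hC : `|h| < e / (C + 1).
      by near: h; apply: (@dnbhs0_lt _ R^o); rewrite divr_gt0// ltr_wpDl.
    rewrite c0 subr0 addr0 sub0r normrN /GRing.scale/= normrM normfV (ger0_norm (cusp_ge0 _ _)).
    rewrite mulrC ltr_pdivrMr// (le_lt_trans (cusp_le k h))// -/C.
    rewrite -(real_normK (num_real h)) expr2 mulrA ltr_pM2r//.
    rewrite ltr_pdivlMr ?ltr_wpDl// in hC; apply: le_lt_trans hC.
    by rewrite mulrDr mulr1 mulrC lerDl.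
  have E : (fun h : R => h^-1 *: ((cusp k \o shift 0) (h *: (1 : R)) - cusp k 0))
     = (fun h : R => h^-1 *: (cusp k (h + 0) - cusp k 0)).
    by apply/funext => h; rewrite /= /GRing.scale/= mulr1.
  by split; [rewrite /derivable E; exact: (cvgP 0)|rewrite /derive E; exact: cvg_lim].
Unshelve. all: by end_near. Qed.

Lemma continuous_cusp k : continuous (cusp k).
Proof. by move=> x; exact: continuous_is_derive (is_derive_cusp k x). Qed.

End Cusp.

(** * A smooth radial bump and its derivatives *)

Section Bump.
Context {R : realType}.
Implicit Types (p c : R * R) (f g : R * R -> R).

Lemma smooth_closed_class (C : set (R * R -> R)) :
  (forall f, C f -> continuous f) ->
  (forall f (i : 'I_2), C f -> exists2 g, C g & forall p, is_derive p (axis R i) f (g p)) ->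
  forall f, C f -> smooth f.
Proof.
move=> CC CD f Cf.
have Cs s : C (partials s f).
  elim: s => //= i s /(CD _ i)[g Cg dg].
  suff -> : partial i (partials s f) = g by [].
  by apply/funext => p; have [_] := dg p.
move=> s; split; first exact: CC.
by move=> i p; have [g _ dg] := CD _ i (Cs s); have [] := dg p.
Qed.

Variables (eps R0 : R) (c : R * R).
Hypothesis eps0 : 0 < eps.

(** [R0] is the square of the radius, which makes this a polynomial, positive exactly in the disk of
    center [c]. *)
Definition zeta p := R0 - dist2 p c.

Lemma is_derive_coord (i j : 'I_2) p :
  is_derive p (axis R i) (fun p : R * R => if j == 0 then p.1 else p.2) ((i == j)%:R : R).
Proof.
case: (ord2 i) => ->; case: (ord2 j) => -> /=.
- by apply/is_derive_axis0; exact: is_derive_id.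
- by apply/is_derive_axis0; exact: is_derive_cst.
- by apply/is_derive_axis1; exact: is_derive_cst.
- by apply/is_derive_axis1; exact: is_derive_id.
Qed.

Definition off (j : 'I_2) p := if j == 0 then p.1 - c.1 else p.2 - c.2.

Lemma is_derive_off (i j : 'I_2) p : is_derive p (axis R i) (off j) ((i == j)%:R : R).
Proof.
have -> : off j = fun p : R * R => (if j == 0 then p.1 else p.2) - (if j == 0 then c.1 else c.2).
  by apply/funext => q; rewrite /off; case: ifP.
have h := is_derive_sub (is_derive_coord i j p) (is_derive_cst (if j == 0 then c.1 else c.2) p (axis R i)).
by rewrite subr0 in h.
Qed.

Lemma is_derive_zeta (i : 'I_2) p : is_derive p (axis R i) zeta (- 2 * off i p).
Proof.
have h := is_derive_sub (is_derive_cst R0 p (axis R i))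
  (is_derive_add (is_derive_sqr (is_derive_off i i0 p)) (is_derive_sqr (is_derive_off i i1 p))).
by apply: (is_derive_eq h); case: (ord2 i) => -> /=; ring.
Qed.

Lemma is_derive_comp_zeta (G G1 : R -> R) (i : 'I_2) p :
  (forall x, is_derive x (1 : R) G (G1 x)) ->
  is_derive p (axis R i) (fun p => G (zeta p)) (- 2 * off i p * G1 (zeta p)).
Proof.
move=> dG; have dz := is_derive_zeta i p.
case: (ord2 i) dz => -> dz.
  have h := is_derive1_comp (f := G) (dG _) ((is_derive_axis0 _ _ _).1 dz).
  by apply/is_derive_axis0; apply: (is_derive_eq h); rewrite /= -surjective_pairing mulrC.
have h := is_derive1_comp (f := G) (dG _) ((is_derive_axis1 _ _ _).1 dz).
by apply/is_derive_axis1; apply: (is_derive_eq h); rewrite /= -surjective_pairing mulrC.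
Qed.

(** Partial derivatives stay among polynomial combinations of coordinates and cusps, so smoothness
    follows by induction on this class, with no formula for higher derivatives. *)
Inductive bump_class : (R * R -> R) -> Prop :=
| BumpCst k : bump_class (fun=> k)
| BumpOff j : bump_class (off j)
| BumpCusp k : bump_class (fun p => cusp eps k (zeta p))
| BumpAdd f g : bump_class f -> bump_class g -> bump_class (fun p => f p + g p)
| BumpMul f g : bump_class f -> bump_class g -> bump_class (fun p => f p * g p).

Lemma bump_class_smooth f : bump_class f -> smooth f.
Proof.
apply: smooth_closed_class.
- move=> {}f; elim=> [k|j|k|{}f g _ IHf _ IHg|{}f g _ IHf _ IHg] p.
  + exact: cvg_cst.
  + by case: (ord2 j) => ->; rewrite /off /=; continuity_arith.
  + apply: (@continuous_comp _ _ _ zeta (cusp eps k)); last exact: continuous_cusp.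
    by rewrite /zeta /dist2; continuity_arith.
  + exact: (continuous_add (IHf p) (IHg p)).
  + exact: (continuous_mul (IHf p) (IHg p)).
- move=> {}f i; elim=> [k|j|k|{}f g cf [f' cf' df] cg [g' cg' dg]|{}f g cf [f' cf' df] cg [g' cg' dg]].
  + by exists (fun=> 0); [exact: BumpCst|move=> p; exact: is_derive_cst].
  + by exists (fun=> (i == j)%:R); [exact: BumpCst|move=> p; exact: is_derive_off].
  + exists (fun p => - 2 * off i p * (- k%:R * cusp eps k.+1 (zeta p) + eps * cusp eps k.+2 (zeta p))).
      apply: BumpMul; first by apply: BumpMul; [exact: BumpCst|exact: BumpOff].
      by apply: BumpAdd; apply: BumpMul; (try exact: BumpCst); exact: BumpCusp.
    by move=> p; exact: (is_derive_comp_zeta i p (is_derive_cusp eps0 k)).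
  + by exists (fun p => f' p + g' p); [exact: BumpAdd|move=> p; exact: is_derive_add].
  + exists (fun p => f' p * g p + f p * g' p); last by move=> p; exact: is_derive_mul.
    by apply: BumpAdd; exact: BumpMul.
Qed.

(** For x > 0 this is x^2 exp (- eps / x), a smooth substitute for the truncated square. Composed
    with [zeta] it approximates (R0 - |p - c|^2)_+^2 as eps tends to 0. *)
Definition prof x := x ^+ 2 * cusp eps 0 x.
Definition prof1 x := (2 * x + eps) * cusp eps 0 x.
Definition prof2 x := 2 * cusp eps 0 x + (2 * x + eps) * (eps * cusp eps 2 x).

Lemma is_derive_prof x : is_derive x (1 : R) prof (prof1 x).
Proof.
have h := is_derive_mul (is_derive_sqr (is_derive_id x (1 : R))) (is_derive_cusp eps0 0 x).
apply: (is_derive_eq h); rewrite /prof1 -(cuspS eps 0) -(cuspS eps 1) /=.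
by rewrite /GRing.natmul/=; ring.
Qed.

Lemma is_derive_prof1 x : is_derive x (1 : R) prof1 (prof2 x).
Proof.
have h := is_derive_mul (is_derive_add (is_derive_scal 2 (is_derive_id x (1 : R)))
  (is_derive_cst eps x (1 : R))) (is_derive_cusp eps0 0 x).
by apply: (is_derive_eq h); rewrite /prof2 /=; rewrite /GRing.natmul/=; ring.
Qed.

Definition bump p := prof (zeta p).

Lemma partial_bump (i : 'I_2) : partials [:: i] bump = fun p => - 2 * off i p * prof1 (zeta p).
Proof.
by apply/funext => p; have [_] := is_derive_comp_zeta i p is_derive_prof.
Qed.

Lemma partial2_bump (i : 'I_2) :
  partials [:: i; i] bump = fun p => 4 * off i p ^+ 2 * prof2 (zeta p) - 2 * prof1 (zeta p).
Proof.
rewrite (_ : partials [:: i; i] bump = partial i (partials [:: i] bump))// partial_bump.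
apply/funext => p.
have h := is_derive_mul (is_derive_scal (- 2) (is_derive_off i i p)) (is_derive_comp_zeta i p is_derive_prof1).
have [_] := h; rewrite /partial => ->; rewrite eqxx /=; ring.
Qed.

Lemma bump_eq0 p : zeta p <= 0 -> bump p = 0.
Proof. by rewrite leNgt => /negbTE h; rewrite /bump /prof /cusp h mulr0. Qed.

Lemma bump_test_function Om : (forall p, dist2 p c <= R0 -> Om p) -> test_function Om bump.
Proof.
move=> HOm.
have cz : continuous (fun p => dist2 p c) by move=> p; rewrite /dist2; continuity_arith.
have cl : closed [set p | dist2 p c <= R0].
  by apply: closed_le_fun => // p; exact: cvg_cst.
have sub : closure [set p | bump p != 0] `<=` [set p | dist2 p c <= R0].
  rewrite [X in _ `<=` X]((closure_id _).1 cl); apply: closure_subset => p /=.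
  by apply: contraNT; rewrite -ltNge => h; rewrite bump_eq0// /zeta; lra.
split.
- apply: bump_class_smooth.
  have -> : bump = fun p => (R0 + (- 1) * (off i0 p * off i0 p + off i1 p * off i1 p)) *
      (R0 + (- 1) * (off i0 p * off i0 p + off i1 p * off i1 p)) * cusp eps 0 (zeta p).
    by apply/funext => p; rewrite /bump /prof /zeta /off /dist2 /=; ring.
  by repeat first [exact: BumpCusp | exact: BumpOff | exact: BumpCst | apply: BumpMul | apply: BumpAdd].
- pose B := `|R0| + 1.
  apply: (@subclosed_compact _ _ (`[c.1 - B, c.1 + B]%classic `*` `[c.2 - B, c.2 + B]%classic)).
  + exact: closed_closure.
  + by apply: compact_setX; exact: segment_compact.
  + move=> p /sub /=; rewrite /dist2 => h.
    have h1 := sqr_ge0 (p.1 - c.1); have h2 := sqr_ge0 (p.2 - c.2).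
    have B1 : 1 <= B by rewrite /B lerDr.
    have hB : R0 <= B ^+ 2.
      rewrite (le_trans (ler_norm R0))// (@le_trans _ _ B)//; first by rewrite lerDl.
      by rewrite expr2 ler_peMr// (le_trans _ B1).
    have B0 : 0 <= B by rewrite (le_trans _ B1).
    have : `|p.1 - c.1| <= B by rewrite -ler_sqr ?nnegrE// real_normK ?num_real//; lra.
    have : `|p.2 - c.2| <= B by rewrite -ler_sqr ?nnegrE// real_normK ?num_real//; lra.
    by rewrite !ler_norml; clear => /andP[? ?] /andP[? ?]; split; rewrite /= in_itv/=; apply/andP; split; lra.
- by move=> p /sub; exact: HOm.
Qed.

End Bump.

(** * Moments of the distance function of a disk *)

Section Moments.
Context {R : realType}.
Notation mR := (measurableTypeR R).
Notation mu := (@lebesgue_measure R).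
Notation mu2 := (leb2 R).
Implicit Types (p c : R * R) (k : nat).

Lemma pw_lt0 k (x : R) : x < 0 -> pw k x = 0.
Proof. by rewrite /pw (leNgt 0) => ->. Qed.

Lemma measurable_pw k : measurable_fun [set: mR] (pw k : R -> R).
Proof.
case: k => [|k]; last exact: continuous_measurable_fun (@continuous_pw _ k).
have -> : pw 0 = \1_(`[(0 : R), +oo[%classic) :> (R -> R).
  apply/funext => x; rewrite indicE /pw expr0.
  have [x0|x0] := boolP (0 <= x); first by rewrite mem_set//= in_itv/= x0.
  by rewrite memNset//= in_itv/= (negbTE x0).
exact: measurable_indic.
Qed.

Lemma integrable_bounded_box M C (f : R * R -> R) : measurable_fun [set: mR * mR] f ->
  (forall p, `|f p| <= C) -> box_supp M f -> mu2.-integrable setT (EFin \o f).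
Proof.
move=> mf HC sf.
pose B : set (mR * mR) := `[- `|M|, `|M|]%classic `*` `[- `|M|, `|M|]%classic.
have mB : measurable B by apply: measurableX; exact: measurable_itv.
have -> : EFin \o f = (EFin \o f) \_ B.
  apply/funext => p; rewrite patchE; case: ifPn => //; rewrite notin_setE => Bp.
  rewrite /= sf//; apply/negP => /andP[h1 h2]; apply: Bp.
  by split; rewrite /= in_itv/= -ler_norml (le_trans (ltW _) (ler_norm M)).
apply/(integrable_mkcond _ mB); apply: measurable_bounded_integrable => //.
- have MM : - `|M| <= `|M| by rewrite (le_trans _ (normr_ge0 M))// oppr_le0.
  by have := leb2_box MM MM => ->; rewrite ltry.
- exact: measurable_funTS.
- exists C; split; first exact: num_real.
  by move=> x Cx p _; exact: (le_trans (HC p) (ltW Cx)).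
Qed.

(** The derivative of (x - a) (h - (x - a)^2)^(k+1) is integrated between the two zeros of h - (x -
    a)^2. *)
Lemma integral_slice_pw (a h : R) k :
  (\int[mu]_x (pw k.+1 (h - (x - a) ^+ 2))%:E =
   \int[mu]_x (2 * k.+1%:R * (x - a) ^+ 2 * pw k (h - (x - a) ^+ 2))%:E)%E.
Proof.
have [h0|h0] := ltP h 0.
  apply: eq_integral => x _; have hx : h - (x - a) ^+ 2 < 0 by have := sqr_ge0 (x - a); lra.
  by rewrite !pw_lt0// mulr0.
pose s := Num.sqrt h; have s0 : 0 <= s := sqrtr_ge0 h.
have s2 : s ^+ 2 = h by rewrite sqr_sqrtr.
have inI x : (0 <= h - (x - a) ^+ 2) = (a - s <= x <= a + s).
  rewrite subr_ge0 -s2 -(real_normK (num_real (x - a))) ler_sqr ?nnegrE//.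
  rewrite ler_norml; apply/andP/andP => -[? ?]; split; lra.
pose u x := (h - (x - a) ^+ 2) ^+ k.+1.
pose v x := 2 * k.+1%:R * (x - a) ^+ 2 * (h - (x - a) ^+ 2) ^+ k.
pose G x := (x - a) * (h - (x - a) ^+ 2) ^+ k.+1.
have ab : a - s <= a + s by lra.
have Ga : G (a - s) = 0.
  by rewrite /G (_ : h - _ = 0) ?expr0n ?mulr0//; rewrite -s2; ring.
have Gb : G (a + s) = 0.
  by rewrite /G (_ : h - _ = 0) ?expr0n ?mulr0//; rewrite -s2; ring.
have dz x : is_derive x (1 : R) (fun x => x - a) 1.
  by have := is_derive_sub (is_derive_id x (1 : R)) (is_derive_cst a x (1 : R)); rewrite subr0.
have dh x : is_derive x (1 : R) (fun x => h - (x - a) ^+ 2) (- 2 * (x - a)).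
  have H := is_derive_sub (is_derive_cst h x (1 : R)) (is_derive_sqr (dz x)).
  by apply: (is_derive_eq H); ring.
have dG x : is_derive x (1 : R) G (u x - v x).
  have H := is_derive_mul (dz x) (is_derive_pow k.+1 (dh x)).
  by apply: (is_derive_eq H); rewrite /u /v succnK; ring.
have cu x : {for x, continuous u}.
  exact: continuous_is_derive (is_derive_pow k.+1 (dh x)).
have cv x : {for x, continuous v}.
  have c1 := continuous_is_derive (dz x); have c2 := continuous_is_derive (is_derive_pow k (dh x)).
  exact: (continuous_mul (continuous_scal (2 * k.+1%:R) (continuous_sqr c1)) c2).
have cuv x : {for x, continuous (fun x => u x - v x)} := continuous_sub (cu x) (cv x).
have toI (f g : R -> R) : (forall x, a - s <= x <= a + s -> f x = g x) ->
    (forall x, ~~ (a - s <= x <= a + s) -> f x = 0) ->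
    (\int[mu]_x (f x)%:E = \int[mu]_(x in `[(a - s)%R, (a + s)%R]) (g x)%:E)%E.
  move=> fg f0; rewrite -(@integral_supp _ _ _ mu `[a - s, a + s]%classic).
    by apply: eq_integral => x; rewrite inE/= in_itv/= => /fg ->.
  by move=> x /=; rewrite in_itv/= => /negP/f0 ->.
rewrite (toI _ u); last 2 first.
- by move=> x; rewrite -inI /pw => ->.
- by move=> x; rewrite -inI /pw => /negbTE ->.
rewrite (toI _ v); last 2 first.
- by move=> x; rewrite -inI /pw => ->.
- by move=> x; rewrite -inI /pw => /negbTE ->; rewrite mulr0.
(* The equality is a pair of calibrations, with [- G] and with [G]. *)
apply/eqP; rewrite eq_le; apply/andP; split.
  apply: (le_integral_calibration (G := fun x => - G x) (g := fun x => - (u x - v x)) ab).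
  - by move=> x _; exact: (continuous_opp (cuv x)).
  - by move=> x _; exact: cu.
  - by move=> x _; exact: cv.
  - by move=> x _; lra.
  - by rewrite Ga Gb.
apply: (le_integral_calibration (G := G) (g := fun x => u x - v x) ab).
- by move=> x _; exact: cuv.
- by move=> x _; exact: cv.
- by move=> x _; exact: cu.
- by move=> x _; lra.
- by rewrite Ga Gb.
Qed.

Variables (R0 : R) (c : R * R).
Hypothesis R00 : 0 < R0.

Definition moment k := \int[mu2]_p pw k (zeta R0 c p).

Lemma continuous_zeta : continuous (zeta R0 c).
Proof. by move=> p; rewrite /zeta /dist2; continuity_arith. Qed.

Lemma measurable_pw_zeta k : measurable_fun [set: mR * mR] (fun p => pw k (zeta R0 c p)).
Proof.
by apply: (measurableT_comp (measurable_pw k)); exact: continuous_measurable2 continuous_zeta.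
Qed.

Lemma integrable_pw_zeta k (g : R * R -> R) : continuous g ->
  mu2.-integrable setT (EFin \o (fun p => g p * pw k (zeta R0 c p))).
Proof.
move=> cg; pose M := `|c.1| + `|c.2| + R0 + 1.
pose K : set (R * R) := `[- M, M]%classic `*` `[- M, M]%classic.
have cK : compact K by apply: compact_setX; exact: segment_compact.
have [C [_ HC]] := compact_bounded (continuous_compact (continuous_subspaceT cg) cK).
have far p : ~~ ((`|p.1| < M) && (`|p.2| < M)) -> zeta R0 c p < 0.
  have R0p := R00; have R2 : R0 <= (R0 + 1) ^+ 2 by nra.
  rewrite negb_and -!leNgt /zeta /dist2 /M => h.
  have h1 := sqr_ge0 (p.1 - c.1); have h2 := sqr_ge0 (p.2 - c.2).
  case/orP: h => h.
    have h' : R0 + 1 <= `|p.1 - c.1|.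
      by have := ler_normD (p.1 - c.1) c.1; rewrite subrK; have := normr_ge0 c.2; lra.
    have : (R0 + 1) ^+ 2 <= (p.1 - c.1) ^+ 2.
      by rewrite -(real_normK (num_real (p.1 - c.1))) ler_sqr ?nnegrE//; lra.
    by nra.
  have h' : R0 + 1 <= `|p.2 - c.2|.
    by have := ler_normD (p.2 - c.2) c.2; rewrite subrK; have := normr_ge0 c.1; lra.
  have : (R0 + 1) ^+ 2 <= (p.2 - c.2) ^+ 2.
    by rewrite -(real_normK (num_real (p.2 - c.2))) ler_sqr ?nnegrE//; lra.
  by nra.
apply: (@integrable_bounded_box M ((`|C| + 1) * R0 ^+ k)).
- apply: measurable_funM; first exact: continuous_measurable2.
  exact: measurable_pw_zeta.
- move=> p; have [h|/far h] := boolP ((`|p.1| < M) && (`|p.2| < M)); last first.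
    by rewrite pw_lt0// mulr0 normr0; apply: mulr_ge0; [exact: addr_ge0|rewrite exprn_ge0// ltW].
  rewrite normrM; apply: ler_pM => //.
    apply: (HC (`|C| + 1)); first by rewrite (le_lt_trans (ler_norm C))// ltrDl.
    by exists p => //; case/andP: h => h1 h2; split; rewrite /= in_itv/= -ler_norml ltW.
  rewrite ger0_norm ?pw_ge0// /pw; case: ifPn => z0; last by rewrite exprn_ge0// ltW.
  apply: lerXn2r; rewrite ?nnegrE ?(ltW R00)//.
  by rewrite /zeta lerBlDr lerDl /dist2 addr_ge0 ?sqr_ge0.
- by move=> p /far h; rewrite pw_lt0// mulr0.
Qed.

(** The slice identities along the two axes add up to 2 m_(k+1) = 2 (k + 1) times the integral of |p
    - c|^2 zeta_+^k, and |p - c|^2 = R0 - zeta. The ratios of moments are obtained without polar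
    coordinates, and the remaining factor [moment 0] cancels from every quotient of energies. *)
Lemma moment_step k : k.+2%:R * moment k.+1 = k.+1%:R * R0 * moment k.
Proof.
have i1 k' : mu2.-integrable setT (EFin \o (fun p => pw k' (zeta R0 c p))).
  rewrite (_ : (fun p => _) = fun p => 1 * pw k' (zeta R0 c p)).
    by apply: (@integrable_pw_zeta k' (fun=> 1)) => p; exact: cvg_cst.
  by apply/funext => p /=; rewrite mul1r.
pose q1 (p : R * R) := 2 * k.+1%:R * (p.1 - c.1) ^+ 2.
pose q2 (p : R * R) := 2 * k.+1%:R * (p.2 - c.2) ^+ 2.
have cq1 : continuous q1 by move=> p; rewrite /q1; continuity_arith.
have cq2 : continuous q2 by move=> p; rewrite /q2; continuity_arith.
have e1 : moment k.+1 = \int[mu2]_p (q1 p * pw k (zeta R0 c p)).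
  rewrite /moment /Rintegral; congr fine.
  rewrite !tonelli2; last 4 first.
  - by apply/measurable_EFinP; apply: measurable_funM; [exact: continuous_measurable2|exact: measurable_pw_zeta].
  - by move=> p; rewrite lee_fin mulr_ge0 ?pw_ge0// mulr_ge0 ?sqr_ge0.
  - by apply/measurable_EFinP; exact: measurable_pw_zeta.
  - by move=> p; rewrite lee_fin pw_ge0.
  apply: eq_integral => y _.
  have zE x : zeta R0 c (x, y) = (R0 - (y - c.2) ^+ 2) - (x - c.1) ^+ 2.
    by rewrite /zeta /dist2 /=; ring.
  transitivity (\int[mu]_x (pw k.+1 ((R0 - (y - c.2) ^+ 2) - (x - c.1) ^+ 2))%:E)%E.
    by apply: eq_integral => x _; rewrite zE.
  by rewrite integral_slice_pw; apply: eq_integral => x _; rewrite /q1 zE.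
have e2 : moment k.+1 = \int[mu2]_p (q2 p * pw k (zeta R0 c p)).
  rewrite /moment /Rintegral; congr fine.
  rewrite !tonelli1; last 4 first.
  - by apply/measurable_EFinP; apply: measurable_funM; [exact: continuous_measurable2|exact: measurable_pw_zeta].
  - by move=> p; rewrite lee_fin mulr_ge0 ?pw_ge0// mulr_ge0 ?sqr_ge0.
  - by apply/measurable_EFinP; exact: measurable_pw_zeta.
  - by move=> p; rewrite lee_fin pw_ge0.
  apply: eq_integral => x _.
  have zE y : zeta R0 c (x, y) = (R0 - (x - c.1) ^+ 2) - (y - c.2) ^+ 2.
    by rewrite /zeta /dist2 /=; ring.
  transitivity (\int[mu]_y (pw k.+1 ((R0 - (x - c.1) ^+ 2) - (y - c.2) ^+ 2))%:E)%E.
    by apply: eq_integral => y _; rewrite zE.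
  by rewrite integral_slice_pw; apply: eq_integral => y _; rewrite /q2 zE.
have E : 2 * moment k.+1 = 2 * k.+1%:R * (R0 * moment k - moment k.+1).
  have -> : 2 * moment k.+1 = moment k.+1 + moment k.+1 by ring.
  rewrite {1}e1 e2 -RintegralD//; [|exact: integrable_pw_zeta|exact: integrable_pw_zeta].
  have iR : mu2.-integrable setT (EFin \o (fun p => R0 * pw k (zeta R0 c p))).
    by apply: (@integrable_pw_zeta k (fun=> R0)) => p; exact: cvg_cst.
  have -> : (fun p => q1 p * pw k (zeta R0 c p) + q2 p * pw k (zeta R0 c p)) =
     (fun p => 2 * k.+1%:R * (R0 * pw k (zeta R0 c p) - pw k.+1 (zeta R0 c p))).
    apply/funext => p; rewrite pwS /q1 /q2 {4}/zeta /dist2; ring.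
  rewrite RintegralZl//; last by have := integrableB measurableT iR (i1 k.+1).
  by rewrite (RintegralB measurableT iR (i1 k.+1)) (RintegralZl R0 measurableT (i1 k)) -e2.
have -> : k.+2%:R = k.+1%:R + 1 :> R by rewrite -natr1.
by move: E; move: (k.+1%:R) => n E; lra.
Qed.

End Moments.

(** * The area of a disk *)

Section DiskArea.
Context {R : realType}.
Notation mR := (measurableTypeR R).
Notation mu := (@lebesgue_measure R).
Notation mu2 := (leb2 R).

Lemma continuous_half_circle (r : R) : continuous (fun y : R => 2 * Num.sqrt (r ^+ 2 - y ^+ 2)).
Proof.
move=> y; have c : {for y, continuous (fun y : R => Num.sqrt (r ^+ 2 - y ^+ 2))}.
  apply: (@continuous_comp _ _ _ (fun y : R => r ^+ 2 - y ^+ 2) Num.sqrt); last exact: sqrt_continuous.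
  by continuity_arith.
exact: (continuous_scal 2 c).
Qed.

Lemma integral_half_circle (r : R) : 0 < r ->
  (\int[mu]_(y in `[(- r)%R, r]) (2 * Num.sqrt (r ^+ 2 - y ^+ 2))%:E = (pi * r ^+ 2)%:E)%E.
Proof.
move=> r0; have p0 := pi_gt0 R; have rn0 : r != 0 by rewrite gt_eqF.
pose F (x : R) := r * sin x.
have dF x : is_derive x (1 : R) F (r * cos x) := is_derive_scal r (is_derive_sin x).
have F' : derive1 F = fun x => r * cos x.
  by apply/funext => x; rewrite derive1E; have [_] := dF x.
have cF' : continuous (derive1 F).
  by rewrite F' => x; apply: continuous_scal; exact: continuous_cos.
have Fb : F (pi / 2) = r by rewrite /F sin_pihalf mulr1.
have Fa : F (- (pi / 2)) = - r by rewrite /F sinN sin_pihalf mulrN1.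
have ab : - (pi / 2) <= pi / 2 :> R by lra.
have subst := @integration_by_substitution_increasing R F
  (fun y => 2 * Num.sqrt (r ^+ 2 - y ^+ 2)) _ _ ab.
rewrite Fa Fb in subst; rewrite subst {subst}.
- pose G (x : R) := r ^+ 2 * (x + sin x * cos x).
  have dG x : is_derive x (1 : R) G (2 * (r * cos x) ^+ 2).
    have h := is_derive_scal (r ^+ 2) (is_derive_add (is_derive_id x (1 : R))
      (is_derive_mul (is_derive_sin x) (is_derive_cos x))).
    apply: (is_derive_eq h).
    have := cos2Dsin2 x; move: (cos x) (sin x) => u v uv.
    have vv : v ^+ 2 = 1 - u ^+ 2 by lra.
    by transitivity (r ^+ 2 * (1 + u ^+ 2 - v ^+ 2)); [ring|rewrite vv; ring].
  transitivity (\int[mu]_(x in `[(- (pi / 2))%R, (pi / 2)%R]) (2 * (r * cos x) ^+ 2)%:E)%E.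
    apply: eq_integral => x; rewrite inE/= in_itv/= => xI.
    have c0 : 0 <= cos x by exact: cos_ge0_pihalf.
    congr EFin; rewrite F' /F /=.
    have -> : (((fun y => 2 * Num.sqrt (r ^+ 2 - y ^+ 2)) \o (fun x0 => r * sin x0)) * (fun x0 => r * cos x0)) x
      = 2 * Num.sqrt (r ^+ 2 - (r * sin x) ^+ 2) * (r * cos x) by [].
    have -> : r ^+ 2 - (r * sin x) ^+ 2 = (r * cos x) ^+ 2.
      rewrite !exprMn; have := cos2Dsin2 x; move: (cos x ^+ 2) (sin x ^+ 2) => u v uv.
      have -> : u = 1 - v by lra.
      by ring.
    by rewrite sqrtr_sqr ger0_norm ?mulr_ge0 ?(ltW r0)// expr2 mulrA.
  have ab' : - (pi / 2) < pi / 2 :> R by lra.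
  rewrite (FTC2_in ab' (fun x _ => dG x)); last first.
    move=> x _; apply: continuous_scal; apply: continuous_sqr; apply: continuous_scal; exact: continuous_cos.
  by congr EFin; rewrite /G cosN cos_pihalf !mulr0 !addr0; field.
- move=> x y; rewrite !in_itv/= => xI yI xy; rewrite /F ltr_pM2l//.
  by rewrite ltr_sin// in_itv.
- by move=> x _; exact: cF'.
- by apply: cvgP; apply: cvg_at_right_filter; exact: cF'.
- by apply: cvgP; apply: cvg_at_left_filter; exact: cF'.
- split.
  + by move=> x _; have [] := dF x.
  + by apply: cvg_at_right_filter; exact: continuous_is_derive (dF _).
  + by apply: cvg_at_left_filter; exact: continuous_is_derive (dF _).
- by apply: continuous_subspaceT; exact: continuous_half_circle.
Qed.

Lemma measurable_open_disk (c : R * R) (r : R) :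
  measurable (open_disk c r : set (mR * mR)).
Proof.
apply: open_measurable2.
rewrite (_ : open_disk c r = ~` [set p | r ^+ 2 <= dist2 p c]).
  apply: closed_openC; apply: closed_le_fun => p; first exact: cvg_cst.
  by rewrite /dist2; continuity_arith.
by apply/seteqP; split => p /=; rewrite /open_disk /dist2/= leNgt; [move=> ->|move/negP/negPn].
Qed.

(** The comparison uses pi r^2 only as an upper bound for the common area. *)
Lemma area_disk_le (c : R * R) (r : R) : 0 < r -> (mu2 (open_disk c r) <= (pi * r ^+ 2)%:E)%E.
Proof.
move=> r0; pose D : set (mR * mR) := open_disk c r.
have mD : measurable D by exact: measurable_open_disk.
have mi := measurable_indic_EFin (R := R) mD.
have -> : (mu2 D = \int[mu2]_p (\1_D p)%:E)%E by rewrite integral_indic// setIT.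
rewrite tonelli2//.
have cS := @continuous_half_circle r.
pose g (y : R) : \bar R := ((fun y => (2 * Num.sqrt (r ^+ 2 - y ^+ 2))%:E) \_ `[- r, r]%classic) y.
have mg : measurable_fun [set: mR] g.
  apply/(measurable_restrict _ (measurable_itv _) measurableT); rewrite setTI.
  by apply: measurable_funTS; apply/measurable_EFinP; exact: continuous_measurable_fun.
have g0 y : (0 <= g y)%E by rewrite /g patchE; case: ifPn => // _; rewrite lee_fin mulr_ge0// sqrtr_ge0.
have <- : (\int[mu]_y g (y + (- c.2))%R = (pi * r ^+ 2)%:E)%E.
  rewrite ge0_integral_translate// -(integral_half_circle r0).
  by rewrite [RHS]integral_mkcond.
apply: ge0_le_integral => //.
- by move=> y _; exact: integral_ge0.
- exact: (measurable_fun_fubini_tonelli_G (m1 := mu) _ mi).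
- by apply: (measurableT_comp mg); apply: measurable_funD.
move=> y _; rewrite /g patchE.
have inD x : D (x, y) -> (y - c.2 \in `[- r, r]%classic) /\
    (x \in `[(c.1 - Num.sqrt (r ^+ 2 - (y - c.2) ^+ 2)), (c.1 + Num.sqrt (r ^+ 2 - (y - c.2) ^+ 2))]%classic).
  rewrite /D /open_disk /= => h.
  have h1 := sqr_ge0 (x - c.1); have h2 := sqr_ge0 (y - c.2).
  rewrite !inE/= !in_itv/= -ler_norml; split.
    by rewrite -ler_sqr ?nnegrE ?(ltW r0)// real_normK ?num_real//; lra.
  have : `|x - c.1| <= Num.sqrt (r ^+ 2 - (y - c.2) ^+ 2).
    by rewrite -sqrtr_sqr ler_wsqrtr//; lra.
  by rewrite ler_norml => /andP[? ?]; apply/andP; split; lra.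
case: ifPn => yI; last first.
  rewrite (eq_integral (cst 0%E)) ?integral0// => x _; rewrite indicE.
  by have [/set_mem/inD[h _]|//] := boolP ((x, y) \in D); rewrite h in yI.
set s := Num.sqrt _ in inD *.
have s0 : 0 <= s by exact: sqrtr_ge0.
apply: (@le_trans _ _ (\int[mu]_x (\1_(`[c.1 - s, c.1 + s]%classic) x)%:E)%E).
  apply: ge0_le_integral => //.
  - exact: (measurable_section1 mi y).
  - by apply/measurable_EFinP; exact: measurable_indic.
  move=> x _; rewrite lee_fin !indicE.
  by have [/set_mem/inD[_ ->]|//] := boolP ((x, y) \in D).
rewrite integral_indic// setIT.
apply: (@le_trans _ _ (mu `[c.1 - s, c.1 + s]%classic)); first by [].
rewrite lebesgue_measure_itv/= lte_fin; case: ifPn => _; last by rewrite lee_fin mulr_ge0.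
by rewrite -EFinD lee_fin; lra.
Qed.

End DiskArea.

(** * Energies of the trial function on a disk *)

Section Trial.
Context {R : realType}.
Notation mR := (measurableTypeR R).
Notation mu2 := (leb2 R).
Implicit Types (p c : R * R) (x t : R).

Lemma expR_ge_quadratic t : 0 <= t -> 1 + t + t ^+ 2 / 2 <= expR t.
Proof.
move=> t0.
have dg x : is_derive x (1 : R) (fun x => expR x - (1 + x + x ^+ 2 / 2)) (expR x - (1 + x)).
  have h := is_derive_sub (is_derive_expR x) (is_derive_add (is_derive_add (is_derive_cst (1 : R) x (1 : R))
    (is_derive_id x (1 : R))) (is_derive_mul (is_derive_sqr (is_derive_id x (1 : R))) (is_derive_cst (2^-1 : R) x (1 : R)))).
  by apply: (is_derive_eq h) => /=; field.
have [x _] := MVT_sym 0 t dg.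
rewrite expR0 expr0n/= mul0r !addr0 subrr !subr0 => E.
by rewrite -subr_ge0 E mulr_ge0// subr_ge0 expR_ge1Dx.
Qed.

Section Profile.
Variable eps : R.
Hypothesis eps0 : 0 < eps.

Lemma prof_np x : x <= 0 -> [/\ prof eps x = 0, prof1 eps x = 0 & prof2 eps x = 0].
Proof.
by rewrite leNgt => /negbTE h; rewrite /prof /prof1 /prof2 /cusp h !mulr0 addr0.
Qed.

(** With t = eps / x and E = exp (- t), one has prof1 = x (2 + t) E and prof2 = (2 + 2 t + t^2) E.
    The upper bounds are those of x^2 itself, without loss, because E (1 + t + t^2 / 2) <= 1; the
    first and last lower bounds lose a term of order eps, from E^2 >= 1 - 2 t. *)
Lemma prof_bounds x : 0 < x ->
  [/\ x ^+ 4 - 2 * eps * x ^+ 3 <= prof eps x ^+ 2, 0 <= prof1 eps x <= 2 * x,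
      0 <= prof2 eps x <= 2 & 4 * x - 8 * eps <= prof1 eps x * prof2 eps x].
Proof.
move=> x0; have e0 := eps0; have xn0 : x != 0 by rewrite gt_eqF.
pose t := eps * x^-1; have t0 : 0 < t by rewrite mulr_gt0// invr_gt0.
have tx : t * x = eps by rewrite /t mulfVK.
have eE : eps = t * x by rewrite tx.
pose E := expR (- t).
have E0 : 0 < E by exact: expR_gt0.
have c0 : cusp eps 0 x = E by rewrite /cusp x0 expr0 mul1r.
have c2 : eps * cusp eps 2 x = t * x^-1 * E.
  by rewrite /cusp x0 -/t -/E /t expr2; ring.
have Ex : E * expR t = 1 by rewrite -expRD addNr expR0.
have qt := expR_ge_quadratic (ltW t0).
have P1 : prof1 eps x = x * (2 + t) * E by rewrite /prof1 c0 {1}eE; ring.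
have P2 : prof2 eps x = (2 + 2 * t + t ^+ 2) * E.
  by rewrite /prof2 c0 c2 {1}eE; field.
have low k : 0 <= k -> k * (1 + t + t ^+ 2 / 2) * E <= k.
  move=> k0; rewrite -mulrA -[leRHS]mulr1; apply: ler_wpM2l => //.
  by apply: (@le_trans _ _ (expR t * E)); [rewrite ler_pM2r|rewrite mulrC Ex].
have EE : 1 - 2 * t <= E ^+ 2.
  have -> : E ^+ 2 = expR (- (2 * t)) by rewrite /E -expRM_natl; congr expR; ring.
  by have := expR_ge1Dx (- (2 * t)).
have E20 : 0 <= E ^+ 2 := sqr_ge0 E.
split.
- rewrite /prof c0 exprMn eE -subr_ge0.
  have -> : (x ^+ 2) ^+ 2 * E ^+ 2 - (x ^+ 4 - 2 * (t * x) * x ^+ 3) = x ^+ 4 * (E ^+ 2 - (1 - 2 * t)) by ring.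
  by rewrite mulr_ge0 ?exprn_ge0 ?(ltW x0)// subr_ge0.
- apply/andP; split; first by rewrite P1 !mulr_ge0 ?(ltW x0) ?(ltW E0)// addr_ge0// ltW.
  rewrite P1 -mulrA [leRHS]mulrC ler_pM2l//; apply: le_trans (low 2 _) => //; rewrite ler_pM2r//.
  by have := sqr_ge0 t; lra.
- apply/andP; split; first by rewrite P2 mulr_ge0 ?(ltW E0)//; have := sqr_ge0 t; lra.
  by rewrite P2; have := low 2 (ler0n R 2); lra.
- rewrite P1 P2.
  have -> : x * (2 + t) * E * ((2 + 2 * t + t ^+ 2) * E) = x * (((2 + t) * (2 + 2 * t + t ^+ 2)) * E ^+ 2) by ring.
  have -> : 4 * x - 8 * eps = x * (4 * (1 - 2 * t)) by rewrite eE; ring.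
  rewrite ler_pM2l//; apply: (@le_trans _ _ (4 * E ^+ 2)); first by rewrite ler_pM2l.
  rewrite ler_wpM2r//; have := sqr_ge0 t; have := mulr_ge0 (ltW t0) (sqr_ge0 t); lra.
Qed.

End Profile.

Definition mass (f : R * R -> R) := \int[mu2]_p (f p ^+ 2).
Definition dirichlet (f : R * R -> R) :=
  \int[mu2]_p (partials [:: i0] f p ^+ 2 + partials [:: i1] f p ^+ 2).
Definition bending (f : R * R -> R) :=
  \int[mu2]_p ((partials [:: i0; i0] f p + partials [:: i1; i1] f p) ^+ 2).

Section BumpEnergy.
Variables (R0 eps : R) (c : R * R).
Hypotheses (R00 : 0 < R0) (eps0 : 0 < eps).
Notation z := (zeta R0 c).
Notation m := (moment R0 c).
Notation phi := (bump eps R0 c).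

Let tphi : test_function setT phi.
Proof. exact: bump_test_function. Qed.

Let integrable_cst_pw k (a : R) : mu2.-integrable setT (EFin \o (fun p => a * pw k (z p))).
Proof. by apply: (@integrable_pw_zeta _ R0 c R00 k (fun=> a)) => p; exact: cvg_cst. Qed.

Let integral_cst_pw k (a : R) : \int[mu2]_p (a * pw k (z p)) = a * m k.
Proof.
have i1 : mu2.-integrable setT (EFin \o (fun p => pw k (z p))).
  rewrite (_ : (fun p => _) = fun p => 1 * pw k (z p)); first exact: integrable_cst_pw.
  by apply/funext => p; rewrite mul1r.
exact: (RintegralZl a measurableT i1).
Qed.

Let integral_comb (a b d : R) k l n :
  mu2.-integrable setT (EFin \o (fun p => a * pw k (z p) + b * pw l (z p) + d * pw n (z p))) /\
  \int[mu2]_p (a * pw k (z p) + b * pw l (z p) + d * pw n (z p)) = a * m k + b * m l + d * m n.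
Proof.
have i1 := integrable_cst_pw k a; have i2 := integrable_cst_pw l b; have i3 := integrable_cst_pw n d.
have i12 : mu2.-integrable setT (EFin \o (fun p => a * pw k (z p) + b * pw l (z p))).
  by have := integrableD measurableT i1 i2.
split; first by have := integrableD measurableT i12 i3.
by rewrite (RintegralD measurableT i12 i3) (RintegralD measurableT i1 i2) !integral_cst_pw.
Qed.

Lemma moments : [/\ m 1 = R0 * m 0 / 2, m 2 = R0 ^+ 2 * m 0 / 3, m 3 = R0 ^+ 3 * m 0 / 4 &
  m 4 = R0 ^+ 4 * m 0 / 5].
Proof.
have h k := @moment_step _ R0 c R00 k.
have h1 : m 1 = R0 * m 0 / 2 by have := h 0%N; lra.
have h2 : m 2 = R0 ^+ 2 * m 0 / 3.
  by have := h 1%N; rewrite h1; lra.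
have h3 : m 3 = R0 ^+ 3 * m 0 / 4.
  by have := h 2%N; rewrite h2; lra.
have h4 : m 4 = R0 ^+ 4 * m 0 / 5.
  by have := h 3%N; rewrite h3; lra.
by split.
Qed.

Lemma moment0_gt0 : 0 < m 0.
Proof.
pose s := Num.sqrt (R0 / 2); have s0 : 0 < s by rewrite sqrtr_gt0 divr_gt0.
have s2 : s ^+ 2 = R0 / 2 by rewrite sqr_sqrtr// divr_ge0// ltW.
pose B : set (mR * mR) := `[c.1 - s, c.1 + s]%classic `*` `[c.2 - s, c.2 + s]%classic.
have mB : measurable B by apply: measurableX; exact: measurable_itv.
have h1 : c.1 - s <= c.1 + s by lra.
have h2 : c.2 - s <= c.2 + s by lra.
have B4 : mu2 B = (4 * s ^+ 2)%:E by have := leb2_box h1 h2 => ->; congr EFin; ring.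
have i0 : mu2.-integrable setT (EFin \o (fun p => pw 0 (z p))).
  rewrite (_ : (fun p => _) = fun p => 1 * pw 0 (z p)); first exact: integrable_cst_pw.
  by apply/funext => p; rewrite mul1r.
rewrite -lte_fin; apply: (@lt_le_trans _ _ (4 * s ^+ 2)%:E).
  by rewrite lte_fin mulr_gt0// exprn_gt0.
rewrite /moment /Rintegral fineK; last exact: (integrable_fin_num measurableT i0).
rewrite -B4 -[B]setIT -integral_indic//.
apply: ge0_le_integral => //.
- by apply/measurable_EFinP; exact: measurable_indic.
- by have /integrableP[] := i0.
move=> p _; rewrite lee_fin indicE; have [|_] := boolP (p \in B); last exact: pw_ge0.
rewrite inE => -[/=]; rewrite !in_itv/= => /andP[? ?] /andP[? ?].
rewrite /pw expr0 ifT// /zeta /dist2 subr_ge0.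
have q1 : (p.1 - c.1) ^+ 2 <= s ^+ 2.
  by rewrite -(real_normK (num_real (p.1 - c.1))) ler_sqr ?nnegrE ?(ltW s0)// ler_norml; apply/andP; split; lra.
have q2 : (p.2 - c.2) ^+ 2 <= s ^+ 2.
  by rewrite -(real_normK (num_real (p.2 - c.2))) ler_sqr ?nnegrE ?(ltW s0)// ler_norml; apply/andP; split; lra.
by rewrite s2 in q1 q2; lra.
Qed.

Let box_phi : exists M, forall s, box_supp M (partials s phi).
Proof. exact: test_function_box tphi. Qed.

Let sphi : smooth phi.
Proof. by case: tphi. Qed.

Lemma mass_bump_ge : R0 ^+ 4 * m 0 / 5 - eps * R0 ^+ 3 * m 0 / 2 <= mass phi.
Proof.
have [M bM] := box_phi.
have [_ _ m3 m4] := moments.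
have [ii Ei] := integral_comb 1 (- 2 * eps) 0 4 3 0.
have im : mu2.-integrable setT (EFin \o (fun p => phi p ^+ 2)).
  by have := integrable_partials2 sphi bM [::] [::]; rewrite /partials/=; under eq_fun do rewrite -expr2.
have := le_Rintegral measurableT ii im.
rewrite Ei m3 m4 => H; apply: le_trans (H _); first by lra.
move=> p _; rewrite mul0r addr0 mul1r /bump.
have [z0|z0] := leP (z p) 0.
  have [-> _ _] := prof_np eps z0; rewrite expr0n/=.
  by rewrite !pw_le0// mulr0 addr0.
have [h _ _ _] := prof_bounds eps0 z0.
by rewrite !pw_gt0//; move: h; lra.
Qed.

(** The squared gradient 4 (R0 - zeta) prof1^2 is at most 16 (R0 - zeta) zeta^2, and the moments
    give 16 (1/3 - 1/4) = 4/3. *)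
Lemma dirichlet_bump_le : dirichlet phi <= 4 / 3 * R0 ^+ 3 * m 0.
Proof.
have [M bM] := box_phi.
have [_ m2 m3 _] := moments.
have [ii Ei] := integral_comb (16 * R0) (- 16) 0 2 3 0.
have im : mu2.-integrable setT (EFin \o (fun p => partials [:: i0] phi p ^+ 2 + partials [:: i1] phi p ^+ 2)).
  have := integrableD measurableT (integrable_partials2 sphi bM [:: i0] [:: i0]) (integrable_partials2 sphi bM [:: i1] [:: i1]).
  by apply: eq_integrable => // p _ /=; rewrite -EFinD !expr2.
have := le_Rintegral measurableT im ii.
rewrite Ei m2 m3 => H; apply: (le_trans (H _)); last by lra.
move=> p _; rewrite mul0r addr0 !partial_bump//.
have [z0|z0] := leP (z p) 0.
  have [_ -> _] := prof_np eps z0; rewrite !mulr0 expr0n/= addr0.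
  by rewrite !pw_le0// !mulr0 addr0.
have [_ /andP[h1 h2] _ _] := prof_bounds eps0 z0.
rewrite !pw_gt0//.
have sE : off c i0 p ^+ 2 + off c i1 p ^+ 2 = R0 - z p by rewrite /zeta /off /dist2 /=; ring.
have s0 : 0 <= R0 - z p by rewrite -sE addr_ge0 ?sqr_ge0.
have -> : (- 2 * off c i0 p * prof1 eps (z p)) ^+ 2 + (- 2 * off c i1 p * prof1 eps (z p)) ^+ 2 =
  4 * (R0 - z p) * prof1 eps (z p) ^+ 2 by rewrite -sE; ring.
have : prof1 eps (z p) ^+ 2 <= (2 * z p) ^+ 2.
  by apply: lerXn2r => //; rewrite nnegrE mulr_ge0// ltW.
by move/(ler_wpM2l (mulr_ge0 (ler0n R 4) s0)); lra.
Qed.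

(** The Laplacian is 4 ((R0 - zeta) prof2 - prof1), close to 8 (R0 - 2 zeta), and the moments give
    64 (1 - 2 + 4/3) = 64/3. The cross term of the square is negative, hence the need for a lower
    bound on prof1 * prof2. *)
Lemma bending_bump_le : bending phi <= (64 / 3 * R0 ^+ 2 + 128 * eps * R0) * m 0.
Proof.
have [M bM] := box_phi.
have [m1 m2 _ _] := moments.
have [ii Ei] := integral_comb (64 * R0 ^+ 2 + 256 * eps * R0) (- (256 * R0) - 256 * eps) 256 0 1 2.
have im : mu2.-integrable setT (EFin \o (fun p => (partials [:: i0; i0] phi p + partials [:: i1; i1] phi p) ^+ 2)).
  apply: (@integrable_box _ M).
    have ct l : continuous (partials l phi) by exact: smooth_continuous.
    apply: (@continuous_sqr_plane _ (fun p => partials [:: i0; i0] phi p + partials [:: i1; i1] phi p)) => p.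
    exact: (continuous_add (ct [:: i0; i0] p) (ct [:: i1; i1] p)).
  by move=> p pM; rewrite !bM// addr0 expr0n.
have := le_Rintegral measurableT im ii.
rewrite Ei m1 m2 => H; apply: (le_trans (H _)); last by lra.
move=> p _; rewrite !partial2_bump//.
have sE : off c i0 p ^+ 2 + off c i1 p ^+ 2 = R0 - z p by rewrite /zeta /off /dist2 /=; ring.
have s0 : 0 <= R0 - z p by rewrite -sE addr_ge0 ?sqr_ge0.
have [z0|z0] := leP (z p) 0.
  have [_ -> ->] := prof_np eps z0; rewrite !mulr0 subrr addr0 expr0n/=.
  rewrite (pw_le0 0 z0) (pw_le0 1 z0) !mulr0 !addr0; apply: mulr_ge0; last exact: pw_ge0.
  apply: addr_ge0; first by apply: mulr_ge0 => //; exact: sqr_ge0.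
  by apply: mulr_ge0; [apply: mulr_ge0; [exact: ler0n|exact: ltW]|exact: ltW].
have [_ /andP[h1 h2] /andP[h3 h4] h5] := prof_bounds eps0 z0.
rewrite !pw_gt0// expr0 expr1 mulr1.
have -> : (4 * off c i0 p ^+ 2 * prof2 eps (z p) - 2 * prof1 eps (z p) +
   (4 * off c i1 p ^+ 2 * prof2 eps (z p) - 2 * prof1 eps (z p))) ^+ 2 =
  16 * ((R0 - z p) * prof2 eps (z p) - prof1 eps (z p)) ^+ 2 by rewrite -sE; ring.
have R0E : R0 = (R0 - z p) + z p by rewrite subrK.
move: (prof1 eps (z p)) (prof2 eps (z p)) h1 h2 h3 h4 h5 => u v u0 ux v0 v2 uv.
move: R0E s0; move: (R0 - z p) => s; move: (z p) z0 ux uv => x x0 ux uv -> s0.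
have q1 : v ^+ 2 <= 2 ^+ 2 by rewrite ler_sqr ?nnegrE.
have q2 : u ^+ 2 <= (2 * x) ^+ 2 by apply: lerXn2r => //; rewrite nnegrE mulr_ge0// ltW.
have q3 := ler_wpM2l s0 uv; have q4 := ler_wpM2l (sqr_ge0 s) q1.
have -> : 16 * (s * v - u) ^+ 2 = 16 * (s ^+ 2 * v ^+ 2) - 32 * (s * (u * v)) + 16 * u ^+ 2 by ring.
by move: q2 q3 q4; move: (u ^+ 2) (s * (u * v)) (s ^+ 2 * v ^+ 2) => A B D; lra.
Qed.

End BumpEnergy.

Lemma disk_trial c (r : R) : 0 < r -> exists2 phi, test_function (open_disk c r) phi &
  [/\ 0 < mass phi, r ^+ 2 * dirichlet phi <= 127 / 19 * mass phi &
    r ^+ 4 * bending phi <= 534 / 5 * mass phi].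
Proof.
(* [rho] shrinks the squared radius so that the support lies in the open disk, and [eta] is eps
   relative to it. Both are small enough for 127/19 and 534/5 to exceed the perturbed values of 20/3
   and 320/3. *)
move=> r0; pose rho : R := 1 - 4 / (100 * 100); pose eta : R := 1 / (100 * 1000).
pose R0 := rho * r ^+ 2; pose eps := eta * R0.
have r20 : 0 < r ^+ 2 by rewrite exprn_gt0.
have rho0 : 0 < rho by rewrite /rho; lra.
have eta0 : 0 < eta by rewrite /eta; lra.
have R00 : 0 < R0 by rewrite mulr_gt0.
have eps0 : 0 < eps by rewrite mulr_gt0.
exists (bump eps R0 c).
  apply: bump_test_function => // p; rewrite /open_disk /dist2 /= => h.
  by apply: le_lt_trans h _; rewrite gtr_pMl// /rho; lra.
have M0 := moment0_gt0 c R00; set m := moment R0 c 0 in M0.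
have H1 := mass_bump_ge c R00 eps0; have H2 := dirichlet_bump_le c R00 eps0.
have H3 := bending_bump_le c R00 eps0; rewrite -/m in H1 H2 H3.
pose N := r ^+ 8 * m; have N0 : 0 < N by rewrite mulr_gt0// exprn_gt0.
have {}H1 : rho ^+ 4 * (1 / 5 - eta / 2) * N <= mass (bump eps R0 c).
  by apply: le_trans H1; rewrite le_eqVlt; apply/orP; left; apply/eqP; rewrite /eps /R0 /N; field.
have {}H2 : r ^+ 2 * dirichlet (bump eps R0 c) <= 4 / 3 * rho ^+ 3 * N.
  have -> : 4 / 3 * rho ^+ 3 * N = r ^+ 2 * (4 / 3 * R0 ^+ 3 * m) by rewrite /R0 /N; ring.
  by rewrite ler_pM2l.
have {}H3 : r ^+ 4 * bending (bump eps R0 c) <= (64 / 3 + 128 * eta) * rho ^+ 2 * N.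
  have -> : (64 / 3 + 128 * eta) * rho ^+ 2 * N = r ^+ 4 * ((64 / 3 * R0 ^+ 2 + 128 * eps * R0) * m).
    by rewrite /eps /R0 /N; ring.
  by rewrite ler_pM2l// exprn_gt0.
have k1 : 4 / 3 <= 127 / 19 * rho * (1 / 5 - eta / 2) by rewrite /rho /eta; lra.
have k2 : 64 / 3 + 128 * eta <= 534 / 5 * rho ^+ 2 * (1 / 5 - eta / 2) by rewrite /rho /eta; lra.
have k0 : 0 < 1 / 5 - eta / 2 by rewrite /eta; lra.
split.
- apply: (lt_le_trans _ H1); apply: mulr_gt0 => //; apply: mulr_gt0 => //; exact: exprn_gt0.
- apply: le_trans H2 _; apply: (@le_trans _ _ (127 / 19 * (rho ^+ 4 * (1 / 5 - eta / 2) * N))); last first.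
    by apply: ler_wpM2l; [lra|exact: H1].
  have := ler_wpM2r (mulr_ge0 (exprn_ge0 3 (ltW rho0)) (ltW N0)) k1.
  have -> : 127 / 19 * rho * (1 / 5 - eta / 2) * (rho ^+ 3 * N) = 127 / 19 * (rho ^+ 4 * (1 / 5 - eta / 2) * N) by ring.
  by rewrite mulrA.
- apply: le_trans H3 _; apply: (@le_trans _ _ (534 / 5 * (rho ^+ 4 * (1 / 5 - eta / 2) * N))); last first.
    by apply: ler_wpM2l; [lra|exact: H1].
  have := ler_wpM2r (mulr_ge0 (exprn_ge0 2 (ltW rho0)) (ltW N0)) k2.
  have -> : 534 / 5 * rho ^+ 2 * (1 / 5 - eta / 2) * (rho ^+ 2 * N) = 534 / 5 * (rho ^+ 4 * (1 / 5 - eta / 2) * N) by ring.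
  by rewrite mulrA.
Qed.

End Trial.

(** * Passing quadratic inequalities to the limit in L^2 *)

Section L2Limit.
Context {R : realType}.
Notation mR := (measurableTypeR R).
Notation mu2 := (leb2 R).
Variable Om : set (R * R).
Hypothesis mOm : measurable (Om : set (mR * mR)).
Implicit Types (f g h : R * R -> R) (t d K : R).

Notation sqr f := (\int[mu2]_(p in Om) (f p ^+ 2)%:E)%E.

Lemma measurable_sqr_EFin f : measurable_fun (Om : set (mR * mR)) f ->
  measurable_fun (Om : set (mR * mR)) (fun p => (f p ^+ 2)%:E).
Proof. by move=> mf; apply/measurable_EFinP; exact: measurable_funX. Qed.

Lemma integral_sqr_ge0 f : (0 <= sqr f)%E.
Proof. by apply: integral_ge0 => p _; rewrite lee_fin sqr_ge0. Qed.

(** Young's inequality with weight t, a substitute for the triangle inequality that involves squared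
    norms only. *)
Lemma integral_sqr_le f g t : 0 < t ->
  measurable_fun (Om : set (mR * mR)) f -> measurable_fun (Om : set (mR * mR)) g ->
  (sqr f <= (1 + t)%:E * sqr g + (1 + t^-1)%:E * sqr (fun p => (f p - g p)%R))%E.
Proof.
move=> t0 mf mg.
have t1 : 0 <= 1 + t by rewrite addr_ge0// ltW.
have t2 : 0 <= 1 + t^-1 by rewrite addr_ge0// invr_ge0 ltW.
have ms := measurable_sqr_EFin (measurable_funB mf mg).
have mgs := measurable_sqr_EFin mg.
rewrite -!ge0_integralZl//; try by move=> p _; rewrite lee_fin sqr_ge0.
rewrite -ge0_integralD//; last 4 first.
- by move=> p _; rewrite mule_ge0// lee_fin sqr_ge0.
- by apply: measurable_funeM.
- by move=> p _; rewrite mule_ge0// lee_fin sqr_ge0.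
- by apply: measurable_funeM.
apply: ge0_le_integral => //.
- by move=> p _; rewrite lee_fin sqr_ge0.
- exact: measurable_sqr_EFin.
- by apply: emeasurable_funD; apply: measurable_funeM.
move=> p _; rewrite -!EFinM -EFinD lee_fin -subr_ge0.
have tn0 : t != 0 by rewrite gt_eqF.
have -> : (1 + t) * g p ^+ 2 + (1 + t^-1) * (f p - g p) ^+ 2 - f p ^+ 2 =
  t^-1 * (t * g p - (f p - g p)) ^+ 2 by field.
by rewrite mulr_ge0 ?sqr_ge0// invr_ge0 ltW.
Qed.

Let cvg_small (e : nat -> \bar R) d : 0 < d -> e n @[n --> \oo] --> 0%E ->
  \forall n \near \oo, (e n <= d%:E)%E.
Proof.
move=> d0 /fine_cvgP[fin /cvgrPdist_lt/(_ _ d0) h].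
near=> n; have fn : e n \is a fin_num by near: n.
rewrite -(fineK fn) lee_fin ltW// (le_lt_trans (ler_norm _))//.
by rewrite -normrN -sub0r; near: n.
Unshelve. all: by end_near. Qed.

(** The approximation error d is sent to 0 first, then the weight t. The two functions on the right
    serve for the two components of a gradient; for the Laplacian the second one is 0. *)
Lemma L2_limit_le K (f g h : R * R -> R) (u v w : nat -> R * R -> R) : 0 <= K ->
  L2 Om f -> L2 Om g -> L2 Om h ->
  (forall n, measurable_fun (Om : set (mR * mR)) (u n)) ->
  (forall n, measurable_fun (Om : set (mR * mR)) (v n)) ->
  (forall n, measurable_fun (Om : set (mR * mR)) (w n)) ->
  sqr (fun p => u n p - f p)%R @[n --> \oo] --> 0%E ->
  sqr (fun p => v n p - g p)%R @[n --> \oo] --> 0%E ->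
  sqr (fun p => w n p - h p)%R @[n --> \oo] --> 0%E ->
  (forall n, (K%:E * sqr (u n) <= sqr (v n) + sqr (w n))%E) ->
  (K%:E * sqr f <= sqr g + sqr h)%E.
Proof.
move=> K0 [mf If] [mg Ig] [mh Ih] mu_ mv mw cu cv cw H.
have fin k : L2 Om k -> sqr k \is a fin_num.
  by case=> mk Ik; have := integrable_fin_num mOm Ik.
have Ff := fin _ (conj mf If); have Fg := fin _ (conj mg Ig); have Fh := fin _ (conj mh Ih).
rewrite -(fineK Ff) -(fineK Fg) -(fineK Fh) -EFinM -EFinD lee_fin.
set F := fine (sqr f); set G := fine (sqr g); set W := fine (sqr h).
have F0 : 0 <= F by rewrite fine_ge0// integral_sqr_ge0.
have G0 : 0 <= G by rewrite fine_ge0// integral_sqr_ge0.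
have W0 : 0 <= W by rewrite fine_ge0// integral_sqr_ge0.
have key t d : 0 < t -> 0 < d ->
    K * F <= (1 + t) * ((1 + t) * (G + W) + 2 * (1 + t^-1) * d) + K * ((1 + t^-1) * d).
  move=> t0 d0.
  have t1 : 0 <= 1 + t by rewrite addr_ge0// ltW.
  have t2 : 0 <= 1 + t^-1 by rewrite addr_ge0// invr_ge0 ltW.
  have [n [en en' en'']] : exists n, [/\ (sqr (fun p => u n p - f p)%R <= d%:E)%E,
      (sqr (fun p => v n p - g p)%R <= d%:E)%E & (sqr (fun p => w n p - h p)%R <= d%:E)%E].
    near \oo => n; exists n; split; near: n; exact: cvg_small.
  have step (k l : R * R -> R) (c : R) : 0 <= c -> measurable_fun (Om : set (mR * mR)) k -> measurable_fun (Om : set (mR * mR)) l ->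
      (sqr l = c%:E)%E -> (sqr (fun p => (k p - l p)%R) <= d%:E)%E ->
      (sqr k <= ((1 + t) * c + (1 + t^-1) * d)%:E)%E.
    move=> c0 mk ml lc kl; apply: (le_trans (integral_sqr_le t0 mk ml)).
    by rewrite lc [leRHS]EFinD !EFinM leeD2l// lee_wpmul2l// lee_fin.
  have hv := step _ _ _ G0 (mv n) mg (esym (fineK Fg)) en'.
  have hw := step _ _ _ W0 (mw n) mh (esym (fineK Fh)) en''.
  have hu := le_trans (H n) (leeD hv hw).
  have sym : (sqr (fun p => (f p - u n p)%R) <= d%:E)%E.
    apply: le_trans en; rewrite le_eqVlt; apply/orP; left; apply/eqP.
    by apply: eq_integral => p _; congr EFin; ring.
  have fu := integral_sqr_le t0 mf (mu_ n).
  have : (K%:E * sqr f <= (1 + t)%:E * (K%:E * sqr (u n)) + K%:E * ((1 + t^-1) * d)%:E)%E.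
    apply: (@le_trans _ _ (K%:E * ((1 + t)%:E * sqr (u n) + ((1 + t^-1) * d)%:E))%E).
      rewrite lee_wpmul2l ?lee_fin//; apply: le_trans fu _.
      by rewrite leeD2l// EFinM lee_wpmul2l// lee_fin.
    rewrite ge0_muleDr; last 2 first.
    - by rewrite mule_ge0 ?integral_sqr_ge0.
    - by rewrite lee_fin mulr_ge0// ltW.
    by rewrite muleCA.
  have : ((1 + t)%:E * (K%:E * sqr (u n)) <= (1 + t)%:E * ((1 + t) * G + (1 + t^-1) * d + ((1 + t) * W + (1 + t^-1) * d))%:E)%E.
    by rewrite lee_wpmul2l ?lee_fin.
  move=> h1 h2; have := le_trans h2 (leeD h1 (lexx _)).
  rewrite -[in X in (X <= _)%E](fineK Ff) -/F -!EFinM -EFinD lee_fin.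
  by clear - mOm; lra.
have key2 t : 0 < t -> K * F <= (1 + t) ^+ 2 * (G + W).
  move=> t0; apply/ler_addgt0Pr => e e0.
  have i0 : 0 < t^-1 by rewrite invr_gt0.
  pose c := (1 + t) * (2 * (1 + t^-1)) + K * (1 + t^-1).
  have c0 : 0 < c by rewrite /c; move: t0 i0 K0 (mulr_ge0 K0 (ltW i0)) (mulr_gt0 t0 i0); clear - mOm; lra.
  have d0 : 0 < e / c by rewrite divr_gt0.
  have := key t (e / c) t0 d0.
  have : c * (e / c) = e by rewrite mulrC divfK// gt_eqF.
  by move: (e / c) => d; rewrite /c; clear - mOm; lra.
apply/ler_addgt0Pr => e e0.
pose S := G + W; have S0 : 0 <= S by exact: addr_ge0.
pose t := e / (3 * (S + 1) + e).
have D0 : 0 < 3 * (S + 1) + e by move: S0 e0; clear - mOm; lra.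
have t0 : 0 < t by rewrite divr_gt0.
have tD : t * (3 * (S + 1) + e) = e by rewrite /t divfK// gt_eqF.
have t1 : t <= 1 by rewrite /t ler_pdivrMr// mul1r; move: S0 e0; clear - mOm; lra.
have := key2 t t0; rewrite -/S.
have tS : 0 <= t * S by rewrite mulr_ge0// ltW.
have tt : t * (t * S) <= t * S by rewrite ler_piMl.
by move: t0 tS tt tD t1 S0 (mulr_gt0 t0 e0); clear - mOm; lra.
Unshelve. all: by end_near. Qed.

End L2Limit.

(** * Bounding the eigenvalue by means of test functions *)

Section GammaBounds.
Context {R : realType}.
Notation mR := (measurableTypeR R).
Notation mu2 := (leb2 R).
Implicit Types (Om : set (R * R)) (phi psi : R * R -> R).

Lemma rayleigh_ge0 Om (tau : R) v D : 0 <= tau -> 0 <= rayleigh Om tau v D.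
Proof.
move=> t0; rewrite /rayleigh divr_ge0//; last by apply: Rintegral_ge0 => p _; exact: sqr_ge0.
rewrite addr_ge0//; first by apply: Rintegral_ge0 => p _; exact: sqr_ge0.
by rewrite mulr_ge0//; apply: Rintegral_ge0 => p _; apply: sumr_ge0 => i _; exact: sqr_ge0.
Qed.

Lemma test_function_by_parts phi psi (i : 'I_2) M : smooth phi -> smooth psi ->
  (forall s, box_supp M (partials s psi)) -> continuous phi ->
  \int[mu2]_p (phi p * partials [:: i] psi p) = - \int[mu2]_p (partials [:: i] phi p * psi p).
Proof.
move=> sphi spsi bpsi cphi.
have := @Rintegral_by_parts R i M psi phi (partials [:: i] psi) (partials [:: i] phi)
  (smooth_continuous (s := [::]) spsi) cphi (smooth_continuous spsi) (smooth_continuous sphi)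
  (bpsi [::]) (bpsi [:: i]) (fun p => smooth_is_derive [::] i p spsi) (fun p => smooth_is_derive [::] i p sphi).
under eq_Rintegral do rewrite mulrC.
by move=> ->; congr (- _); apply: eq_Rintegral => p _; rewrite mulrC.
Qed.

Lemma test_function_H20 Om phi : measurable (Om : set (mR * mR)) -> test_function Om phi ->
  H20 Om phi (fun s => partials s phi).
Proof.
move=> mOm tphi; have sphi : smooth phi by case: tphi.
have [M bM] := test_function_box tphi.
split; last first.
  exists (fun _ => phi); split => // s _.
  rewrite (_ : (fun _ => _) = fun=> 0%E); first exact: cvg_cst.
  apply/funext => n; rewrite (eq_integral (cst 0%E)) ?integral0// => p _.
  by rewrite subrr expr0n.
split => // s ss; split.
  split; first by apply: measurable_funTS; apply: continuous_measurable2; exact: smooth_continuous.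
  apply: (integrableS measurableT) => //.
  by have := integrable_partials2 sphi bM s s; apply: eq_integrable => // p _ /=; rewrite expr2.
move=> psi tpsi; have spsi : smooth psi by case: tpsi.
have [N bN] := test_function_box tpsi.
rewrite (@Rintegral_supp _ _ _ mu2 Om); last by move=> p /(test_function_supp s tpsi) ->; rewrite mulr0.
rewrite (@Rintegral_supp _ _ _ mu2 Om (fun p => partials s phi p * psi p)); last first.
  by move=> p /(test_function_supp [::] tpsi) /= ->; rewrite mulr0.
case: s ss => [|i [|j [|//]]] _.
- by rewrite expr0 mul1r.
- by rewrite expr1 mulN1r (test_function_by_parts i sphi spsi bN)//; exact: (smooth_continuous (s := [::])).
- rewrite /= -signr_odd expr0 mul1r.
  have sj : smooth (partials [:: j] psi) by exact: smooth_partials.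
  have bj l : box_supp N (partials l (partials [:: j] psi)) by rewrite -partials_cat.
  have si : smooth (partials [:: i] phi) by exact: smooth_partials.
  have := test_function_by_parts i sphi sj bj (smooth_continuous (s := [::]) sphi).
  rewrite /= => ->; rewrite (test_function_by_parts j si spsi bN (smooth_continuous (s := [::]) si)) opprK.
  by have -> : partials [:: j] (partials [:: i] phi) = partials [:: i; j] phi := partials_swap [::] [::] j i sphi.
Qed.

Lemma mass_gt0_not_ae Om phi : measurable (Om : set (mR * mR)) -> test_function Om phi ->
  0 < mass phi -> ~ {ae mu2, forall p, Om p -> phi p = 0}.
Proof.
move=> mOm tphi m0 h; move: m0; rewrite /mass /Rintegral.
have sphi : smooth phi by case: tphi.
have m2 : measurable_fun (Om : set (mR * mR)) (fun p => (phi p ^+ 2)%:E).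
  by apply: measurable_funTS; exact: measurable_sqrE (smooth_continuous (s := [::]) sphi).
rewrite -(@integral_supp _ _ _ mu2 Om); last first.
  by move=> p /(test_function_supp [::] tphi) /= ->; rewrite expr0n.
rewrite (ae_eq_integral (cst 0%E))//; first by rewrite integral0/= ltxx.
apply: (@filterS _ _ (ae_filter_ringOfSetsType mu2) _ _ _ h) => p hp /hp /= ->.
by rewrite expr0n.
Qed.

Lemma rayleigh_test_function Om (tau : R) phi : test_function Om phi ->
  rayleigh Om tau phi (fun s => partials s phi) = (bending phi + tau * dirichlet phi) / mass phi.
Proof.
move=> tphi; have z s p : ~ Om p -> partials s phi p = 0 by exact: test_function_supp.
rewrite /rayleigh; congr ((_ + _ * _) / _).
- rewrite Rintegral_supp; last by move=> p /z h; rewrite /laplacian big_ord2 !h addr0 expr0n.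
  by apply: eq_Rintegral => p _; rewrite /laplacian big_ord2.
- rewrite Rintegral_supp; last by move=> p /z h; rewrite /grad_sqr big_ord2 !h expr0n addr0.
  by apply: eq_Rintegral => p _; rewrite /grad_sqr big_ord2.
- rewrite Rintegral_supp// => p /z h; have /= -> := h [::].
  by rewrite expr0n.
Qed.

Lemma Gamma_le Om (tau : R) phi : measurable (Om : set (mR * mR)) -> 0 <= tau ->
  test_function Om phi -> 0 < mass phi ->
  Gamma Om tau <= (bending phi + tau * dirichlet phi) / mass phi.
Proof.
move=> mOm t0 tphi m0; apply: ge_inf.
  by exists 0 => _ [v [D [_ _ ->]]]; exact: rayleigh_ge0.
exists phi, (fun s => partials s phi); split.
- exact: test_function_H20.
- exact: mass_gt0_not_ae.
- by rewrite rayleigh_test_function.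
Qed.

(** The mass and both energies pass to the limit along the approximating sequence of an element of
    H_0^2, so it is enough to test smooth functions. The last hypothesis makes the set of quotients
    nonempty; an empty one would have the default infimum 0. *)
Lemma Gamma_ge Om (tau A B : R) : measurable (Om : set (mR * mR)) -> 0 <= tau -> 0 <= A -> 0 <= B ->
  (forall phi, test_function Om phi -> (A%:E * \int[mu2]_p (phi p ^+ 2)%:E <=
     \int[mu2]_p ((partials [:: i0; i0] phi p + partials [:: i1; i1] phi p) ^+ 2)%:E)%E) ->
  (forall phi, test_function Om phi -> (B%:E * \int[mu2]_p (phi p ^+ 2)%:E <=
     \int[mu2]_p (partials [:: i0] phi p ^+ 2 + partials [:: i1] phi p ^+ 2)%:E)%E) ->
  (exists2 phi, test_function Om phi & 0 < mass phi) ->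
  A + tau * B <= Gamma Om tau.
Proof.
move=> mOm t0 A0 B0 HA HB [phi0 tphi0 m0]; apply: lb_le_inf.
  exists (rayleigh Om tau phi0 (fun s => partials s phi0)), phi0, (fun s => partials s phi0).
  by split => //; [exact: test_function_H20|exact: mass_gt0_not_ae].
move=> _ [v [D [[[Dv HD] [phi [tphi cphi]]] vn0 ->]]].
have L2D s : (size s <= 2)%N -> L2 Om (D s) by move=> /HD[].
have mp n s : measurable_fun (Om : set (mR * mR)) (partials s (phi n)).
  apply: measurable_funTS; apply: continuous_measurable2; apply: smooth_continuous.
  by case: (tphi n).
have supp n (F : (seq 'I_2 -> R) -> R) : F (fun=> 0) = 0 ->
    (\int[mu2]_(p in Om) (F (fun s => partials s (phi n) p))%:E =
     \int[mu2]_p (F (fun s => partials s (phi n) p))%:E)%E.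
  move=> F0; apply: integral_supp => p pO.
  rewrite (_ : (fun s => _) = fun=> 0) ?F0//; apply/funext => s.
  exact: (test_function_supp s (tphi n) pO).
have mD s : (size s <= 2)%N -> measurable_fun (Om : set (mR * mR)) (D s) by move=> /L2D[].
have L2v : L2 Om v by rewrite -Dv; exact: L2D.
have i00 := @L2D [:: i0; i0] isT; have i11 := @L2D [:: i1; i1] isT.
have L2L : L2 Om (laplacian D).
  have E : laplacian D = fun p => D [:: i0; i0] p + D [:: i1; i1] p.
    by apply/funext => p; rewrite /laplacian big_ord2.
  have mL : measurable_fun (Om : set (mR * mR)) (laplacian D).
    by rewrite E; apply: measurable_funD; [case: i00|case: i11].
  split => //.
  have I2 : mu2.-integrable Om (fun p => (2 * D [:: i0; i0] p ^+ 2)%:E + (2 * D [:: i1; i1] p ^+ 2)%:E)%E.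
    by apply: integrableD => //; [have := integrableZl mOm 2 i00.2|have := integrableZl mOm 2 i11.2].
  apply: (le_integrable mOm _ _ I2); first exact: measurable_sqr_EFin.
  move=> p _; rewrite E /= lee_fin (ger0_norm (sqr_ge0 _)) ger0_norm; last first.
    by apply: addr_ge0; apply: mulr_ge0 => //; exact: sqr_ge0.
  by rewrite -subr_ge0 (_ : _ - _ = (D [:: i0; i0] p - D [:: i1; i1] p) ^+ 2) ?sqr_ge0//; ring.
have zero : L2 Om (fun=> 0).
  split; first exact: measurable_cst.
  apply: (eq_integrable mOm _ _ _ (integrable0 _ _)).
  by move=> q _; rewrite /= expr0n.
have sq0 : (\int[mu2]_(p in Om) (((fun=> 0) : R * R -> R) p ^+ 2)%:E = 0)%E.
  by rewrite (eq_integral (cst 0%E)) ?integral0// => p _; rewrite expr0n.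
have cz : (\int[mu2]_(p in Om) ((0 - 0 : R) ^+ 2)%:E)%E @[n --> \oo] --> (0 : \bar R)%E.
  rewrite (_ : (fun _ => _) = fun=> 0%E); first exact: cvg_cst.
  apply/funext => n; rewrite (eq_integral (cst 0%E)) ?integral0// => p _.
  by rewrite subrr expr0n.
have cv0 : (\int[mu2]_(p in Om) ((phi n p - v p) ^+ 2)%:E)%E @[n --> \oo] --> 0%E.
  by have := @cphi [::] isT; rewrite Dv.
have cL : (\int[mu2]_(p in Om) ((partials [:: i0; i0] (phi n) p + partials [:: i1; i1] (phi n) p
    - laplacian D p) ^+ 2)%:E)%E @[n --> \oo] --> 0%E.
  (* The Laplacians converge because (x - y)^2 <= 2 x^2 + 2 y^2 applied to the two pure second
     derivatives. *)
  pose e (i : 'I_2) n := (\int[mu2]_(p in Om) ((partials [:: i; i] (phi n) p - D [:: i; i] p) ^+ 2)%:E)%E.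
  have mdiff (i : 'I_2) n : measurable_fun (Om : set (mR * mR)) (fun p => partials [:: i; i] (phi n) p - D [:: i; i] p).
    by apply: measurable_funB; [exact: mp|exact: mD].
  apply: (@squeeze_cvge _ _ _ _ (fun=> 0%E) _ (fun n => 2%:E * e i0 n + 2%:E * e i1 n)%E); last 2 first.
  - exact: cvg_cst.
  - have ce (i : 'I_2) : (2%:E * e i n)%E @[n --> \oo] --> (2%:E * 0)%E.
      by apply: cvgeZl => //; exact: (@cphi [:: i; i] isT).
    have := cvgeD _ (ce i0) (ce i1); rewrite !mule0 adde0; exact.
  near=> n; apply/andP; split; first by apply: integral_ge0 => p _; rewrite lee_fin sqr_ge0.
  rewrite /e -!ge0_integralZl//; try (by move=> p _; rewrite lee_fin sqr_ge0);
    try exact: measurable_sqr_EFin.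
  rewrite -ge0_integralD//; try (by move=> p _; rewrite mule_ge0// lee_fin sqr_ge0);
    try (by apply: measurable_funeM; exact: measurable_sqr_EFin).
  apply: ge0_le_integral => //.
  - by move=> p _; rewrite lee_fin sqr_ge0.
  - apply: measurable_sqr_EFin; apply: measurable_funB; last by case: L2L.
    by apply: measurable_funD; exact: mp.
  - by apply: emeasurable_funD; apply: measurable_funeM; exact: measurable_sqr_EFin.
  move=> p _; rewrite -!EFinM -EFinD lee_fin /laplacian big_ord2 -subr_ge0.
  move: (partials [:: i0; i0] _ p) (partials [:: i1; i1] _ p) (D [:: i0; i0] p) (D [:: i1; i1] p) => a b a' b'.
  by rewrite (_ : _ - _ = ((a - a') - (b - b')) ^+ 2) ?sqr_ge0//; ring.
have keyA := @L2_limit_le R Om mOm A v (laplacian D) (fun=> 0) phi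
  (fun n p => partials [:: i0; i0] (phi n) p + partials [:: i1; i1] (phi n) p) (fun _ _ => 0)
  A0 L2v L2L zero (fun n => mp n [::]) (fun n => measurable_funD (mp n [:: i0; i0]) (mp n [:: i1; i1]))
  (fun n => measurable_cst _) cv0 cL cz.
have {}keyA : (A%:E * \int[mu2]_(p in Om) (v p ^+ 2)%:E <= \int[mu2]_(p in Om) (laplacian D p ^+ 2)%:E)%E.
  rewrite sq0 adde0 in keyA; apply: keyA => n; rewrite adde0.
  rewrite (supp n (fun P => P [::] ^+ 2)) ?expr0n//.
  by rewrite (supp n (fun P => (P [:: i0; i0] + P [:: i1; i1]) ^+ 2)) ?addr0 ?expr0n//; exact: (HA _ (tphi n)).
have gradE n : (\int[mu2]_(p in Om) (partials [:: i0] (phi n) p ^+ 2)%:E +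
    \int[mu2]_(p in Om) (partials [:: i1] (phi n) p ^+ 2)%:E =
    \int[mu2]_(p in Om) (partials [:: i0] (phi n) p ^+ 2 + partials [:: i1] (phi n) p ^+ 2)%:E)%E.
  rewrite -ge0_integralD//; try (by move=> p _; rewrite lee_fin sqr_ge0).
  - by apply: measurable_sqr_EFin; exact: mp.
  - by apply: measurable_sqr_EFin; exact: mp.
have keyB := @L2_limit_le R Om mOm B v (D [:: i0]) (D [:: i1]) phi
  (fun n => partials [:: i0] (phi n)) (fun n => partials [:: i1] (phi n))
  B0 L2v (@L2D [:: i0] isT) (@L2D [:: i1] isT) (fun n => mp n [::]) (fun n => mp n [:: i0]) (fun n => mp n [:: i1])
  cv0 (@cphi [:: i0] isT) (@cphi [:: i1] isT).
have {}keyB : (B%:E * \int[mu2]_(p in Om) (v p ^+ 2)%:E <= \int[mu2]_(p in Om) (grad_sqr D p)%:E)%E.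
  have -> : (\int[mu2]_(p in Om) (grad_sqr D p)%:E =
      \int[mu2]_(p in Om) (D [:: i0] p ^+ 2)%:E + \int[mu2]_(p in Om) (D [:: i1] p ^+ 2)%:E)%E.
    rewrite -ge0_integralD//; try (by move=> p _; rewrite lee_fin sqr_ge0).
    - by apply: eq_integral => p _; rewrite /grad_sqr big_ord2.
    - by apply: measurable_sqr_EFin; exact: mD.
    - by apply: measurable_sqr_EFin; exact: mD.
  apply: keyB => n; rewrite gradE (supp n (fun P => P [::] ^+ 2)) ?expr0n//.
  by rewrite (supp n (fun P => P [:: i0] ^+ 2 + P [:: i1] ^+ 2)) ?expr0n ?addr0//; exact: (HB _ (tphi n)).
have Nfin : (\int[mu2]_(p in Om) (v p ^+ 2)%:E)%E \is a fin_num.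
  by have := integrable_fin_num mOm L2v.2.
have Lfin : (\int[mu2]_(p in Om) (laplacian D p ^+ 2)%:E)%E \is a fin_num.
  by have := integrable_fin_num mOm L2L.2.
have Gfin : (\int[mu2]_(p in Om) (grad_sqr D p)%:E)%E \is a fin_num.
  have I2 : mu2.-integrable Om (fun p => (D [:: i0] p ^+ 2)%:E + (D [:: i1] p ^+ 2)%:E)%E.
    by apply: integrableD => //; [exact: (@L2D [:: i0] isT).2|exact: (@L2D [:: i1] isT).2].
  have -> : (\int[mu2]_(p in Om) (grad_sqr D p)%:E =
      \int[mu2]_(p in Om) ((D [:: i0] p ^+ 2)%:E + (D [:: i1] p ^+ 2)%:E))%E.
    by apply: eq_integral => p _; rewrite /grad_sqr big_ord2 EFinD.
  exact: (integrable_fin_num mOm I2).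
rewrite /rayleigh /Rintegral.
rewrite -(fineK Nfin) -(fineK Lfin) -EFinM lee_fin in keyA.
rewrite -(fineK Nfin) -(fineK Gfin) -EFinM lee_fin in keyB.
have N0 : 0 < fine (\int[mu2]_(p in Om) (v p ^+ 2)%:E)%E.
  rewrite lt_neqAle fine_ge0 ?integral_sqr_ge0// andbT; apply/eqP => N0.
  apply: vn0; have mv2 := measurable_sqr_EFin L2v.1.
  have /(ae_eq_integral_abs mu2 mOm mv2) : (\int[mu2]_(p in Om) `|(v p ^+ 2)%:E| = 0)%E.
    transitivity (\int[mu2]_(p in Om) (v p ^+ 2)%:E)%E; last by rewrite -(fineK Nfin) -N0.
    by apply: eq_integral => p _; rewrite gee0_abs// lee_fin sqr_ge0.
  move=> h; apply: (@filterS _ _ (ae_filter_ringOfSetsType mu2) _ _ _ h) => p hp /hp /= [].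
  by move/eqP; rewrite sqrf_eq0 => /eqP.
rewrite ler_pdivlMr// mulrDl; apply: lerD => //.
by rewrite -mulrA ler_wpM2l.
Unshelve. all: by end_near. Qed.

End GammaBounds.

(** * An upper bound for pi *)

Section PiBound.
Context {R : realType}.
Implicit Types (x y : R).

Lemma is_derive_ge0_le (f df : R -> R) x : 0 <= x ->
  (forall y, is_derive y 1 f (df y)) -> (forall y, 0 <= y -> 0 <= df y) ->
  f 0 <= f x.
Proof.
move=> x0 fdf df0; have [|z] := MVT_segment x0 (fun y _ => fdf y); last first.
  rewrite in_itv/= => /andP[z0 _] e.
  by rewrite -subr_ge0 e subr0 mulr_ge0// df0.
by apply: continuous_in_subspaceT => y _; exact: continuous_is_derive (fdf y).
Qed.

Lemma sin_le x : 0 <= x -> sin x <= x.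
Proof.
move=> x0; have h y := is_derive_sub (is_derive_id y (1 : R)) (is_derive_sin y).
have := is_derive_ge0_le x0 h; rewrite /= sin0 subrr subr_ge0; apply.
by move=> y _; rewrite subr_ge0 cos_le1.
Qed.

Lemma cos_ge_quadratic x : 0 <= x -> 1 - x ^+ 2 / 2 <= cos x.
Proof.
move=> x0; have d y : is_derive y 1 (fun y => cos y + 1 / 2 * y ^+ 2) (y - sin y).
  apply: (is_derive_eq (is_derive_add (is_derive_cos y)
    (is_derive_scal (1 / 2) (is_derive_sqr (is_derive_id y (1 : R)))))).
  by field.
have := is_derive_ge0_le x0 d; rewrite cos0 expr0n/= mulr0 addr0.
suff : forall y, 0 <= y -> 0 <= y - sin y by move=> h /(_ h); lra.
by move=> y y0; rewrite subr_ge0 sin_le.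
Qed.

Lemma sin_ge_cubic x : 0 <= x -> x - x ^+ 3 / 6 <= sin x.
Proof.
move=> x0; have d y : is_derive y 1 (fun y => sin y - (y - 1 / 6 * y ^+ 3))
    (cos y - (1 - y ^+ 2 / 2)).
  have hid := is_derive_id y (1 : R).
  apply: (is_derive_eq (is_derive_sub (is_derive_sin y)
    (is_derive_sub hid (is_derive_scal (1 / 6) (is_derive_pow 3 hid))))).
  by rewrite /=; field.
have := is_derive_ge0_le x0 d; rewrite sin0 expr0n/= mulr0 !subr0.
suff : forall y, 0 <= y -> 0 <= cos y - (1 - y ^+ 2 / 2) by move=> h /(_ h); lra.
by move=> y y0; rewrite subr_ge0 cos_ge_quadratic.
Qed.

(** On the interval x^2 lies below its chord, which turns the cubic into a quadratic. *)
Let cubic_gt_half x : 21 / 40 < x -> x < 2 / 3 -> 1 / 2 < x - x ^+ 3 / 6.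
Proof.
move=> h1 h2; have h : 0 < (x - 21 / 40) * (2 / 3 - x).
  by apply: mulr_gt0; lra.
have {}h : x ^+ 2 <= (143 / 120) * x - 7 / 20 by rewrite expr2; lra.
have x0 : 0 <= x by lra.
have := ler_wpM2l x0 h; rewrite -exprS => h3; have : x * x = x ^+ 2 by [].
lra.
Qed.

(* [1 = sin (3 * (pi / 6))] is a cubic equation for [s = sin (pi / 6)],
   which forces [s = 1 / 2]. *)
Lemma pi_le : pi <= 63 / 20 :> R.
Proof.
set x : R := pi / 6; suff : x <= 21 / 40 by rewrite /x; lra.
have x0 : 0 < x by rewrite divr_gt0 ?pi_gt0.
have x1 : x < 2 / 3 by have := @pihalf_lt2 R; rewrite /x; lra.
rewrite leNgt; apply/negP => xh.
have hs := sin_ge_cubic (ltW x0).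
have s2 : 1 / 2 < sin x by apply: lt_le_trans hs; exact: cubic_gt_half.
have := @sin_pihalf R; have -> : pi / 2 = x + x + x by rewrite /x; field.
rewrite sinD sinD cosD; have c2 : cos x ^+ 2 = 1 - sin x ^+ 2.
  by rewrite -(cos2Dsin2 x) addrK.
move=> e; have : (sin x + 1) * (2 * sin x - 1) ^+ 2 = 0.
  transitivity (1 - (3 * sin x * (1 - sin x ^+ 2) - sin x ^+ 3)); first by ring.
  by rewrite -c2; apply/eqP; rewrite subr_eq0 eq_sym; apply/eqP/(etrans _ e); ring.
by move/eqP; rewrite mulf_eq0 sqrf_eq0 => /orP[]/eqP; move: s2; lra.
Qed.

End PiBound.

(** * Partial sums of the Bessel series *)

Section BesselSeries.
Context {R : realType}.
Implicit Types (n k : nat) (t u x : R).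

Definition bterm n u k : R := u ^+ k / (k`! * (k + n)`!)%:R.

(* [besselJ n x = (x / 2) ^+ n * bsum n (- (x / 2) ^+ 2)], and likewise for
   [besselI] with the opposite sign. *)
Definition bsum n u : R := limn (series (bterm n u)).

Lemma is_cvg_bsum n u : cvgn (series (bterm n u)).
Proof.
apply: normed_cvg.
apply: (@series_le_cvg R _ (exp_coeff `|u|)); last exact: is_cvg_series_exp_coeff.
- by move=> k; exact: normr_ge0.
- by move=> k; apply: exp_coeff_ge0.
move=> k; rewrite /= normrM normrX ler_wpM2l ?exprn_ge0// normfV.
rewrite ger0_norm// lef_pV2 ?posrE ?ltr0n ?muln_gt0 ?fact_gt0// ler_nat.
by rewrite leq_pmulr ?fact_gt0.
Qed.

Lemma besselJE n x : besselJ n x = (x / 2) ^+ n * bsum n (- (x / 2) ^+ 2).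
Proof.
rewrite /bsum -[_ * _](lim_seriesZ _ (@is_cvg_bsum n _)) /besselJ.
congr (limn (series _)); apply/funext => k.
rewrite -[RHS]/(_ * _) /bterm exprD exprM (exprNn ((x / 2) ^+ 2)).
by move: (_ ^+ k) (_ ^+ k) (_ ^+ n) (_%:R) => a b c d; ring.
Qed.

Lemma besselIE n x : besselI n x = (x / 2) ^+ n * bsum n ((x / 2) ^+ 2).
Proof.
rewrite /bsum -[_ * _](lim_seriesZ _ (@is_cvg_bsum n _)) /besselI.
congr (limn (series _)); apply/funext => k.
rewrite -[RHS]/(_ * _) /bterm exprD exprM.
by move: (_ ^+ k) (_ ^+ n) (_%:R) => a b d; ring.
Qed.

Lemma btermS n u k : bterm n u k.+1 = bterm n u k * (u / (k.+1 * (k + n).+1)%:R).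
Proof.
rewrite /bterm addSn !factS exprSr mulf_div -natrM; congr (_ / _%:R); lia.
Qed.

Lemma bterm_ge0 n u k : 0 <= u -> 0 <= bterm n u k.
Proof. by move=> u0; rewrite divr_ge0// exprn_ge0. Qed.

Lemma bterm_le n u k m : 0 <= u -> u * m%:R <= (k.+1 * (k + n).+1)%:R ->
  bterm n u k.+1 * m%:R <= bterm n u k.
Proof.
move=> u0 h; rewrite btermS -mulrA -[leRHS]mulr1 ler_wpM2l ?bterm_ge0//.
by rewrite mulrAC ler_pdivrMr ?mul1r// ltr0n.
Qed.

Lemma bsum_ge n u m c : (forall k, c <= \sum_(0 <= i < m + k) bterm n u i) ->
  c <= bsum n u.
Proof.
move=> h; apply: limr_ge; first exact: is_cvg_bsum.
exists m => // k /= mk; rewrite /series/= -(subnKC mk); exact: h.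
Qed.

Lemma bsum_le n u m c : (forall k, \sum_(0 <= i < m + k) bterm n u i <= c) ->
  bsum n u <= c.
Proof.
move=> h; apply: limr_le; first exact: is_cvg_bsum.
exists m => // k /= mk; rewrite /series/= -(subnKC mk); exact: h.
Qed.

Lemma bsum_ge_partial n t m : 0 <= t ->
  \sum_(0 <= i < m) bterm n t i <= bsum n t.
Proof.
move=> t0; apply: (@bsum_ge _ _ m) => k; rewrite [leRHS](big_cat_nat (n := m))//= ?leq_addr//.
by rewrite lerDl sumr_ge0// => i _; exact: bterm_ge0.
Qed.

(** From index m on the terms decrease in absolute value, since t <= m + 1, and after an even number
    of them the alternating remainder is nonnegative. *)
Lemma bsum_alternating_ge n t m : 0 <= t -> ~~ odd m -> t <= m.+1%:R ->
  \sum_(0 <= i < m) bterm n (- t) i <= bsum n (- t).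
Proof.
move=> t0 m2 tm.
have alt k : bterm n (- t) (m + k) = (-1) ^+ k * bterm n t (m + k).
  by rewrite /bterm (exprNn t) -(signr_odd _ (m + k)) oddD (negbTE m2) signr_odd mulrA.
apply: (@bsum_ge _ _ m) => k.
(* For odd k the last term added is positive and is kept in reserve to pay for the next one. *)
suff : \sum_(0 <= i < m) bterm n (- t) i + (odd k)%:R * bterm n t (m + k) <=
    \sum_(0 <= i < m + k) bterm n (- t) i.
  by apply: le_trans; rewrite lerDl mulr_ge0 ?bterm_ge0.
elim: k => [|k IH]; first by rewrite mul0r !addn0 addr0.
rewrite addnS big_nat_recr//= alt; apply: le_trans (lerD IH (lexx _)).
have : bterm n t (m + k).+1 <= bterm n t (m + k).
  rewrite -[leLHS]mulr1 (@bterm_le _ _ _ 1)// mulr1 (le_trans tm)// ler_nat.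
  by apply: leq_trans (leq_pmulr _ _); rewrite ?ltnS ?leq_addr.
have := bterm_ge0 n (m + k) t0.
by rewrite -signr_odd; case: (odd k) => /=; rewrite ?expr1 ?expr0 ?mul0r ?mul1r ?mulN1r; lra.
Qed.

(** From index m on each term is at most half of the previous one, so the tail is at most twice its
    first term. *)
Lemma bsum_le_partial n t m : 0 <= t -> t * 2 <= m.+1%:R ->
  bsum n t <= \sum_(0 <= i < m) bterm n t i + 2 * bterm n t m.
Proof.
move=> t0 tm; apply: (@bsum_le _ _ m) => k.
suff : \sum_(0 <= i < m + k) bterm n t i + 2 * bterm n t (m + k) <=
    \sum_(0 <= i < m) bterm n t i + 2 * bterm n t m.
  by apply: le_trans; rewrite lerDl mulr_ge0 ?bterm_ge0.
elim: k => [|k IH]; first by rewrite addn0.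
rewrite addnS big_nat_recr//=; apply: le_trans IH.
have : bterm n t (m + k).+1 * 2 <= bterm n t (m + k).
  rewrite bterm_le// (le_trans tm)// ler_nat.
  by apply: leq_trans (leq_pmulr _ _); rewrite ?ltnS ?leq_addr.
lra.
Qed.

End BesselSeries.

(** * A lower bound for the constant of the theorem *)

Section PlateZero.
Context {R : realType}.
Implicit Types (n k : nat) (t u x g : R).

Let bsum6E n u : n = 0%N \/ n = 1%N -> \sum_(0 <= i < 6) bterm n u i =
  if n == 0%N then 1 + u + u ^+ 2 / 4 + u ^+ 3 / 36 + u ^+ 4 / 576 + u ^+ 5 / (120 * 120)
  else 1 + u / 2 + u ^+ 2 / 12 + u ^+ 3 / (6 * 24) + u ^+ 4 / (24 * 120) + u ^+ 5 / (120 * 720).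
Proof.
rewrite big_mkord !big_ord_recr big_ord0 /= !btermS => -[->|->];
by rewrite /bterm /= !fact0 ?fact1 ?mul1n ?add0n ?addn0 ?addn1 !expr0 !natrM; field.
Qed.

(* The product of the alternating partial sums of [bsum 1 (- t)] and
   [bsum 0 (- t)] with bounds for [bsum 0 t] and [bsum 1 t]. *)
Let cross_polynomial t :
  (1 - t / 2 + t ^+ 2 / 12 - t ^+ 3 / 144 + t ^+ 4 / 2880 - t ^+ 5 / (120 * 720)) *
  (1 + t + t ^+ 2 / 4 + t ^+ 3 / 36 + t ^+ 4 / 576) +
  (1 - t + t ^+ 2 / 4 - t ^+ 3 / 36 + t ^+ 4 / 576 - t ^+ 5 / (120 * 120)) *
  (1 + t / 2 + t ^+ 2 / 12 + t ^+ 3 / 144 + t ^+ 4 / 2880 + 2 * t ^+ 5 / (120 * 720)) =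
  2 - t ^+ 2 / 3 + t ^+ 4 * (1 / 240 - t / (144 * 120) + t ^+ 2 / (360 * 360)
    - t ^+ 3 / (480 * 720) - t ^+ 4 / (80 * 72 * 720)
    - t ^+ 5 / (120 * 120 * 144 * 120) - t ^+ 6 / (120 * 720 * 120 * 60)).
Proof. by field. Qed.

Let pow_le t k (d : R) : 0 <= t -> t <= 63 / 25 -> (63 / 25) ^+ k <= d -> t ^+ k <= d.
Proof. by move=> t0 t1; apply: le_trans; rewrite lerXn2r// nnegrE; lra. Qed.

Let cross_pos t : 0 <= t -> t <= 63 / 25 ->
  0 < 2 - t ^+ 2 / 3 + t ^+ 4 * (1 / 240 - t / (144 * 120) + t ^+ 2 / (360 * 360)
    - t ^+ 3 / (480 * 720) - t ^+ 4 / (80 * 72 * 720)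
    - t ^+ 5 / (120 * 120 * 144 * 120) - t ^+ 6 / (120 * 720 * 120 * 60)).
Proof.
move=> t0 t1.
have h2 : t ^+ 2 <= 6351 / 1000 by apply: pow_le => //; lra.
have h3 : t ^+ 3 <= 17 by apply: pow_le => //; lra.
have h4 : t ^+ 4 <= 41 by apply: pow_le => //; lra.
have h5 : t ^+ 5 <= 102 by apply: pow_le => //; lra.
have h6 : t ^+ 6 <= 257 by apply: pow_le => //; lra.
have s0 := sqr_ge0 t.
set w := (X in t ^+ 4 * X); have hw : 39 / (100 * 100) <= w by rewrite /w; lra.
(* This is the tangent to s |-> s^2 near s = t^2 = 6.35, close to the right end of the range, where
   the margin is smallest. *)
have hs : 127 / 10 * t ^+ 2 - 4033 / 100 <= t ^+ 4.
  rewrite -subr_ge0; have -> : t ^+ 4 = t ^+ 2 * t ^+ 2 by rewrite -exprD.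
  by have := sqr_ge0 (t ^+ 2 - 635 / 100); rewrite expr2; lra.
have := ler_wpM2l (exprn_ge0 4 t0) hw; move: (w) => v; lra.
Qed.

Let factor_pos t : 0 <= t -> t <= 63 / 25 ->
  0 < 1 - t / 2 + t ^+ 2 / 12 - t ^+ 3 / 144 + t ^+ 4 / 2880 - t ^+ 5 / (120 * 720).
Proof.
move=> t0 t1.
have h3 : t ^+ 3 <= 63 / 25 * t ^+ 2 by rewrite exprS ler_wpM2r ?exprn_ge0.
have h5 : t ^+ 5 <= 63 / 25 * t ^+ 4 by rewrite exprS ler_wpM2r ?exprn_ge0.
have h4 : 0 <= t ^+ 4 by rewrite exprn_ge0.
have := sqr_ge0 (t - 38 / 10); have : t * t = t ^+ 2 by [].
rewrite [(t - _) ^+ 2]expr2; lra.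
Qed.

(** In the application b is a value of J_0, which changes sign in the range. If b is nonnegative
    there is nothing more to estimate; if it is negative, C is replaced by its upper bound. *)
Let cross_gt0 (a a' b b' A A' C C' : R) : 0 < a' -> a' <= a -> b' <= b ->
  0 < A' -> A' <= A -> 0 < C -> C <= C' -> 0 < a' * A' + b' * C' ->
  0 < a * A + b * C.
Proof.
move=> a0 aa bb A0 AA C0 CC p.
have h1 : a' * A' <= a * A by rewrite ler_pM// ltW.
have [b0|b0] := leP 0 b; first by have := mulr_gt0 a0 A0; have := mulr_ge0 b0 (ltW C0); lra.
have h2 : b * C' <= b * C by rewrite ler_nM2l.
have C0' := lt_le_trans C0 CC.
have h3 : b' * C' <= b * C' by rewrite ler_pM2r.
lra.
Qed.

(** Up to the factor x / 2 with x = 2 sqrt t, this is J_1(x) I_0(x) + J_0(x) I_1(x). It first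
    vanishes at t = gamma_0^2 / 4, about 2.554, just above 63/25. *)
Lemma bessel_cross_gt0 t : 0 < t -> t <= 63 / 25 ->
  0 < bsum 1 (- t) * bsum 0 t + bsum 0 (- t) * bsum 1 t.
Proof.
move=> t0 t1; have t0' := ltW t0.
have a := @bsum_alternating_ge R 1 t 6 t0' isT.
have b := @bsum_alternating_ge R 0 t 6 t0' isT.
have A := @bsum_ge_partial R 0 t 6 t0'.
have C := @bsum_ge_partial R 1 t 6 t0'.
have C' := @bsum_le_partial R 1 t 5 t0'.
have S5 n : \sum_(0 <= i < 5) bterm n t i + 2 * bterm n t 5 =
    \sum_(0 <= i < 6) bterm n t i + bterm n t 5.
  by rewrite [in RHS]big_nat_recr//= mulr_natl mulr2n addrA.
have b5 : bterm 1 t 5 = t ^+ 5 / (120 * 720).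
  by rewrite /bterm natrM; congr (_ / (_ * _)).
have t6 : t <= 7 by lra.
have t3 : t * 2 <= 6 by lra.
move: {a b C'} (a t6) (b t6) A C (C' t3); rewrite S5 b5 !bsum6E/=; [|by auto..].
have neg5 : (- t) ^+ 5 = - t ^+ 5 by rewrite exprNn; ring.
have neg3 : (- t) ^+ 3 = - t ^+ 3 by rewrite exprNn; ring.
have neg4 : (- t) ^+ 4 = t ^+ 4 by rewrite exprNn; ring.
rewrite neg5 neg3 neg4 sqrrN.
move: (bsum 1 (- t)) (bsum 0 (- t)) (bsum 0 t) (bsum 1 t) => a b A C ha hb hA hC hC'.
have p1 := t0'; have p2 := exprn_ge0 2 t0'; have p3 := exprn_ge0 3 t0'.
have p4 := exprn_ge0 4 t0'; have p5 := exprn_ge0 5 t0'.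
have := cross_pos t0' t1; rewrite -cross_polynomial.
apply: cross_gt0; first exact: factor_pos.
all: move: p1 p2 p3 p4 p5 ha hb hA hC hC'; clear; lra.
Qed.

Let ratio_pos t : 63 / 25 <= t -> 0 <= - (13 / 10) - 3 / 10 * t + 7 / 40 * t ^+ 2
  + 17 / 360 * t ^+ 3 + 27 / (576 * 10) * t ^+ 4 + 37 / (144 * 1000) * t ^+ 5.
Proof.
move=> ht; have t0 : 0 <= t by lra.
have h2 : 63 / 25 * t <= t ^+ 2 by rewrite expr2 ler_wpM2r.
have h3 : 63 / 25 * t ^+ 2 <= t ^+ 3 by rewrite [leRHS]exprS ler_wpM2r ?exprn_ge0.
have h4 : 63 / 25 * t ^+ 3 <= t ^+ 4 by rewrite [leRHS]exprS ler_wpM2r ?exprn_ge0.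
have h5 : 63 / 25 * t ^+ 4 <= t ^+ 5 by rewrite [leRHS]exprS ler_wpM2r ?exprn_ge0.
lra.
Qed.

Let shift_term t k : t * bterm 1 t k = k.+1%:R * bterm 0 t k.+1.
Proof.
rewrite btermS addn0 mulrCA [_ * (t / _)]mulrC.
rewrite /bterm addn0 addn1 factS !natrM.
have : k.+1%:R != 0 :> R by rewrite pnatr_eq0.
have : k`!%:R != 0 :> R by rewrite pnatr_eq0 -lt0n fact_gt0.
move: (k.+1%:R) (k`!%:R) (t ^+ k) => p q w q0 p0; field.
by rewrite q0 p0.
Qed.

(** As t * bterm 1 t k = (k + 1) * bterm 0 t (k + 1), the right-hand side is the sum of i * bterm 0
    t i. Only the indices 0 and 1 are below 1.3, and the next four terms outweigh them once t >=
    63/25. *)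
Lemma bessel_ratio_ge t : 63 / 25 <= t -> 13 / 10 * bsum 0 t <= t * bsum 1 t.
Proof.
move=> ht; have t0 : 0 <= t by lra.
suff h k : 13 / 10 * \sum_(0 <= i < 6 + k) bterm 0 t i <= t * bsum 1 t.
  suff : bsum 0 t <= 10 / 13 * (t * bsum 1 t) by lra.
  by apply: (@bsum_le _ _ _ 6) => k; have := h k; lra.
apply: (le_trans _ (ler_wpM2l t0 (@bsum_ge_partial _ 1 t (5 + k) t0))).
have -> : t * \sum_(0 <= i < 5 + k) bterm 1 t i =
    \sum_(0 <= i < 6 + k) i%:R * bterm 0 t i.
  rewrite (big_nat_recl (5 + k))//= mul0r add0r mulr_sumr.
  by apply: eq_bigr => i _; exact: shift_term.
elim: k => [|k IH].
  rewrite addn0; have := ratio_pos ht; rewrite bsum6E/=; last by left.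
  rewrite big_mkord !big_ord_recr big_ord0 /= !btermS /bterm /= !fact0 ?mul1n ?addn0 !expr0 !natrM.
  lra.
rewrite addnS !(big_nat_recr (6 + k))//= mulrDr lerD//.
by rewrite ler_wpM2r ?bterm_ge0// natrD; have : 0 <= k%:R :> R by []; lra.
Qed.

(** With t = g^2 / 4, a zero forces t >= 63/25 and J_1/J_0 = - I_1/I_0. The constant is then (2 t *
    bsum 1 t / bsum 0 t)^2, at least (2 * 1.3)^2. *)
Lemma plate_zero_bound g : 0 < g -> plate_zero g ->
  676 / 100 <= g ^+ 2 * (besselJ 1 g ^+ 2 / besselJ 0 g ^+ 2).
Proof.
move=> g0; rewrite /plate_zero !besselJE !besselIE !expr0 !expr1 !mul1r => -[b0 /eqP].
set t := (g / 2) ^+ 2.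
have t0 : 0 < t by rewrite exprn_gt0// divr_gt0.
have A1 : 0 < bsum 0 t.
  apply: lt_le_trans (@bsum_ge_partial _ 0 t 1 (ltW t0)).
  by rewrite big_nat1 /bterm expr0 divr1.
have C1 : 0 <= bsum 1 t.
  by apply: le_trans (@bsum_ge_partial _ 1 t 0 (ltW t0)); rewrite big_geq.
rewrite mulf_eq0 [g == 0]gt_eqF// orbF => /eqP e.
have tE : t = g ^+ 2 / 4 by rewrite /t; field.
have A0 : bsum 0 t != 0 by rewrite gt_eqF.
have cross : bsum 1 (- t) * bsum 0 t + bsum 0 (- t) * bsum 1 t = 0.
  apply: (mulfI (x := g / 2 / (bsum 0 (- t) * bsum 0 t))).
    by rewrite mulf_neq0 ?invr_neq0 ?mulf_neq0// ?invr_neq0 ?gt_eqF.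
  rewrite mulr0 -[RHS]e; field.
  by rewrite b0 A0.
have tge : 63 / 25 <= t.
  by rewrite leNgt; apply/negP => /ltW/(bessel_cross_gt0 t0); rewrite cross ltxx.
have := bessel_ratio_ge tge; rewrite -subr_ge0.
have r : bsum 1 (- t) / bsum 0 (- t) = - (bsum 1 t / bsum 0 t).
  apply/eqP; rewrite -subr_eq0 opprK; apply/eqP.
  transitivity ((bsum 1 (- t) * bsum 0 t + bsum 0 (- t) * bsum 1 t) / (bsum 0 (- t) * bsum 0 t)).
    by field; rewrite b0 A0.
  by rewrite cross mul0r.
have -> : g ^+ 2 * ((g / 2 * bsum 1 (- t)) ^+ 2 / bsum 0 (- t) ^+ 2) =
    (2 * (t * (bsum 1 (- t) / bsum 0 (- t)))) ^+ 2.
  rewrite {3}tE; move: (bsum 1 _) (bsum 0 _) b0 => p q q0; field.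
  exact: q0.
rewrite r mulrN mulrN sqrrN => h.
have : 26 / 10 <= 2 * (t * (bsum 1 t / bsum 0 t)).
  by rewrite mulrA mulrA ler_pdivlMr//; lra.
move: (2 * _) => y hy; have : 0 <= (y - 26 / 10) * (y + 26 / 10) by apply: mulr_ge0; lra.
by rewrite expr2; lra.
Qed.

End PlateZero.

(** * Comparison of the constants on the convex set and on the disk *)

Section PlateComparison.
Context {R : realType}.
Notation mR := (measurableTypeR R).
Notation mu2 := (leb2 R).
Implicit Types (Om : set (R * R)) (p c n : R * R) (rho r l tau : R).

(** The three scalar products have a vanishing convex combination, so they cannot all be
    negative. *)
Lemma directions_cover (l1 l2 l3 : R) (n1 n2 n3 : R * R) :
  0 <= l1 -> 0 <= l2 -> 0 <= l3 -> l1 + l2 + l3 = 1 ->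
  l1 * n1.1 + l2 * n2.1 + l3 * n3.1 = 0 -> l1 * n1.2 + l2 * n2.2 + l3 * n3.2 = 0 ->
  forall p, [\/ 0 <= n1.1 * p.1 + n1.2 * p.2, 0 <= n2.1 * p.1 + n2.2 * p.2
    | 0 <= n3.1 * p.1 + n3.2 * p.2].
Proof.
move=> l10 l20 l30 l123 e1 e2 p.
have := leP 0 (n1.1 * p.1 + n1.2 * p.2); case=> [h1|h1]; first exact: Or31.
have := leP 0 (n2.1 * p.1 + n2.2 * p.2); case=> [h2|h2]; first exact: Or32.
have := leP 0 (n3.1 * p.1 + n3.2 * p.2); case=> [h3|h3]; first exact: Or33.
exfalso; move: h1 h2 h3; set a := n1.1 * p.1 + _; set b := n2.1 * p.1 + _.
set d := n3.1 * p.1 + _ => a0 b0 d0.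
have e : l1 * a + l2 * b + l3 * d = 0.
  transitivity ((l1 * n1.1 + l2 * n2.1 + l3 * n3.1) * p.1 +
    (l1 * n1.2 + l2 * n2.2 + l3 * n3.2) * p.2); first by rewrite /a /b /d; ring.
  by rewrite e1 e2 !mul0r addr0.
have z1 : l1 * a <= 0 by rewrite mulr_ge0_le0// ltW.
have z2 : l2 * b <= 0 by rewrite mulr_ge0_le0// ltW.
have z3 : l3 * d <= 0 by rewrite mulr_ge0_le0// ltW.
have zero (x y : R) : y < 0 -> x * y = 0 -> x = 0.
  by move=> y0 /eqP; rewrite mulf_eq0 (lt_eqF y0) orbF => /eqP.
have := zero l1 a a0; have := zero l2 b b0; have := zero l3 d d0.
move=> k3 k2 k1; have : l1 = 0 by apply: k1; lra.
have : l2 = 0 by apply: k2; lra.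
have : l3 = 0 by apply: k3; lra.
lra.
Qed.

(** The margin is (199/400)^2 * (26/5)^2 = 6.692 against 127/19 = 6.684. The factor 199/400 replaces
    1/2 to stay strictly below pi / (2 rho) in Hersch's bound. *)
Lemma membrane_constant rho r : 0 < rho -> 0 < r -> 26 / 5 * rho < pi * r ->
  127 / 19 / r ^+ 2 <= (199 / 400 * pi / rho) ^+ 2.
Proof.
move=> rho0 r0 h.
have r2 : 0 < r ^+ 2 by rewrite exprn_gt0.
have rho2 : 0 < rho ^+ 2 by rewrite exprn_gt0.
have {}h : (26 / 5) ^+ 2 * rho ^+ 2 <= pi ^+ 2 * r ^+ 2.
  by rewrite -!exprMn lerXn2r ?nnegrE ?ltW// ?mulr_gt0// ?pi_gt0// divr_gt0.
have -> : (199 / 400 * pi / rho) ^+ 2 = (199 / 400) ^+ 2 * pi ^+ 2 / rho ^+ 2.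
  by rewrite expr_div_n (exprMn 2 (199 / 400)).
rewrite ler_pdivrMr// mulrAC ler_pdivlMr// -(mulrA ((199 / 400) ^+ 2)).
move: h rho2; move: (rho ^+ 2) (pi ^+ 2 * r ^+ 2) => s w; lra.
Qed.

(** From pi <= 3.15 one gets r >= 1.65 rho, hence l r >= 0.7 rho since 0.43 * 1.65 = 0.7095, and 28
    * 16 * 0.7^4 = 107.5 exceeds 534/5 = 106.8. *)
Lemma clamped_constant rho r l : 0 < rho -> 0 < r -> 26 / 5 * rho < pi * r ->
  43 / 100 <= l -> 534 / 5 / r ^+ 4 <= 28 * (2 / (rho / l)) ^+ 4.
Proof.
move=> rho0 r0 h hl.
have h1 : 33 / 20 * rho <= r.
  have := ler_wpM2r (ltW r0) (@pi_le R); lra.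
have h2 : 7 / 10 * rho <= l * r.
  have : 43 / 100 * r <= l * r by rewrite ler_pM2r.
  lra.
have h4 : (7 / 10 * rho) ^+ 4 <= (l * r) ^+ 4.
  by rewrite lerXn2r ?nnegrE//; apply: mulr_ge0; lra.
have r4 : 0 < r ^+ 4 by rewrite exprn_gt0.
have rho4 : 0 < rho ^+ 4 by rewrite exprn_gt0.
have rhon : rho != 0 by rewrite gt_eqF.
have ln : l != 0 by rewrite gt_eqF//; lra.
rewrite ler_pdivrMr//.
have -> : 28 * (2 / (rho / l)) ^+ 4 * r ^+ 4 = 28 * 16 * (l * r) ^+ 4 / rho ^+ 4.
  by field; rewrite rhon ln.
rewrite ler_pdivlMr//; move: h4 rho4; rewrite exprMn.
move: (rho ^+ 4) ((l * r) ^+ 4) => x y; rewrite !exprS expr0; lra.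
Qed.

(** Eliminating P gives K < pi A / (4 rho^2), so pi A > 27.04 rho^2. Dividing by pi <= 3.15 bounds
    the area, and A <= pi r^2 with 27.04 = 5.2^2 bounds the radius. *)
Lemma isoperimetric_gap (K P A rho r : R) : 676 / 100 <= K -> 0 < rho -> 0 < r ->
  0 <= A -> A <= pi * r ^+ 2 -> 0 <= P -> P * rho <= 2 * A ->
  K < pi * P ^+ 2 / (16 * A) ->
  858 / 100 * rho ^+ 2 < A /\ 26 / 5 * rho < pi * r.
Proof.
move=> hK rho0 r0 A0 Ar P0 PA h.
have {A0} A0 : 0 < A.
  (* For A = 0 the quotient is 0 by the convention on inverses, which contradicts K >= 6.76. *)
  rewrite lt_neqAle A0 andbT; apply/negP => /eqP e.
  by move: h; rewrite -e mulr0 invr0 mulr0; lra.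
have rho2 : 0 < rho ^+ 2 by rewrite exprn_gt0.
have pi0 := @pi_gt0 R.
have {h} h : 676 / 100 * (16 * A) < pi * P ^+ 2.
  by rewrite -ltr_pdivlMr ?mulr_gt0//; exact: le_lt_trans h.
have P2 : P ^+ 2 * rho ^+ 2 <= 4 * A ^+ 2.
  have -> : 4 * A ^+ 2 = (2 * A) ^+ 2 by ring.
  by rewrite -exprMn lerXn2r ?nnegrE ?mulr_ge0// ltW.
have gap : 2704 / 100 * rho ^+ 2 < pi * A.
  have h1 : 676 / 100 * (16 * A) * rho ^+ 2 < pi * P ^+ 2 * rho ^+ 2 by rewrite ltr_pM2r.
  have h2 : pi * (P ^+ 2 * rho ^+ 2) <= pi * (4 * A ^+ 2) by rewrite ler_pM2l.
  rewrite -(ltr_pM2r A0); move: h1 h2; rewrite expr2; lra.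
split.
  have := ler_wpM2r (ltW A0) (@pi_le R); lra.
have : (26 / 5 * rho) ^+ 2 < (pi * r) ^+ 2.
  have := ler_wpM2l (ltW pi0) Ar; rewrite !exprMn !expr2; move: gap; rewrite !expr2; lra.
by rewrite ltr_pXn2r// nnegrE mulr_ge0// ltW//; lra.
Qed.

Lemma Gamma_disk_le c r tau : 0 < r -> 0 <= tau ->
  Gamma (open_disk c r) tau <= 534 / 5 / r ^+ 4 + tau * (127 / 19 / r ^+ 2).
Proof.
move=> r0 tau0; have [phi tphi [m0 hd hb]] := disk_trial c r0.
apply: (le_trans (Gamma_le (@measurable_open_disk R c r) tau0 tphi m0)).
have r2 : 0 < r ^+ 2 by rewrite exprn_gt0.
have r4 : 0 < r ^+ 4 by rewrite exprn_gt0.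
rewrite ler_pdivrMr// mulrDl lerD//.
  by rewrite mulrAC ler_pdivlMr// mulrC.
by rewrite -(mulrA tau) ler_wpM2l// mulrAC ler_pdivlMr// mulrC.
Qed.

Lemma test_function_sub Om Om' phi : Om `<=` Om' -> test_function Om phi ->
  test_function Om' phi.
Proof. by move=> sub [? ? h]; split=> //; exact: subset_trans h sub. Qed.

Lemma Gamma_triangle_ge Om p rho (n1 n2 n3 : R * R) (l1 l2 l3 : R) r tau :
  measurable (Om : set (mR * mR)) -> 0 <= tau -> 0 < rho -> 0 < r ->
  26 / 5 * rho < pi * r -> ((858 / 100 * rho ^+ 2)%:E < mu2 Om)%E ->
  open_disk p rho `<=` Om ->
  n1.1 ^+ 2 + n1.2 ^+ 2 = 1 -> n2.1 ^+ 2 + n2.2 ^+ 2 = 1 -> n3.1 ^+ 2 + n3.2 ^+ 2 = 1 ->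
  0 <= l1 -> 0 <= l2 -> 0 <= l3 -> l1 + l2 + l3 = 1 ->
  l1 * n1.1 + l2 * n2.1 + l3 * n3.1 = 0 -> l1 * n1.2 + l2 * n2.2 + l3 * n3.2 = 0 ->
  (forall x, Om x -> [/\ n1.1 * (x.1 - p.1) + n1.2 * (x.2 - p.2) < rho,
    n2.1 * (x.1 - p.1) + n2.2 * (x.2 - p.2) < rho
    & n3.1 * (x.1 - p.1) + n3.2 * (x.2 - p.2) < rho]) ->
  534 / 5 / r ^+ 4 + tau * (127 / 19 / r ^+ 2) <= Gamma Om tau.
Proof.
move=> mOm tau0 rho0 r0 gap hA diskOm u1 u2 u3 l10 l20 l30 l123 e1 e2 sup.
apply: (Gamma_ge mOm tau0).
- by apply: divr_ge0; [lra|rewrite exprn_ge0// ltW].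
- by apply: divr_ge0; [lra|rewrite exprn_ge0// ltW].
- move=> phi tphi.
  have [n [l [un hl strip]]] :=
    supporting_strip mOm rho0 hA u1 u2 u3 l10 l20 l30 l123 e1 e2 sup.
  have l0 : 0 < l by lra.
  have ba : rho - - (1 - l) / l * rho = rho / l by field; rewrite gt_eqF.
  have ab : - (1 - l) / l * rho < rho by rewrite -subr_gt0 ba divr_gt0.
  have [M box] := test_function_box tphi.
  have [sphi _ _] := tphi.
  have out s q : ~~ (- (1 - l) / l * rho < n.1 * (q.1 - p.1) + n.2 * (q.2 - p.2) < rho) ->
      partials s phi q = 0.
    by move=> h; apply: (test_function_supp _ tphi) => /strip; apply/negP.
  have := clamped_strip sphi box un ab out; rewrite ba; apply: le_trans.
  rewrite lee_wpmul2r ?lee_fin ?clamped_constant//.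
  by apply: integral_ge0 => q _; rewrite lee_fin sqr_ge0.
- move=> phi tphi; have [sphi _ _] := tphi.
  have cover := directions_cover l10 l20 l30 l123 e1 e2.
  have k0 : 0 < 199 / 400 * pi / rho by apply: divr_gt0 rho0; have := @pi_gt0 R; lra.
  have krho : 199 / 400 * pi / rho * rho < pi / 2.
    by rewrite divfK ?gt_eqF//; have := @pi_gt0 R; lra.
  have H := hersch sphi u1 u2 u3 cover _ _ _ k0 krho.
  apply: (le_trans _ (H p _ _ _)).
  + rewrite lee_wpmul2r ?lee_fin ?membrane_constant//.
    by apply: integral_ge0 => q _; rewrite lee_fin sqr_ge0.
  + move=> q h; apply: (@test_function_supp _ _ _ [::] _ tphi) => /sup[+ _ _].
    by rewrite ltNge h.
  + move=> q h; apply: (@test_function_supp _ _ _ [::] _ tphi) => /sup[_ + _].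
    by rewrite ltNge h.
  + move=> q h; apply: (@test_function_supp _ _ _ [::] _ tphi) => /sup[_ _ +].
    by rewrite ltNge h.
- have [phi tphi [m0 _ _]] := disk_trial p rho0.
  by exists phi => //; exact: test_function_sub tphi.
Qed.

End PlateComparison.

Theorem corollary3p5 (R : realType) (gamma0 : R)
    (hgamma0 : smallest_positive_plate_zero gamma0)
    (Omega : set (R * R)) (hopen : open Omega) (hbounded : bounded_set Omega)
    (hconvex : convex_set Omega)
    (c : R * R) (r : R) (hr : 0 < r)
    (harea : leb2 R (open_disk c r) = leb2 R Omega)
    (tau : R) (htau : 0 <= tau)
    (hperimeter : pi * perimeter Omega ^+ 2 / (16 * area Omega) >
       gamma0 ^+ 2 * (besselJ 1 gamma0 ^+ 2 / besselJ 0 gamma0 ^+ 2)) :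
  Gamma Omega tau >= Gamma (open_disk c r) tau.
Proof.
have g0 : 0 < gamma0 by case: hgamma0.
have zero : plate_zero gamma0 by case: hgamma0.
have hK := plate_zero_bound g0 zero.
have mOm := open_measurable2 hopen.
have fin : (leb2 R Omega < +oo)%E.
  by rewrite -harea (le_lt_trans (area_disk_le c hr))// ltry.
have areaE : leb2 R Omega = (area Omega)%:E by rewrite fineK// ge0_fin_numE.
have area0 : 0 <= area Omega by rewrite fine_ge0.
have area_le : area Omega <= pi * r ^+ 2.
  by rewrite -lee_fin -areaE -harea area_disk_le.
(* An empty [Omega] has area 0, so the quotient in [hperimeter] is 0 by convention and cannot exceed
   a constant that is at least 6.76. *)
have ne : Omega !=set0.
  apply/set0P/negP => /eqP e; move: hperimeter.
  by rewrite /area e measure0 mulr0 invr0 mulr0 => h; lra.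
have [p [rho [n1 [n2 [n3 [l1 [l2 [l3 [rho0 inner [u1 u2 u3] [[l10 l20 l30] l123 e1 e2] sup]]]]]]]]] :=
  supporting_triangle hopen hbounded (convex_planeP hconvex) ne.
have disk q : dist2 q p < rho ^+ 2 -> Omega q.
  by move=> h; apply: contrapT => /inner; rewrite leNgt h.
have [P0 PA] := perimeter_bounds mOm fin (convex_planeP hconvex) rho0 disk.
have [gapA gap] := isoperimetric_gap hK rho0 hr area0 area_le P0 PA hperimeter.
apply: le_trans (Gamma_disk_le c hr htau) _.
apply: (Gamma_triangle_ge mOm htau rho0 hr gap _ disk u1 u2 u3 l10 l20 l30 l123 e1 e2 sup).
by rewrite areaE lte_fin.
Qed.
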